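(* Let $n\ge2$, let $r_1,\dots,r_n\in(-1,1)$ be distinct real points and let $s_1,\dots,s_n\in\mathbb B$, where $\mathbb B$ is the open quaternionic unit ball. Let $Q_\kappa^\ell$ ($1\le\kappa\le n-1$, $\kappa+1\le\ell\le n$) be the quantities attached to these data as defined in the context. There exists a slice regular function $f:\mathbb B\to\mathbb B$ such that $f(r_m)=s_m$ for all $m=1,\dots,n$ if and only if $Q_{n-1}^n$ is a quaternion of modulus less than or equal to one. If $|Q_{n-1}^n|<1$, then there is an infinite family of solutions, while if $|Q_{n-1}^n|=1$ there exists a unique solution, given by a regular Blaschke product.
   Context: $\mathbb H$ is the skew-field of quaternions, $\mathbb B=\{q\in\mathbb H:|q|<1\}$, $\partial\mathbb B=\{|q|=1\}$, $\mathbb S=\{I\in\mathbb H:I^2=-1\}$, $\mathbb C_I=\mathbb R+\mathbb RI$. A function $f:\mathbb B\to\mathbb H$ is slice regular if it has continuous partial derivatives and $\frac12(\partial_x+I\partial_y)f(x+yI)=0$ on $\mathbb B\cap\mathbb C_I$ for every $I\in\mathbb S$; equivalently $f(q)=\sum_{m\ge0}q^ma_m$ with $a_m\in\mathbb H$, converging on $\mathbb B$. For $f=\sum q^ma_m$, $g=\sum q^mb_m$: $f\ast g=\sum_m q^m\sum_{\ell=0}^m a_{m-\ell}b_\ell$, $f^c=\sum q^m\overline{a_m}$, $f^s=f\ast f^c$, $f^{-\ast}(q)=f^s(q)^{-1}f^c(q)$ off the zero set of $f^s$. For $p\in\mathbb B$: $M_p(q)=(1-q\overline p)^{-1}(q-p)$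 (pointwise product) and $\mathcal M_p(q)=(1-q\overline p)^{-\ast}\ast(q-p)$. A regular (finite) Blaschke product is a function $\mathcal M_{t_1}\ast\cdots\ast\mathcal M_{t_\kappa}u$ with $\kappa\ge1$, $t_1,\dots,t_\kappa\in\mathbb B$, $|u|=1$. Quantities $Q_\kappa^\ell$: $Q_1^m:=M_{r_1}(r_m)^{-1}M_{s_1}(s_m)$ for $m=2,\dots,n$, and for $\kappa=2,\dots,n-1$, $\ell=\kappa+1,\dots,n$, $$Q_\kappa^\ell:=\begin{cases}M_{r_\kappa}(r_\ell)^{-1}M_{Q_{\kappa-1}^\kappa}(Q_{\kappa-1}^\ell)&\text{if }Q_{\kappa-1}^\kappa,Q_{\kappa-1}^\ell\in\mathbb B,\\ Q_{\kappa-1}^\kappa&\text{if }Q_{\kappa-1}^\kappa=Q_{\kappa-1}^\ell\in\partial\mathbb B,\\ \infty&\text{otherwise.}\end{cases}$$ Here $\infty$ is only a conventional symbol, not a quaternion. *)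

(* Defs.v *)
From Stdlib Require Import Reals List ClassicalEpsilon.
From Coquelicot Require Import Coquelicot.
Open Scope R_scope.

(** [(a, b, c, d)] stands for a + bi + cj + dk.  As a real normed space this is
    Coquelicot's iterated product, whose [norm] is the Euclidean one. *)
Definition quat : Type := (R * R * R * R)%type.

Definition RtoQ (x : R) : quat := (x, 0, 0, 0).
Coercion RtoQ : R >-> quat.

Definition qplus (p q : quat) : quat :=
  let '(a, b, c, d) := p in let '(a', b', c', d') := q in
  (a + a', b + b', c + c', d + d').

Definition qopp (q : quat) : quat :=
  let '(a, b, c, d) := q in (- a, - b, - c, - d).

Definition qmult (p q : quat) : quat :=
  let '(a, b, c, d) := p in let '(a', b', c', d') := q in
  (a * a' - b * b' - c * c' - d * d',
   a * b' + b * a' + c * d' - d * c',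
   a * c' - b * d' + c * a' + d * b',
   a * d' + b * c' - c * b' + d * a').

Definition qconj (q : quat) : quat :=
  let '(a, b, c, d) := q in (a, - b, - c, - d).

Definition qmod (q : quat) : R :=
  let '(a, b, c, d) := q in sqrt (a ^ 2 + b ^ 2 + c ^ 2 + d ^ 2).

Definition qinv (q : quat) : quat := qmult (RtoQ (/ qmod q ^ 2)) (qconj q).

Declare Scope quat_scope.
Delimit Scope quat_scope with Q.
Bind Scope quat_scope with quat.
Notation "p + q" := (qplus p q) : quat_scope.
Notation "- q" := (qopp q) : quat_scope.
Notation "p - q" := (qplus p (qopp q)) : quat_scope.
Notation "p * q" := (qmult p q) : quat_scope.
Notation "/ q" := (qinv q) : quat_scope.

Fixpoint qpow (q : quat) (m : nat) : quat :=
  match m with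
  | O => RtoQ 1
  | S m' => (q * qpow q m')%Q
  end.

Definition inB (q : quat) : Prop := qmod q < 1.
Definition in_bdB (q : quat) : Prop := qmod q = 1.
Definition inS (I : quat) : Prop := (I * I)%Q = RtoQ (-1).

Definition slice (I : quat) (x y : R) : quat := (RtoQ x + RtoQ y * I)%Q.

(** Functions on B are represented by total functions whose values outside B
    are irrelevant.  [fx] and [fy] are the partial derivatives of the
    restriction of [f] to the slice through [I]. *)
Definition slice_regular (f : quat -> quat) : Prop :=
  forall I : quat, inS I ->
  exists fx fy : R -> R -> quat,
  forall x y : R, inB (slice I x y) ->
    is_derive (fun t : R => f (slice I t y)) x (fx x y) /\
    is_derive (fun t : R => f (slice I x t)) y (fy x y) /\
    continuous (fun z : R * R => fx (fst z) (snd z)) (x, y) /\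
    continuous (fun z : R * R => fy (fst z) (snd z)) (x, y) /\
    (RtoQ (/ 2) * (fx x y + I * fy x y))%Q = RtoQ 0.

Definition has_expansion (f : quat -> quat) (a : nat -> quat) : Prop :=
  forall q : quat, inB q -> is_series (fun m : nat => (qpow q m * a m)%Q) (f q).

(** The power series coefficients of [f] (junk if [f] has no expansion on B). *)
Definition coeffs (f : quat -> quat) : nat -> quat :=
  epsilon (inhabits (fun _ : nat => RtoQ 0)) (has_expansion f).

Definition qSeries (u : nat -> quat) : quat :=
  (Series (fun m => let '(a, _, _, _) := u m in a),
   Series (fun m => let '(_, b, _, _) := u m in b),
   Series (fun m => let '(_, _, c, _) := u m in c),
   Series (fun m => let '(_, _, _, d) := u m in d)).

Definition qPSeries (a : nat -> quat) (q : quat) : quat :=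
  qSeries (fun m : nat => (qpow q m * a m)%Q).

Definition star (f g : quat -> quat) : quat -> quat :=
  qPSeries (fun m : nat =>
    sum_n (fun l : nat => (coeffs f (m - l)%nat * coeffs g l)%Q) m).

Definition reg_conj (f : quat -> quat) : quat -> quat :=
  qPSeries (fun m : nat => qconj (coeffs f m)).

Definition symmetrization (f : quat -> quat) : quat -> quat :=
  star f (reg_conj f).

Definition star_inv (f : quat -> quat) : quat -> quat :=
  fun q => (/ symmetrization f q * reg_conj f q)%Q.

Definition moebius (p q : quat) : quat :=
  (/ (RtoQ 1 - q * qconj p) * (q - p))%Q.

Definition reg_moebius (p : quat) : quat -> quat :=
  star (star_inv (fun q => RtoQ 1 - q * qconj p)%Q) (fun q => q - p)%Q.

(** The head [t1] is kept apart from the tail [ts] so that there is always at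
    least one factor. *)
Definition regular_Blaschke (f : quat -> quat) : Prop :=
  exists (t1 : quat) (ts : list quat) (u : quat),
    inB t1 /\ List.Forall inB ts /\ qmod u = 1 /\
    forall q : quat, inB q ->
      f q = (fold_left (fun g t => star g (reg_moebius t)) ts
               (reg_moebius t1) q * u)%Q.

(** [Qval r s kappa l] is Q_kappa^l for kappa >= 1, with [None] for the symbol
    infinity; the data are indexed from 1, and the value at kappa = 0 is junk. *)
Fixpoint Qval (r : nat -> R) (s : nat -> quat) (kappa l : nat) : option quat :=
  match kappa with
  | O => None
  | S O => Some (/ moebius (r 1%nat) (r l) * moebius (s 1%nat) (s l))%Q
  | S k =>
      match Qval r s k kappa, Qval r s k l with
      | Some a, Some b =>
          if excluded_middle_informative (inB a /\ inB b) then
            Some (/ moebius (r kappa) (r l) * moebius a b)%Q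
          else if excluded_middle_informative (a = b /\ in_bdB a) then Some a
          else None
      | _, _ => None
      end
  end.

Definition solution (n : nat) (r : nat -> R) (s : nat -> quat)
    (f : quat -> quat) : Prop :=
  slice_regular f /\
  (forall q : quat, inB q -> inB (f q)) /\
  (forall m : nat, (1 <= m <= n)%nat -> f (r m) = s m).

(* Main.v *)
Require Import Defs.
From Stdlib Require Import Reals List Lra Lia Psatz.
From Stdlib Require Import FunctionalExtensionality ClassicalEpsilon.
From Stdlib Require Ncring Ncring_tac.
From mathcomp Require all_boot all_order all_algebra complex Rstruct.
From Coquelicot Require Import Coquelicot.
Open Scope R_scope.

(** A slice regular map of the ball into itself is a power series in [q] with
    coefficients on the right, and evaluation at a real point is a ring homomorphism
    for the product that makes the variable commute with the coefficients. So the
    problem is transferred to the ring of power series with a central variable.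

    There, being bounded by one is expressed by [contractive]: the lower triangular
    operator of left multiplication has norm at most one on square-summable
    sequences. That slice regular self-maps of the ball have contractive series needs
    the power series expansion ([slice_regular_expansion], by a Cauchy integral on
    each slice) and an average over roots of unity of the products of stem functions
    ([bounded_contractive]); multiplication by a stem value has operator norm the
    supremum of the modulus over all slices ([stem_product_le]). Conversely a
    contractive series takes values in the closed ball, by testing it on a geometric
    sequence, and a value of modulus one makes it constant ([test_inequality],
    [contractive_unimodular]); its sum is slice regular
    ([power_series_slice_regular]).

    For contractive series a Schur step is algebra. If [F] takes the value [a] inside
    the ball at the real point [r], the Moebius transformation of [F] that sends [a]
    to zero is again contractive and divisible by the Blaschke factor of [r], and
    dividing leaves a contractive [F'] ([schur_down]); every contractive [F'] arises
    ([schur_up]), and [F], [F'] determine each other. As a real point is central, the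
    values of [F] and [F'] at the other points are related by the Moebius
    transformations in the recursion for the quantities Q ([schur_value_moebius]).
    Hence [F] solves the problem for the data if and only if what is left after [k]
    steps solves the problem for the Q of step [k] ([level_down], [level_up]), where
    a unimodular value corresponds to a constant series. After [n - 1] steps a single
    point is left, and the datum there is the last Q. A solution exists exactly if its
    modulus is at most one; if it is less than one, a further step has an arbitrary
    contractive series as its result, in particular infinitely many constants; if it
    is one, the series is constant, and so the solution is unique.

    In that last case the solution is a Blaschke product. Undoing the steps from a
    unimodular constant gives a series [F] that is both the left fraction [A^-1 B] of
    two polynomials and the right fraction of the reversed polynomials
    ([inner_pair_schur]). The numerator has a quaternionic zero, by the fundamental
    theorem of algebra ([poly_root]); it is either a common factor or produces a
    Blaschke factor of [F], and dividing lowers the degree ([inner_pair_reduce]). *)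

(** * Quaternion algebra *)

Ltac qdestruct :=
  repeat match goal with
  | |- context [?t] =>
    lazymatch type of t with quat => idtac end; is_var t;
    generalize t; intros [[[? ?] ?] ?]
  end.
(* Replaces by variables the quaternions that the ring operations do not build. *)
Ltac qgeneralize :=
  repeat match goal with
  | |- context [?t] =>
    lazymatch type of t with quat => idtac end;
    lazymatch t with
    | qplus _ _ => fail | qopp _ => fail | qmult _ _ => fail
    | qconj _ => fail | RtoQ _ => fail | (_, _) => fail
    | _ => tryif is_var t then fail else (generalize t; intro)
    end
  end.
Ltac qunfold := unfold qplus, qopp, qmult, qconj, RtoQ.
Ltac qring :=
  intros; qgeneralize; qdestruct; qunfold; repeat apply injective_projections; simpl; ring.

Lemma qplusC p q : (p + q)%Q = (q + p)%Q. Proof. qring. Qed.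
Lemma qplusA p q w : (p + (q + w))%Q = (p + q + w)%Q. Proof. qring. Qed.
Lemma qmultA p q w : (p * (q * w))%Q = (p * q * w)%Q. Proof. qring. Qed.
Lemma qplus0l q : (RtoQ 0 + q)%Q = q. Proof. qring. Qed.
Lemma qplus0r q : (q + RtoQ 0)%Q = q. Proof. qring. Qed.
Lemma qmult1l q : (RtoQ 1 * q)%Q = q. Proof. qring. Qed.
Lemma qmult1r q : (q * RtoQ 1)%Q = q. Proof. qring. Qed.
Lemma qmult0l q : (RtoQ 0 * q)%Q = RtoQ 0. Proof. qring. Qed.
Lemma qmult0r q : (q * RtoQ 0)%Q = RtoQ 0. Proof. qring. Qed.
Lemma qmultDl p q w : ((p + q) * w)%Q = (p * w + q * w)%Q. Proof. qring. Qed.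
Lemma qmultDr p q w : (w * (p + q))%Q = (w * p + w * q)%Q. Proof. qring. Qed.
Lemma qplusN q : (q + - q)%Q = RtoQ 0. Proof. qring. Qed.
Lemma qconjK q : qconj (qconj q) = q. Proof. qring. Qed.
Lemma qconjM p q : qconj (p * q) = (qconj q * qconj p)%Q. Proof. qring. Qed.
Lemma qconjD p q : qconj (p + q) = (qconj p + qconj q)%Q. Proof. qring. Qed.
Lemma qconjR (x : R) : qconj (RtoQ x) = RtoQ x. Proof. qring. Qed.
Lemma qrealC (x : R) q : (RtoQ x * q)%Q = (q * RtoQ x)%Q. Proof. qring. Qed.
Lemma RtoQM x y : RtoQ (x * y) = (RtoQ x * RtoQ y)%Q. Proof. qring. Qed.
Lemma RtoQD x y : RtoQ (x + y) = (RtoQ x + RtoQ y)%Q. Proof. qring. Qed.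

(** The squared modulus, which unlike [qmod] is polynomial in the coordinates,
    and the Euclidean inner product. *)
Definition qn (q : quat) : R :=
  let '(a, b, c, d) := q in a * a + b * b + c * c + d * d.

Definition qdot (p q : quat) : R :=
  let '(a, b, c, d) := p in let '(a', b', c', d') := q in
  a * a' + b * b' + c * c' + d * d'.

Ltac qreal :=
  intros; cbv beta; match goal with |- _ ?a ?b => change (@eq R a b) end; qgeneralize; qdestruct; unfold qn, qdot; qunfold; simpl; ring.

Lemma qmod_sqrt q : qmod q = sqrt (qn q).
Proof. destruct q as [[[a b] c] d]; simpl; f_equal; ring. Qed.

Lemma qn_ge0 q : 0 <= qn q.
Proof. destruct q as [[[a b] c] d]; simpl; nra. Qed.

Lemma qmod_ge0 q : 0 <= qmod q.
Proof. rewrite qmod_sqrt; apply sqrt_pos. Qed.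

Lemma qmod_sqr q : qmod q * qmod q = qn q.
Proof. rewrite qmod_sqrt; apply sqrt_sqrt, qn_ge0. Qed.

Lemma qnM p q : qn (p * q) = qn p * qn q. Proof. qreal. Qed.
Lemma qn_conj q : qn (qconj q) = qn q. Proof. qreal. Qed.
Lemma qnN q : qn (- q) = qn q. Proof. qreal. Qed.
Lemma qnR x : qn (RtoQ x) = x * x. Proof. qreal. Qed.
Lemma qnD p q : qn (p + q) = qn p + qn q + 2 * qdot p q. Proof. qreal. Qed.
Lemma qnB p q : qn (p - q) = qn p + qn q - 2 * qdot p q. Proof. qreal. Qed.
Lemma qdot_self q : qn q = qdot q q. Proof. qreal. Qed.
Lemma qdotC p q : qdot p q = qdot q p. Proof. qreal. Qed.
Lemma qdot_conj_l p q w : qdot (p * q) w = qdot q (qconj p * w). Proof. qreal. Qed.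
Lemma qdotNl p q : qdot (- p) q = - qdot p q. Proof. qreal. Qed.
Lemma qdotDl p q w : qdot (p + q) w = qdot p w + qdot q w. Proof. qreal. Qed.
Lemma qdotDr p q w : qdot w (p + q) = qdot w p + qdot w q. Proof. qreal. Qed.
Lemma qconj_mult q : (qconj q * q)%Q = RtoQ (qn q).
Proof. unfold qn; qring. Qed.
Lemma qmult_conj q : (q * qconj q)%Q = RtoQ (qn q).
Proof. unfold qn; qring. Qed.

Lemma qn0 q : qn q = 0 -> q = RtoQ 0.
Proof.
destruct q as [[[a b] c] d]; simpl; intros h; unfold RtoQ.
repeat apply injective_projections; simpl; nra.
Qed.

Lemma qmodM p q : qmod (p * q) = qmod p * qmod q.
Proof. rewrite !qmod_sqrt, qnM; apply sqrt_mult; apply qn_ge0. Qed.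

Lemma qmod_conj q : qmod (qconj q) = qmod q.
Proof. now rewrite !qmod_sqrt, qn_conj. Qed.

Lemma qmodN q : qmod (- q) = qmod q.
Proof. now rewrite !qmod_sqrt, qnN. Qed.

Lemma qmodR x : qmod (RtoQ x) = Rabs x.
Proof. rewrite qmod_sqrt, qnR; apply sqrt_Rsqr_abs. Qed.

Lemma qmod0 q : qmod q = 0 -> q = RtoQ 0.
Proof. intros h; apply qn0; rewrite <- qmod_sqr, h; ring. Qed.

Lemma qdot_le p q : qdot p q <= qmod p * qmod q.
Proof.
assert (h : qdot p q * qdot p q <= (qmod p * qmod q) * (qmod p * qmod q)).
{ replace (qmod p * qmod q * (qmod p * qmod q))
    with ((qmod p * qmod p) * (qmod q * qmod q)) by ring.
  rewrite !qmod_sqr; destruct p as [[[a b] c] d], q as [[[a' b'] c'] d']; simpl.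
  apply Rminus_le_0.
  replace (_ - _) with
   ((a * b' - b * a') ^ 2 + (a * c' - c * a') ^ 2 + (a * d' - d * a') ^ 2
   + (b * c' - c * b') ^ 2 + (b * d' - d * b') ^ 2 + (c * d' - d * c') ^ 2) by ring.
  repeat apply Rplus_le_le_0_compat; apply pow2_ge_0. }
apply Rsqr_incr_0_var; [exact h|].
apply Rmult_le_pos; apply qmod_ge0.
Qed.

Lemma qmod_triangle p q : qmod (p + q) <= qmod p + qmod q.
Proof.
pose proof (qmod_ge0 p); pose proof (qmod_ge0 q); pose proof (qmod_ge0 (p + q)).
pose proof (qdot_le p q).
assert (qmod (p + q) * qmod (p + q) <= (qmod p + qmod q) * (qmod p + qmod q)).
{ rewrite qmod_sqr, qnD, <- !qmod_sqr; nra. }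
apply Rsqr_incr_0_var; [easy|lra].
Qed.

Lemma qmod_triangle_sub p q : qmod (p - q) <= qmod p + qmod q.
Proof. rewrite <- (qmodN q); apply qmod_triangle. Qed.

Lemma qmod_lt1 q : qmod q < 1 <-> qn q < 1.
Proof. rewrite <- qmod_sqr; pose proof (qmod_ge0 q); split; nra. Qed.

Lemma qmod_le1 q : qmod q <= 1 <-> qn q <= 1.
Proof. rewrite <- qmod_sqr; pose proof (qmod_ge0 q); split; nra. Qed.

Lemma qmod_eq1 q : qmod q = 1 <-> qn q = 1.
Proof. rewrite <- qmod_sqr; pose proof (qmod_ge0 q); split; nra. Qed.

Lemma qinv_l q : q <> RtoQ 0 -> (/ q * q)%Q = RtoQ 1.
Proof.
intros h; assert (qn q <> 0) by (intros e; apply h; now apply qn0).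
unfold qinv; rewrite <- qmultA, qconj_mult, <- RtoQM; f_equal.
rewrite <- qmod_sqr in *; field; nra.
Qed.

Lemma qinv_r q : q <> RtoQ 0 -> (q * / q)%Q = RtoQ 1.
Proof.
intros h; assert (qn q <> 0) by (intros e; apply h; now apply qn0).
unfold qinv; rewrite qmultA, <- qrealC, <- qmultA, qmult_conj, <- RtoQM; f_equal.
rewrite <- qmod_sqr in *; field; nra.
Qed.

Lemma qmult_eq0 p q : (p * q)%Q = RtoQ 0 -> p <> RtoQ 0 -> q = RtoQ 0.
Proof.
intros h hp; rewrite <- (qmult1l q), <- (qinv_l p hp), <- qmultA, h; apply qmult0r.
Qed.

Lemma qmult_cancel_l p q w : p <> RtoQ 0 -> (p * q = p * w)%Q -> q = w.
Proof.
intros hp h.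
now rewrite <- (qmult1l q), <- (qinv_l p hp), <- qmultA, h, qmultA, qinv_l, qmult1l.
Qed.

Lemma qmult_cancel_r p q w : p <> RtoQ 0 -> (q * p = w * p)%Q -> q = w.
Proof.
intros hp h.
now rewrite <- (qmult1r q), <- (qinv_r p hp), qmultA, h, <- qmultA, qinv_r, qmult1r.
Qed.

Lemma qsub_eq0 p q : (p - q)%Q = RtoQ 0 -> p = q.
Proof.
intros h; replace p with (p - q + q)%Q by qring; rewrite h; apply qplus0l.
Qed.

Lemma RtoQ_inj x y : RtoQ x = RtoQ y -> x = y.
Proof. intros h; injection h; auto. Qed.

Arguments qmod : simpl never.
Arguments qmult : simpl never.
Arguments qplus : simpl never.
Arguments qopp : simpl never.
Arguments RtoQ : simpl never.
Arguments qn : simpl never.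
Arguments qdot : simpl never.

Lemma qmod_pow q m : qmod (qpow q m) = qmod q ^ m.
Proof.
induction m as [|m IH]; simpl.
- rewrite qmodR; apply Rabs_R1.
- now rewrite qmodM, IH.
Qed.

Lemma qpow_comm q m : (q * qpow q m = qpow q m * q)%Q.
Proof.
induction m as [|m IH]; simpl; [qring|].
now rewrite <- qmultA, IH.
Qed.

Lemma qpow_real (x : R) m : qpow (RtoQ x) m = RtoQ (x ^ m).
Proof. induction m as [|m IH]; simpl; [easy|]; now rewrite IH, RtoQM. Qed.

(** * Power series with a central variable *)

(** Sequences of coefficients. The variable commutes with the coefficients, so that
    the product below is the one that defines the regular product of functions. *)
Definition fps : Type := nat -> quat.

Definition fC (c : quat) : fps := fun m => match m with O => c | _ => RtoQ 0 end.
Definition fX : fps := fun m => match m with 1%nat => RtoQ 1 | _ => RtoQ 0 end.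
Definition fadd (a b : fps) : fps := fun m => (a m + b m)%Q.
Definition fopp (a : fps) : fps := fun m => (- a m)%Q.
Definition fsub (a b : fps) : fps := fun m => (a m - b m)%Q.
Definition shift (a : fps) : fps := fun m => match m with O => RtoQ 0 | S k => a k end.

Fixpoint qsum (u : nat -> quat) (n : nat) : quat :=
  match n with O => RtoQ 0 | S k => (qsum u k + u k)%Q end.

Definition fmul (a b : fps) : fps :=
  fun m => qsum (fun l => (a (m - l)%nat * b l)%Q) (S m).

Declare Scope fps_scope.
Delimit Scope fps_scope with fps.
Bind Scope fps_scope with fps.
Notation "a + b" := (fadd a b) : fps_scope.
Notation "a - b" := (fsub a b) : fps_scope.
Notation "- a" := (fopp a) : fps_scope.
Notation "a * b" := (fmul a b) : fps_scope.

Lemma qsum_ext u v n : (forall k, (k < n)%nat -> u k = v k) -> qsum u n = qsum v n.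
Proof.
induction n as [|n IH]; simpl; intros h; [easy|].
rewrite IH, h; auto.
Qed.

Lemma qsum_add u v n : qsum (fun k => u k + v k)%Q n = (qsum u n + qsum v n)%Q.
Proof. induction n as [|n IH]; simpl; [|rewrite IH]; qring. Qed.

Lemma qsum_mul_l c u n : qsum (fun k => c * u k)%Q n = (c * qsum u n)%Q.
Proof. induction n as [|n IH]; simpl; [|rewrite IH]; qring. Qed.

Lemma qsum_mul_r c u n : qsum (fun k => u k * c)%Q n = (qsum u n * c)%Q.
Proof. induction n as [|n IH]; simpl; [|rewrite IH]; qring. Qed.

Lemma qsum_0 u n : (forall k, (k < n)%nat -> u k = RtoQ 0) -> qsum u n = RtoQ 0.
Proof.
induction n as [|n IH]; simpl; intros h; [easy|].
rewrite IH, h; auto using qplus0l.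
Qed.

Lemma qsum_head u n : qsum u (S n) = (u 0%nat + qsum (fun k => u (S k)) n)%Q.
Proof.
induction n as [|n IH]; [simpl; qring|].
change (qsum u (S (S n))) with (qsum u (S n) + u (S n))%Q; rewrite IH; simpl.
now rewrite qplusA.
Qed.

Lemma qsum_triangle (f : nat -> nat -> quat) n :
  qsum (fun i => qsum (fun j => f i j) (S i)) n =
  qsum (fun j => qsum (fun i => f (j + i)%nat j) (n - j)) n.
Proof.
induction n as [|n IH]; [easy|].
transitivity (qsum (fun i => qsum (fun j => f i j) (S i)) n
  + (qsum (fun j => f n j) n + f n n))%Q; [easy|].
transitivity (qsum (fun j => qsum (fun i => f (j + i)%nat j) (S n - j)) n
  + qsum (fun i => f (n + i)%nat n) (S n - n))%Q; [|easy].
replace (S n - n)%nat with 1%nat by lia; simpl (qsum _ 1).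
rewrite IH, Nat.add_0_r, qplus0l, qplusA; f_equal.
rewrite <- qsum_add; apply qsum_ext; intros k hk.
replace (S n - k)%nat with (S (n - k)) by lia; simpl qsum.
now replace (k + (n - k))%nat with n by lia.
Qed.

Lemma fmulA a b c : (a * (b * c) = a * b * c)%fps.
Proof.
apply functional_extensionality; intros m; unfold fmul.
transitivity (qsum (fun i => qsum (fun j => a (m - i)%nat * (b (i - j)%nat * c j))%Q (S i)) (S m)).
{ apply qsum_ext; intros i hi; symmetry; apply qsum_mul_l. }
rewrite (qsum_triangle (fun i j => a (m - i)%nat * (b (i - j)%nat * c j))%Q (S m)).
apply qsum_ext; intros j hj; rewrite <- qsum_mul_r.
replace (S (m - j)) with (S m - j)%nat by lia.
apply qsum_ext; intros k hk.
replace (m - (j + k))%nat with (m - j - k)%nat by lia.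
replace (j + k - j)%nat with k by lia.
apply qmultA.
Qed.

Lemma fmul_C_l c a m : (fC c * a)%fps m = (c * a m)%Q.
Proof.
unfold fmul; simpl; rewrite Nat.sub_diag, qsum_0.
- apply qplus0l.
- intros k hk; replace (m - k)%nat with (S (m - k - 1)) by lia; apply qmult0l.
Qed.

Lemma fmul_C_r c a m : (a * fC c)%fps m = (a m * c)%Q.
Proof.
unfold fmul; rewrite qsum_head, qsum_0, Nat.sub_0_r; [apply qplus0r|].
intros; apply qmult0r.
Qed.

Lemma fmul_X_l a : (fX * a)%fps = shift a.
Proof.
apply functional_extensionality; intros [|m]; unfold fmul.
- simpl; qring.
- change (qsum (fun l => fX (S m - l)%nat * a l)%Q m
    + fX (S m - m)%nat * a m + fX (S m - S m)%nat * a (S m) = a m)%Q.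
  replace (S m - m)%nat with 1%nat by lia.
  rewrite Nat.sub_diag, qsum_0; [simpl; qring|].
  intros k hk; replace (S m - k)%nat with (S (S (m - k - 1))) by lia; apply qmult0l.
Qed.

Lemma fmul_X_r a : (a * fX)%fps = shift a.
Proof.
apply functional_extensionality; intros [|m]; unfold fmul.
- simpl; qring.
- rewrite qsum_head, qsum_head, qsum_0; [simpl; rewrite Nat.sub_0_r; qring|].
  intros; apply qmult0r.
Qed.

Ltac fpoint := intros; apply functional_extensionality; intros ?m;
  unfold fadd, fsub, fopp.

Lemma fX_central a : (fX * a = a * fX)%fps.
Proof. now rewrite fmul_X_l, fmul_X_r. Qed.

Lemma fC_real_central (x : R) a : (fC x * a = a * fC x)%fps.
Proof. fpoint; rewrite fmul_C_l, fmul_C_r; apply qrealC. Qed.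

Lemma fmulDl a b c : ((a + b) * c = a * c + b * c)%fps.
Proof.
fpoint; unfold fmul; rewrite <- qsum_add; apply qsum_ext; intros; apply qmultDl.
Qed.

Lemma fmulDr a b c : (c * (a + b) = c * a + c * b)%fps.
Proof.
fpoint; unfold fmul; rewrite <- qsum_add; apply qsum_ext; intros; apply qmultDr.
Qed.

Lemma fmul1l a : (fC 1 * a = a)%fps.
Proof. fpoint; rewrite fmul_C_l; apply qmult1l. Qed.
Lemma fmul1r a : (a * fC 1 = a)%fps.
Proof. fpoint; rewrite fmul_C_r; apply qmult1r. Qed.

Lemma fC0 : fC 0 = (fun _ => RtoQ 0).
Proof. apply functional_extensionality; now intros [|m]. Qed.

(** Equations between power series are left to the tactic for noncommutative
    rings. Its notations would take over those of the reals, hence the module. *)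
Module FpsRing.
Import Ncring Ncring_tac.

#[export] Instance fps_ops :
  @Ncring.Ring_ops fps (fC (RtoQ 0%R)) (fC (RtoQ 1%R)) fadd fmul fsub fopp (@eq fps) := {}.

#[export] Instance fps_ring : @Ncring.Ring fps _ _ _ _ _ _ _ fps_ops.
Proof.
constructor; try exact _; cbv [equality eq_notation addition multiplication
  add_notation mul_notation zero_notation one_notation opposite
  opp_notation subtraction sub_notation Algebra_syntax.zero Algebra_syntax.one].
all: try solve [repeat intro; subst; reflexivity].
- rewrite fC0; fpoint; apply qplus0l.
- fpoint; apply qplusC.
- fpoint; apply qplusA.
- apply fmul1l.
- apply fmul1r.
- apply fmulA.
- apply fmulDl.
- intros; apply fmulDr.
- rewrite fC0; fpoint; apply qplusN.
Qed.

Ltac fring := intros; non_commutative_ring.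
End FpsRing.
Import FpsRing.

(** * Linear factors and inverses of power series *)

(** [z - p] and [1 - z q]: a Blaschke factor is a quotient of two of these, and
    multiplication by either is a two-term recurrence on coefficients. *)
Definition fl (p : quat) : fps := (fX - fC p)%fps.
Definition fr (q : quat) : fps := (fC 1 - fX * fC q)%fps.

Lemma fC_add a b : fC (a + b)%Q = (fC a + fC b)%fps.
Proof. fpoint; destruct m; simpl; [easy|qring]. Qed.
Lemma fC_opp a : fC (- a)%Q = (- fC a)%fps.
Proof. fpoint; destruct m; simpl; [easy|qring]. Qed.
Lemma fC_mul a b : fC (a * b)%Q = (fC a * fC b)%fps.
Proof. fpoint; rewrite fmul_C_l; destruct m; simpl; [easy|qring]. Qed.
Lemma fC_inj a b : fC a = fC b -> a = b.
Proof. intros h; now apply (f_equal (fun u => u 0%nat)) in h. Qed.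

Lemma fl_l0 p (a : fps) : (fl p * a)%fps 0%nat = (- (p * a 0%nat))%Q.
Proof. unfold fl, fmul, fsub; simpl; qring. Qed.

Lemma fl_lS p a m : (fl p * a)%fps (S m) = (a m - p * a (S m))%Q.
Proof.
replace (fl p * a)%fps with (fX * a - fC p * a)%fps by (unfold fl; fring).
unfold fsub; now rewrite fmul_X_l, fmul_C_l.
Qed.

Lemma fl_r0 p a : (a * fl p)%fps 0%nat = (- (a 0%nat * p))%Q.
Proof. unfold fl, fmul, fsub; simpl; qring. Qed.

Lemma fl_rS p a m : (a * fl p)%fps (S m) = (a m - a (S m) * p)%Q.
Proof.
replace (a * fl p)%fps with (a * fX - a * fC p)%fps by (unfold fl; fring).
unfold fsub; now rewrite fmul_X_r, fmul_C_r.
Qed.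

Lemma fr_l0 q a : (fr q * a)%fps 0%nat = a 0%nat.
Proof.
replace (fr q * a)%fps with (a - fX * (fC q * a))%fps by (unfold fr; fring).
unfold fsub; rewrite fmul_X_l; simpl; qring.
Qed.

Lemma fr_lS q a m : (fr q * a)%fps (S m) = (a (S m) - q * a m)%Q.
Proof.
replace (fr q * a)%fps with (a - fX * (fC q * a))%fps by (unfold fr; fring).
unfold fsub; rewrite fmul_X_l; simpl; now rewrite fmul_C_l.
Qed.

Lemma fr_r0 q a : (a * fr q)%fps 0%nat = a 0%nat.
Proof.
replace (a * fr q)%fps with (a - a * fX * fC q)%fps by (unfold fr; fring).
unfold fsub; rewrite fmul_C_r, fmul_X_r; simpl; qring.
Qed.

Lemma fr_rS q a m : (a * fr q)%fps (S m) = (a (S m) - a m * q)%Q.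
Proof.
replace (a * fr q)%fps with (a - a * fX * fC q)%fps by (unfold fr; fring).
unfold fsub; now rewrite fmul_C_r, fmul_X_r.
Qed.

Lemma fps_ext (a b : fps) : (forall m, a m = b m) -> a = b.
Proof. apply functional_extensionality. Qed.

Lemma fl_fr_comm p q : (p * q = q * p)%Q -> (fl p * fr q = fr q * fl p)%fps.
Proof.
intros h.
assert (e : (fC p * fC q = fC q * fC p)%fps) by now rewrite <- !fC_mul, h.
transitivity (fX - fC p - fX * fX * fC q + fC p * fX * fC q)%fps; [unfold fl, fr; fring|].
rewrite <- (fX_central (fC p)).
transitivity (fX - fC p - fX * (fX * fC q) + fX * (fC q * fC p))%fps;
  [rewrite <- e; fring|].
rewrite (fX_central (fC q)); unfold fl, fr; fring.
Qed.

Lemma fl_real_central (x : R) a : (fl x * a = a * fl x)%fps.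
Proof.
unfold fl; transitivity (fX * a - fC x * a)%fps; [fring|].
rewrite fX_central, fC_real_central; fring.
Qed.

Lemma fr_real_central (x : R) a : (fr x * a = a * fr x)%fps.
Proof.
unfold fr; transitivity (a - fX * (fC x * a))%fps; [fring|].
rewrite fX_central, fC_real_central; rewrite <- fmulA, <- (fX_central (fC x)).
fring.
Qed.

(** For [p = 0] the product is a shift; otherwise the coefficients of the
    difference of [a] and [b] vanish one after the other. *)
Lemma fl_cancel_l p a b : (fl p * a = fl p * b)%fps -> a = b.
Proof.
intros h.
assert (e : forall m, (a m - b m)%Q = (p * (a (S m) - b (S m)))%Q).
{ intros m; apply (f_equal (fun u => u (S m))) in h; rewrite !fl_lS in h.
  replace (p * (a (S m) - b (S m)))%Q with
    (a m - p * b (S m) - (a m - p * a (S m)))%Q by qring.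
  rewrite h; qring. }
assert (e0 : (p * (a 0%nat - b 0%nat))%Q = RtoQ 0).
{ apply (f_equal (fun u => u 0%nat)) in h; rewrite !fl_l0 in h.
  replace (p * (a 0%nat - b 0%nat))%Q with (- (p * b 0%nat) - - (p * a 0%nat))%Q by qring.
  rewrite h; qring. }
destruct (ClassicalEpsilon.excluded_middle_informative (p = RtoQ 0)) as [->|hp].
{ apply fps_ext; intros m; apply qsub_eq0; rewrite e; qring. }
apply fps_ext; intros m; apply qsub_eq0.
induction m as [|m IH]; apply (qmult_eq0 p); auto.
now rewrite <- e.
Qed.

(** The first [n] coefficients of a right inverse of [u]. Each of them depends on
    all the previous ones, which is why the recursion builds a table. *)
Fixpoint finv_upto (u : fps) (n : nat) : nat -> quat :=
  match n with
  | O => fun _ => RtoQ 0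
  | S k => fun m =>
      if Nat.ltb m k then finv_upto u k m
      else (/ u 0%nat *
        (fC 1 k - qsum (fun l => u (k - l)%nat * finv_upto u k l)%Q k))%Q
  end.

Lemma finv_upto_stable u n m : (m < n)%nat -> finv_upto u n m = finv_upto u (S m) m.
Proof.
induction n as [|n IH]; intros h; [lia|].
destruct (Nat.eq_dec m n) as [->|ne]; [easy|].
assert (hm : (m < n)%nat) by lia.
rewrite <- IH by easy; simpl; now rewrite (proj2 (Nat.ltb_lt m n) hm).
Qed.

Lemma fps_right_inverse u : u 0%nat <> RtoQ 0 -> exists v, (u * v)%fps = fC 1.
Proof.
intros hu; exists (fun m => finv_upto u (S m) m).
apply fps_ext; intros m.
change ((qsum (fun l => u (m - l)%nat * finv_upto u (S l) l) m
  + u (m - m)%nat * finv_upto u (S m) m)%Q = fC 1 m).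
rewrite Nat.sub_diag; simpl finv_upto; rewrite Nat.ltb_irrefl.
rewrite qmultA, qinv_r, qmult1l by easy.
rewrite (qsum_ext (fun l => _) (fun l => (u (m - l)%nat * finv_upto u m l)%Q)).
- qring.
- intros k hk; now rewrite (finv_upto_stable u m k hk).
Qed.

(** A right inverse has in turn a right inverse, which then equals [u]. *)
Lemma fps_unit (u : fps) : u 0%nat <> RtoQ 0 ->
  exists v, (u * v)%fps = fC 1 /\ (v * u)%fps = fC 1.
Proof.
intros hu; destruct (fps_right_inverse u hu) as [v hv].
exists v; split; [easy|].
destruct (fps_right_inverse v) as [w hw].
- intros e; apply (f_equal (fun x => x 0%nat)) in hv; unfold fmul in hv; simpl in hv.
  rewrite e, qmult0r, qplus0r in hv; apply RtoQ_inj in hv; lra.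
- replace u with w; [easy|].
  transitivity (fC 1 * w)%fps; [now rewrite fmul1l|].
  now rewrite <- hv, <- fmulA, hw, fmul1r.
Qed.

Lemma fmul_0th a b : (a * b)%fps 0%nat = (a 0%nat * b 0%nat)%Q.
Proof. unfold fmul; simpl; qring. Qed.

Lemma fps_unit_cancel_l (u a b : fps) :
  u 0%nat <> RtoQ 0 -> (u * a = u * b)%fps -> a = b.
Proof.
intros hu h; destruct (fps_unit u hu) as [v [_ hv]].
now rewrite <- (fmul1l a), <- (fmul1l b), <- hv, <- !fmulA, h.
Qed.

Lemma fps_unit_cancel_r (u a b : fps) :
  u 0%nat <> RtoQ 0 -> (a * u = b * u)%fps -> a = b.
Proof.
intros hu h; destruct (fps_unit u hu) as [v [hv _]].
now rewrite <- (fmul1r a), <- (fmul1r b), <- hv, !fmulA, h.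
Qed.

Lemma fr_cancel_r q a b : (a * fr q = b * fr q)%fps -> a = b.
Proof.
apply fps_unit_cancel_r; unfold fr, fsub; rewrite fmul_X_l; simpl.
replace (RtoQ 1 - RtoQ 0)%Q with (RtoQ 1) by qring.
intros e; apply RtoQ_inj in e; lra.
Qed.

Definition fgeom (q : quat) : fps := qpow q.

Lemma fr_geom q : (fr q * fgeom q)%fps = fC 1.
Proof.
apply fps_ext; intros [|m]; [now rewrite fr_l0|].
rewrite fr_lS; unfold fgeom; simpl; qring.
Qed.

Lemma geom_fr q : (fgeom q * fr q)%fps = fC 1.
Proof.
apply fps_ext; intros [|m]; [now rewrite fr_r0|].
rewrite fr_rS; unfold fgeom; simpl; rewrite qpow_comm; qring.
Qed.

(** * Square-summable and contractive power series *)

Fixpoint rsum (u : nat -> R) (n : nat) : R :=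
  match n with O => 0 | S k => rsum u k + u k end.

Lemma rsum_ext u v n : (forall k, (k < n)%nat -> u k = v k) -> rsum u n = rsum v n.
Proof. induction n as [|n IH]; simpl; intros h; [easy|]; rewrite IH, h; auto. Qed.

Lemma rsum_le u v n : (forall k, (k < n)%nat -> u k <= v k) -> rsum u n <= rsum v n.
Proof.
induction n as [|n IH]; simpl; intros h; [lra|].
apply Rplus_le_compat; auto.
Qed.

Lemma rsum_add u v n : rsum (fun k => u k + v k) n = rsum u n + rsum v n.
Proof. induction n as [|n IH]; simpl; [|rewrite IH]; ring. Qed.

Lemma rsum_scal c u n : rsum (fun k => c * u k) n = c * rsum u n.
Proof. induction n as [|n IH]; simpl; [|rewrite IH]; ring. Qed.

Definition sumsq (a : fps) (n : nat) : R := rsum (fun m => qn (a m)) n.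

Lemma sumsq_mono a n k : (n <= k)%nat -> sumsq a n <= sumsq a k.
Proof.
induction 1 as [|k _ IH]; [lra|].
change (sumsq a (S k)) with (sumsq a k + qn (a k)).
pose proof (qn_ge0 (a k)); lra.
Qed.

Lemma sumsq_ge0 a n : 0 <= sumsq a n.
Proof. apply (sumsq_mono a 0); lia. Qed.

Lemma sumsq_term a n : qn (a n) <= sumsq a (S n).
Proof.
change (sumsq a (S n)) with (sumsq a n + qn (a n)).
pose proof (sumsq_ge0 a n); lra.
Qed.

(** Left multiplication by [F], as an operator on square-summable sequences, has
    norm at most one.  As the operator is lower triangular this can be said with
    partial sums, for all sequences. *)
Definition contractive (F : fps) : Prop :=
  forall (g : fps) (n : nat), sumsq (F * g) n <= sumsq g n.

Definition l2 (a : fps) : Prop := exists c, forall n, sumsq a n <= c.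

Definition tends0 (a : fps) : Prop := is_lim_seq (fun m => qn (a m)) 0.

Lemma contractive_mul F G : contractive F -> contractive G -> contractive (F * G).
Proof.
intros hF hG g n; rewrite <- fmulA.
eapply Rle_trans; [apply hF|apply hG].
Qed.

Lemma contractive_C c : qn c <= 1 -> contractive (fC c).
Proof.
intros hc g n; apply rsum_le; intros k _; rewrite fmul_C_l, qnM.
pose proof (qn_ge0 (g k)); nra.
Qed.

Lemma contractive_l2 F a : contractive F -> l2 a -> l2 (F * a).
Proof.
intros hF [c hc]; exists c; intros n; eapply Rle_trans; [apply hF|apply hc].
Qed.

Lemma qnD_le p q : qn (p + q) <= 2 * (qn p + qn q).
Proof. rewrite qnD; pose proof (qn_ge0 (p - q)) as h; rewrite qnB in h; lra. Qed.

Lemma l2_add a b : l2 a -> l2 b -> l2 (a + b).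
Proof.
intros [c hc] [d hd]; exists (2 * (c + d)); intros n.
apply Rle_trans with (2 * (sumsq a n + sumsq b n)); [|specialize (hc n); specialize (hd n); lra].
unfold sumsq; rewrite <- rsum_add, <- rsum_scal; apply rsum_le; intros k _; apply qnD_le.
Qed.

Lemma l2_le c (a b : fps) : 0 <= c -> (forall m, qn (b m) <= c * qn (a m)) -> l2 a -> l2 b.
Proof.
intros hc h [d hd]; exists (c * d); intros n.
eapply Rle_trans; [|apply Rmult_le_compat_l; [exact hc|apply (hd n)]].
unfold sumsq; rewrite <- rsum_scal; apply rsum_le; auto.
Qed.

Lemma l2_C_l c a : l2 a -> l2 (fC c * a).
Proof. apply (l2_le (qn c)); [apply qn_ge0|]; intros m; rewrite fmul_C_l, qnM; lra. Qed.

Lemma l2_C_r c a : l2 a -> l2 (a * fC c).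
Proof. apply (l2_le (qn c)); [apply qn_ge0|]; intros m; rewrite fmul_C_r, qnM; lra. Qed.

Lemma l2_sub a b : l2 a -> l2 b -> l2 (a - b).
Proof.
intros ha hb; apply (l2_add a (- b)); [easy|]; revert hb; apply (l2_le 1); [lra|].
intros m; unfold fopp; rewrite qnN; lra.
Qed.

Lemma sumsq_C c n : sumsq (fC c) n <= qn c.
Proof.
destruct n as [|n]; [apply qn_ge0|].
induction n as [|n IH]; [unfold sumsq; simpl; lra|].
change (sumsq (fC c) (S (S n))) with (sumsq (fC c) (S n) + qn (fC c (S n))).
simpl; rewrite qnR; lra.
Qed.

Lemma l2_C c : l2 (fC c).
Proof. exists (qn c); apply sumsq_C. Qed.

Lemma contractive_is_l2 F : contractive F -> l2 F.
Proof. intros h; rewrite <- (fmul1r F); apply contractive_l2, l2_C; easy. Qed.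

Lemma contractive_sumsq F n : contractive F -> sumsq F n <= 1.
Proof.
intros h; rewrite <- (fmul1r F); eapply Rle_trans; [apply h|].
eapply Rle_trans; [apply sumsq_C|rewrite qnR; lra].
Qed.

Lemma contractive_coef F n : contractive F -> qn (F n) <= 1.
Proof.
intros h; eapply Rle_trans; [apply sumsq_term|now apply contractive_sumsq].
Qed.

Lemma is_lim_seq_0 (u : nat -> R) : is_lim_seq u 0 <->
  forall eps : posreal, exists n, forall m, (n <= m)%nat -> Rabs (u m) < eps.
Proof.
rewrite <- is_lim_seq_spec; split; intros h eps; destruct (h eps) as [n hn];
  exists n; intros m hm; specialize (hn m hm); now rewrite Rminus_0_r in *.
Qed.

Lemma squeeze_0 (u v : nat -> R) :
  (forall m, 0 <= u m <= v m) -> is_lim_seq v 0 -> is_lim_seq u 0.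
Proof. intros h hv; apply is_lim_seq_le_le with (fun _ => 0) v; auto; apply is_lim_seq_const. Qed.

Lemma is_lim_seq_scal_0 (c : R) (u : nat -> R) :
  is_lim_seq u 0 -> is_lim_seq (fun m => c * u m) 0.
Proof. intros h; apply (is_lim_seq_scal_l u c 0) in h; simpl in h; now rewrite Rmult_0_r in h. Qed.

Lemma is_lim_seq_plus_0 (u v : nat -> R) :
  is_lim_seq u 0 -> is_lim_seq v 0 -> is_lim_seq (fun m => u m + v m) 0.
Proof. intros hu hv; rewrite <- (Rplus_0_r 0); now apply is_lim_seq_plus'. Qed.

Lemma le_of_lim_0 a b (u : nat -> R) :
  is_lim_seq u 0 -> (forall k, a <= b + u k) -> a <= b.
Proof.
intros h hu; apply (is_lim_seq_le (fun _ => a - b) u (a - b) 0) in h; [simpl in h; lra| |].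
- intros k; specialize (hu k); lra.
- apply is_lim_seq_const.
Qed.

Lemma l2_tends0 a : l2 a -> tends0 a.
Proof.
intros [c hc].
destruct (ex_finite_lim_seq_incr (sumsq a) c) as [l hl]; [|exact hc|].
{ intros n; apply sumsq_mono; lia. }
apply (is_lim_seq_ext (fun n => sumsq a (S n) - sumsq a n)); [intros n; unfold sumsq; simpl; ring|].
replace (Finite 0) with (Rbar_minus l l) by (simpl; f_equal; ring).
apply is_lim_seq_minus'; [now apply -> is_lim_seq_incr_1|easy].
Qed.

Lemma tends0_le c (a b : fps) : (forall m, qn (b m) <= c * qn (a m)) -> tends0 a -> tends0 b.
Proof.
intros h ha; eapply squeeze_0; [|exact (is_lim_seq_scal_0 c _ ha)].
intros m; split; [apply qn_ge0|apply h].
Qed.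

Lemma tends0_add a b : tends0 a -> tends0 b -> tends0 (a + b).
Proof.
intros ha hb.
eapply squeeze_0; [|exact (is_lim_seq_scal_0 2 _ (is_lim_seq_plus_0 _ _ ha hb))].
intros m; split; [apply qn_ge0|apply qnD_le].
Qed.

Lemma tends0_C_l c a : tends0 a -> tends0 (fC c * a).
Proof. apply (tends0_le (qn c)); intros m; rewrite fmul_C_l, qnM; lra. Qed.

Lemma tends0_C_r c a : tends0 a -> tends0 (a * fC c).
Proof. apply (tends0_le (qn c)); intros m; rewrite fmul_C_r, qnM; lra. Qed.

Lemma tends0_sub a b : tends0 a -> tends0 b -> tends0 (a - b).
Proof.
intros ha hb; apply (tends0_add a (- b)); [easy|]; revert hb; apply (tends0_le 1).
intros m; unfold fopp; rewrite qnN; lra.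
Qed.

Lemma tends0_shift a : tends0 a -> tends0 (fX * a).
Proof. intros h; rewrite fmul_X_l; now apply is_lim_seq_incr_1. Qed.

Definition deg_le (d : nat) (a : fps) : Prop := forall m, (d < m)%nat -> a m = RtoQ 0.

Lemma fps_head (a : fps) : a = (fC (a 0%nat) + fX * (fun m => a (S m)))%fps.
Proof. fpoint; rewrite fmul_X_l; destruct m; simpl; qring. Qed.

Lemma deg_le_0 a : deg_le 0 a -> a = fC (a 0%nat).
Proof. intros h; apply fps_ext; intros [|m]; [easy|apply h; lia]. Qed.

Lemma tends0_poly_r d a b : deg_le d b -> tends0 a -> tends0 (a * b).
Proof.
revert b; induction d as [|d IH]; intros b hb ha.
- rewrite (deg_le_0 b hb); now apply tends0_C_r.
- rewrite (fps_head b).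
  replace (a * (fC (b 0%nat) + fX * (fun m => b (S m))))%fps
    with (a * fC (b 0%nat) + a * fX * (fun m => b (S m)))%fps by fring.
  rewrite <- fX_central, <- fmulA.
  apply tends0_add; [now apply tends0_C_r|apply tends0_shift, IH; [|easy]].
  intros m hm; apply hb; lia.
Qed.

Lemma tends0_poly_l d a b : deg_le d b -> tends0 a -> tends0 (b * a).
Proof.
revert b; induction d as [|d IH]; intros b hb ha.
- rewrite (deg_le_0 b hb); now apply tends0_C_l.
- rewrite (fps_head b), fmulDl, <- fmulA.
  apply tends0_add; [now apply tends0_C_l|apply tends0_shift, IH; [|easy]].
  intros m hm; apply hb; lia.
Qed.

Lemma tends0_poly d b : deg_le d b -> tends0 b.
Proof.
intros hb; apply (is_lim_seq_ext_loc (fun _ => 0)); [|apply is_lim_seq_const].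
exists (S d); intros m hm; rewrite hb, qnR by lia; ring.
Qed.

(** * Multiplication and division by a Blaschke factor *)

(** On coefficients, [|x - conj p y|^2 - |y - p x|^2 = (1 - |p|^2) (|x|^2 - |y|^2)],
    and the sum over consecutive [x], [y] telescopes. So the Blaschke factor, which
    takes [fr (qconj p) * l] to [fl p * l], is isometric up to a boundary term. *)
Lemma blaschke_energy p l n :
  sumsq (fr (qconj p) * l) (S n) = sumsq (fl p * l) (S n) + (1 - qn p) * qn (l n).
Proof.
induction n as [|n IH].
- unfold sumsq; simpl; rewrite fr_l0, fl_l0, qnN, qnM; ring.
- change (sumsq (fr (qconj p) * l) (S (S n)))
    with (sumsq (fr (qconj p) * l) (S n) + qn ((fr (qconj p) * l)%fps (S n))).
  change (sumsq (fl p * l) (S (S n)))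
    with (sumsq (fl p * l) (S n) + qn ((fl p * l)%fps (S n))).
  rewrite IH, fr_lS, fl_lS, !qnB, !qnM, qn_conj.
  rewrite (qdotC (l (S n))), qdot_conj_l, qconjK; ring.
Qed.

Definition trunc (n : nat) (g : fps) : fps :=
  fun m => if Nat.ltb m n then g m else RtoQ 0.

Lemma trunc_lt n g m : (m < n)%nat -> trunc n g m = g m.
Proof. intros h; unfold trunc; now rewrite (proj2 (Nat.ltb_lt m n) h). Qed.

Lemma trunc_ge n g m : (n <= m)%nat -> trunc n g m = RtoQ 0.
Proof. intros h; unfold trunc; now rewrite (proj2 (Nat.ltb_ge m n) h). Qed.

Lemma sumsq_trunc n k g : (n <= k)%nat -> sumsq (trunc n g) k = sumsq g n.
Proof.
induction 1 as [|k hk IH].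
- apply rsum_ext; intros m hm; now rewrite trunc_lt.
- change (sumsq (trunc n g) (S k)) with (sumsq (trunc n g) k + qn (trunc n g k)).
  rewrite IH, trunc_ge, qnR by easy; ring.
Qed.

Lemma fmul_trunc F g n m : (m < n)%nat -> (F * trunc n g)%fps m = (F * g)%fps m.
Proof. intros h; apply qsum_ext; intros k hk; rewrite trunc_lt; [easy|lia]. Qed.

Lemma sumsq_fmul_trunc F g n : sumsq (F * trunc n g) n = sumsq (F * g) n.
Proof. apply rsum_ext; intros m hm; now rewrite fmul_trunc. Qed.

Lemma trunc_deg n g : deg_le n (trunc n g).
Proof. intros m hm; apply trunc_ge; lia. Qed.

(** Cancellation of a Blaschke factor. The boundary term of [blaschke_energy] tends
    to zero if the sequence multiplied by [L] has finite support, and truncating a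
    sequence does not change the partial sum that has to be estimated. *)
Lemma contractive_div p L :
  qn p < 1 -> tends0 L -> contractive (fl p * L) -> contractive (fr (qconj p) * L).
Proof.
intros hp hL hF g n.
assert (h0 := tends0_poly_r n L (trunc n g) (trunc_deg n g) hL).
apply (is_lim_seq_incr_n _ n), (is_lim_seq_scal_0 (1 - qn p)) in h0.
apply (le_of_lim_0 _ _ _ h0); intros k.
rewrite <- sumsq_fmul_trunc.
eapply Rle_trans; [apply (sumsq_mono _ n (S (k + n))); lia|].
rewrite <- fmulA, blaschke_energy, fmulA; apply Rplus_le_compat_r.
eapply Rle_trans; [apply hF|rewrite sumsq_trunc by lia; lra].
Qed.

(** The power series of the regular Moebius map with zero [p]. *)
Definition fblaschke (p : quat) : fps := (fgeom (qconj p) * fl p)%fps.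

Lemma fblaschke_l p : (fr (qconj p) * fblaschke p)%fps = fl p.
Proof. unfold fblaschke; now rewrite fmulA, fr_geom, fmul1l. Qed.

Lemma fblaschke_r p : (fblaschke p * fr (qconj p))%fps = fl p.
Proof.
unfold fblaschke; rewrite <- fmulA, fl_fr_comm, fmulA, geom_fr, fmul1l; [easy|].
rewrite qconj_mult; apply qmult_conj.
Qed.

Lemma contractive_blaschke p : qn p < 1 -> contractive (fblaschke p).
Proof.
intros hp g n; destruct n as [|n]; [unfold sumsq; simpl; lra|].
set (l := (fgeom (qconj p) * g)%fps).
replace g with (fr (qconj p) * l)%fps by (unfold l; now rewrite fmulA, fr_geom, fmul1l).
rewrite fmulA, fblaschke_r, blaschke_energy.
pose proof (qn_ge0 (l n)); nra.
Qed.

(** * Moebius transformations of contractive series *)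

(** Each coefficient satisfies
    [|x + a y|^2 - |y + conj a x|^2 = (1 - |a|^2) (|x|^2 - |y|^2)]. With [X = G g] and
    [y = g] it compares [F] and [G] when [F = (G + a) (1 + conj a G)^-1]. *)
Lemma moebius_energy (a : quat) (X y : fps) n :
  sumsq (X + fC a * y) n - sumsq (y + fC (qconj a) * X) n
  = (1 - qn a) * (sumsq X n - sumsq y n).
Proof.
induction n as [|n IH]; [unfold sumsq; simpl; ring|].
change (sumsq ?u (S n)) with (sumsq u n + qn (u n)) in *.
unfold sumsq in *; cbn [rsum].
enough (qn ((X + fC a * y)%fps n) - qn ((y + fC (qconj a) * X)%fps n)
  = (1 - qn a) * (qn (X n) - qn (y n))) by lra.
unfold fadd; rewrite !fmul_C_l; qreal.
Qed.

Lemma unit_coef_neq0 a b : qn a < 1 -> qn b <= 1 -> (RtoQ 1 + a * b)%Q <> RtoQ 0.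
Proof.
intros ha hb e.
assert (h : (a * b)%Q = (- RtoQ 1)%Q).
{ replace (a * b)%Q with (RtoQ 1 + a * b - RtoQ 1)%Q by qring; rewrite e; qring. }
apply (f_equal qn) in h; rewrite qnM, qnN, qnR in h.
pose proof (qn_ge0 a); pose proof (qn_ge0 b); nra.
Qed.

Lemma moebius_contractive_down a F G :
  qn a < 1 -> (F * (fC 1 + fC (qconj a) * G))%fps = (G + fC a)%fps ->
  contractive F -> contractive G.
Proof.
intros ha h hc g n.
pose proof (moebius_energy a (G * g) g n) as e.
replace (G * g + fC a * g)%fps with (F * (g + fC (qconj a) * (G * g)))%fps in e.
- specialize (hc (g + fC (qconj a) * (G * g))%fps n); nra.
- replace (g + fC (qconj a) * (G * g))%fps
    with ((fC 1 + fC (qconj a) * G) * g)%fps by fring.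
  rewrite fmulA, h; fring.
Qed.

Lemma moebius_contractive_up a F G :
  qn a < 1 -> (F * (fC 1 + fC (qconj a) * G))%fps = (G + fC a)%fps ->
  contractive G -> contractive F.
Proof.
intros ha h hc u n.
destruct (fps_unit (fC 1 + fC (qconj a) * G)%fps) as [v [hv _]].
{ unfold fadd; rewrite fmul_C_l; simpl; apply unit_coef_neq0.
  - now rewrite qn_conj.
  - now apply contractive_coef. }
set (g := (v * u)%fps).
assert (eu : u = (g + fC (qconj a) * (G * g))%fps).
{ transitivity ((fC 1 + fC (qconj a) * G) * g)%fps; [|fring].
  unfold g; now rewrite fmulA, hv, fmul1l. }
pose proof (moebius_energy a (G * g) g n) as e.
replace (G * g + fC a * g)%fps with (F * u)%fps in e.
- rewrite <- eu in e; specialize (hc g n); nra.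
- rewrite eu.
  replace (g + fC (qconj a) * (G * g))%fps
    with ((fC 1 + fC (qconj a) * G) * g)%fps by fring.
  rewrite fmulA, h; fring.
Qed.

(** * Evaluation at a point of the ball *)

(** [hasval F q v] says that the sum of the [q ^ m * F m] is [v]; the quotient of
    [F - v] by the linear factor makes this an algebraic notion. *)
Definition hasval (F : fps) (q v : quat) : Prop :=
  exists L, l2 L /\ F = (fC v + fl q * L)%fps.

(** The moduli of the tail do not decrease, and they tend to zero. *)
Lemma tail_zero_l d q h :
  qn q <= 1 -> tends0 h -> (forall m, (d <= m)%nat -> h m = (q * h (S m))%Q) ->
  forall m, (d <= m)%nat -> h m = RtoQ 0.
Proof.
intros hq h0 e m hm; apply qn0; apply Rle_antisym; [|apply qn_ge0].
apply (is_lim_seq_incr_n _ m) in h0; apply (le_of_lim_0 _ _ _ h0).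
induction k as [|k IH]; simpl; [lra|].
rewrite (e (k + m)%nat), qnM in IH by lia.
pose proof (qn_ge0 q); pose proof (qn_ge0 (h (S (k + m)))); nra.
Qed.

Lemma tail_zero_r d q h :
  qn q <= 1 -> tends0 h -> (forall m, (d <= m)%nat -> h m = (h (S m) * q)%Q) ->
  forall m, (d <= m)%nat -> h m = RtoQ 0.
Proof.
intros hq h0 e m hm.
rewrite <- (qconjK (h m)), (tail_zero_l d (qconj q) (fun m => qconj (h m))).
- qring.
- now rewrite qn_conj.
- revert h0; apply is_lim_seq_ext; intros k; symmetry; apply qn_conj.
- intros k hk; rewrite <- qconjM, <- e; easy.
- easy.
Qed.

Lemma hasval_unique F q v w : qn q < 1 -> hasval F q v -> hasval F q w -> v = w.
Proof.
intros hq [L [hL eL]] [M [hM eM]].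
assert (h0 : tends0 (L - M)) by now apply tends0_sub; apply l2_tends0.
assert (e : fC (w - v)%Q = (fl q * (L - M))%fps).
{ rewrite fC_add, fC_opp.
  transitivity (fC w - fC v)%fps; [fring|].
  replace (fC w) with (F - fl q * M)%fps by (rewrite eM; fring).
  rewrite eL at 1; fring. }
assert (z : forall m, (0 <= m)%nat -> (L - M)%fps m = RtoQ 0).
{ apply (tail_zero_l 0 q); [lra|easy|]; intros m _.
  apply (f_equal (fun u => u (S m))) in e; rewrite fl_lS in e; simpl in e.
  apply qsub_eq0; now symmetry. }
apply (f_equal (fun u => u 0%nat)) in e; rewrite fl_l0, z in e by lia; simpl in e.
symmetry; apply qsub_eq0; rewrite e; qring.
Qed.

Lemma hasval_C c q : hasval (fC c) q c.
Proof.
exists (fC 0); split; [apply l2_C|].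
replace (fl q * fC 0)%fps with (fC 0); [rewrite fC0; fpoint; qring|].
fpoint; rewrite fmul_C_r, fC0; qring.
Qed.

Lemma l2_bounded a : l2 a -> exists c, 0 <= c /\ forall m, qmod (a m) <= c.
Proof.
intros [c hc]; exists (1 + c).
assert (0 <= c) by (eapply Rle_trans; [apply (sumsq_ge0 a 0)|apply hc]).
split; [lra|]; intros m.
assert (h : qn (a m) <= c) by (eapply Rle_trans; [apply sumsq_term|apply hc]).
rewrite <- qmod_sqr in h; pose proof (qmod_ge0 (a m)); nra.
Qed.

Lemma qmod_qsum u n : qmod (qsum u n) <= rsum (fun k => qmod (u k)) n.
Proof.
induction n as [|n IH]; simpl; [rewrite qmodR, Rabs_R0; lra|].
eapply Rle_trans; [apply qmod_triangle|lra].
Qed.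

Lemma rsum_geom x n : (1 - x) * rsum (fun k => x ^ k) n = 1 - x ^ n.
Proof.
induction n as [|n IH]; [simpl; ring|].
change (rsum ?u (S n)) with (rsum u n + u n); rewrite Rmult_plus_distr_l, IH; simpl; ring.
Qed.

Lemma rsum_geom_le x n : 0 <= x < 1 -> rsum (fun k => x ^ k) n <= / (1 - x).
Proof.
intros hx; apply Rmult_le_reg_l with (1 - x); [lra|].
rewrite rsum_geom, Rinv_r by lra; pose proof (pow_le x n (proj1 hx)); lra.
Qed.

Lemma qdot_real_l (x : R) q : qdot (x * q) q = x * qn q.
Proof. qreal. Qed.

Section TestSequence.
Variables (F : fps) (q v : quat) (L : fps).
Hypotheses (hq : qn q < 1) (hF : contractive F) (hL : l2 L)
  (eF : F = (fC v + fl q * L)%fps).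

Let u : fps := fun m => (qconj v * qpow (qconj q) m)%Q.

(** The powers of [conj q] are killed by the adjoint of the multiplication by [fl q];
    the truncation leaves a boundary term. *)
Lemma qdot_telescope (w : fps) n :
  rsum (fun m => qdot ((fl q * w)%fps m) (qpow (qconj q) m)) (S n)
  = - qdot (w n) (qpow (qconj q) (S n)).
Proof.
induction n as [|n IH].
- simpl; rewrite fl_l0, qmult1r, Rplus_0_l, qdotNl, qdot_conj_l, qmult1r; easy.
- change (rsum ?f (S (S n))) with (rsum f (S n) + f (S n)); cbv beta.
  rewrite IH, fl_lS; unfold Rminus.
  rewrite qdotDl, qdotNl, qdot_conj_l.
  change (qconj q * qpow (qconj q) (S n))%Q with (qpow (qconj q) (S (S n))); ring.
Qed.

Lemma sumsq_test n : sumsq u n = qn v * rsum (fun m => qn q ^ m) n.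
Proof.
rewrite <- rsum_scal; apply rsum_ext; intros m _; unfold u.
rewrite qnM, qn_conj; f_equal.
rewrite <- qmod_sqr, qmod_pow, qmod_conj, <- Rpow_mult_distr, qmod_sqr; easy.
Qed.

Lemma test_bounded : exists c, forall n, qmod ((L * u)%fps n) <= c.
Proof.
destruct (l2_bounded L hL) as [c [hc h]].
exists (c * qmod v * / (1 - qmod q)); intros n.
pose proof (qmod_ge0 v); pose proof (qmod_ge0 q).
assert (qmod q < 1) by now apply qmod_lt1.
eapply Rle_trans; [apply qmod_qsum|].
apply Rle_trans with (rsum (fun k => c * qmod v * qmod q ^ k) (S n)).
- apply rsum_le; intros k _; unfold u.
  rewrite !qmodM, qmod_pow, !qmod_conj, Rmult_assoc.
  apply Rmult_le_compat_r; [|apply h].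
  apply Rmult_le_pos; [easy|now apply pow_le].
- rewrite rsum_scal; apply Rmult_le_compat_l; [now apply Rmult_le_pos|].
  now apply rsum_geom_le.
Qed.

(** Contractivity is tested on [u], for which [F * u] has inner product close to
    [|v|^2 / (1 - |q|^2)] with the sequence of the powers of [conj q]. This bounds the
    values of a contractive series by one, and the left-hand side, a single term of a
    sum of squares, makes the case of a unimodular value rigid. *)
Lemma test_inequality : qn (F 0%nat * qconj v - RtoQ 1) * (1 - qn q) <= 1 - qn v.
Proof.
set (k := qpow (qconj q) : fps).
assert (ek : forall m, qn (k m) = qn q ^ m).
{ intros m; unfold k.
  rewrite <- qmod_sqr, qmod_pow, qmod_conj, <- Rpow_mult_distr, qmod_sqr; easy. }
(* |F u - k|^2 = |F u|^2 - 2 <F u, k> + |k|^2 and <F u, k> tends to |v|^2 |k|^2 *)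
assert (e : forall n, sumsq (F * u - k) (S n)
  = sumsq (F * u) (S n) + rsum (fun m => qn q ^ m) (S n) * (1 - 2 * qn v)
    + 2 * qdot ((L * u)%fps n) (k (S n))).
{ intros n.
  assert (e1 : rsum (fun m => qdot ((F * u)%fps m) (k m)) (S n)
    = qn v * rsum (fun m => qn q ^ m) (S n) - qdot ((L * u)%fps n) (k (S n))).
  { rewrite <- rsum_scal; unfold Rminus.
    change (k (S n)) with (qpow (qconj q) (S n)).
    rewrite <- (qdot_telescope (L * u)%fps n), <- rsum_add.
    apply rsum_ext; intros m _.
    replace (F * u)%fps with (fC v * u + fl q * (L * u))%fps by (rewrite eF; fring).
    unfold fadd; rewrite qdotDl, fmul_C_l; f_equal.
    unfold u; rewrite qmultA, qmult_conj, <- ek; apply qdot_real_l. }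
  transitivity (sumsq (F * u) (S n) + -2 * rsum (fun m => qdot ((F * u)%fps m) (k m)) (S n)
    + rsum (fun m => qn q ^ m) (S n)).
  - unfold sumsq; rewrite <- rsum_scal, <- !rsum_add; apply rsum_ext; intros m _.
    unfold fsub; rewrite qnB, ek; ring.
  - rewrite e1; ring. }
destruct test_bounded as [c hc].
pose proof (qn_ge0 q) as hq0.
assert (hq' : qmod q < 1) by now apply qmod_lt1.
pose proof (qmod_ge0 q) as hq1.
assert (lim : is_lim_seq (fun n => 2 * c * qmod q ^ S n) 0).
{ apply is_lim_seq_scal_0, (is_lim_seq_incr_1 (fun n => qmod q ^ n)), is_lim_seq_geom.
  rewrite Rabs_pos_eq; lra. }
apply (le_of_lim_0 _ _ _ lim); intros n; specialize (e n).
assert (h1 : qn (F 0%nat * qconj v - RtoQ 1) <= sumsq (F * u - k) (S n)).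
{ replace (qn (F 0%nat * qconj v - RtoQ 1)) with (sumsq (F * u - k) 1).
  - apply sumsq_mono; lia.
  - unfold sumsq; simpl; unfold fsub; rewrite fmul_0th; unfold u, k; simpl.
    rewrite qmult1r; ring. }
assert (h2 := hF u (S n)); rewrite sumsq_test in h2.
set (eps := 2 * c * qmod q ^ S n).
assert (h3 : 2 * qdot ((L * u)%fps n) (k (S n)) <= eps).
{ pose proof (qdot_le ((L * u)%fps n) (k (S n))) as h.
  unfold k in h at 2; rewrite qmod_pow, qmod_conj in h.
  pose proof (Rmult_le_compat_r _ _ _ (pow_le _ (S n) hq1) (hc n)); unfold eps; lra. }
assert (heps : 0 <= eps).
{ apply Rmult_le_pos; [|now apply pow_le].
  pose proof (qmod_ge0 ((L * u)%fps n)); specialize (hc n); lra. }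
assert (h4 : (1 - qn q) * rsum (fun m => qn q ^ m) (S n) <= 1).
{ rewrite rsum_geom; pose proof (pow_le (qn q) (S n) hq0); lra. }
set (s := rsum (fun m => qn q ^ m) (S n)) in *.
assert (h6 : qn (F 0%nat * qconj v - RtoQ 1) <= s * (1 - qn v) + eps) by nra.
assert (h7 : 1 <= s).
{ unfold s; clear - hq0; induction n as [|n IH]; [simpl; lra|].
  simpl in *; pose proof (pow_le (qn q) n hq0); nra. }
pose proof (qn_ge0 (F 0%nat * qconj v - RtoQ 1)).
destruct (Rle_lt_dec (qn v) 1); nra.
Qed.
End TestSequence.

(** * Schur steps *)

Lemma contractive_value_le F q v :
  contractive F -> qn q < 1 -> hasval F q v -> qn v <= 1.
Proof.
intros hF hq [L [hL e]].
pose proof (test_inequality F q v L hq hF hL e) as h.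
pose proof (qn_ge0 (F 0%nat * qconj v - RtoQ 1)); nra.
Qed.

(** The maximum principle: [test_inequality] forces the constant coefficient to be
    [v], and there is no norm left for the other coefficients. *)
Lemma contractive_unimodular F q v :
  contractive F -> qn q < 1 -> hasval F q v -> 1 <= qn v -> F = fC v.
Proof.
intros hF hq hv h1.
assert (h2 : qn v = 1) by (apply Rle_antisym; [apply (contractive_value_le F q v)|]; easy).
assert (e0 : F 0%nat = v).
{ destruct hv as [L [hL e]].
  pose proof (test_inequality F q v L hq hF hL e) as h.
  assert (h0 : qn (F 0%nat * qconj v - RtoQ 1) = 0).
  { pose proof (qn_ge0 (F 0%nat * qconj v - RtoQ 1)); nra. }
  apply qn0, qsub_eq0 in h0.
  rewrite <- (qmult1l v), <- h0, <- qmultA, qconj_mult, h2, qmult1r; easy. }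
apply fps_ext; intros [|m]; [easy|]; simpl; apply qn0.
apply Rle_antisym; [|apply qn_ge0].
pose proof (contractive_sumsq F (S (S m)) hF) as h.
change (sumsq F (S (S m))) with (sumsq F (S m) + qn (F (S m))) in h.
pose proof (sumsq_mono F 1 (S m) ltac:(lia)) as h'.
unfold sumsq in h' at 1; simpl in h'; rewrite e0, h2 in h'; lra.
Qed.

(** [F] arises from [F'] by an inverse Schur step at the real point [r]: with
    [G] the product of [F'] and the Blaschke factor of [r], [F] is
    [(G + a) (1 + conj a G)^-1]. The denominator [1 - r z] is cleared. *)
Definition schur (r : R) (a : quat) (F F' : fps) : Prop :=
  (F * (fr r + fC (qconj a) * (fl r * F')) = fl r * F' + fC a * fr r)%fps.

Lemma schur_moebius (r : R) a F F' G : (fr r * G = fl r * F')%fps ->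
  schur r a F F' <-> (F * (fC 1 + fC (qconj a) * G) = G + fC a)%fps.
Proof.
intros hG; unfold schur; rewrite <- hG.
assert (e1 : (F * (fr r + fC (qconj a) * (fr r * G))
  = (F * (fC 1 + fC (qconj a) * G)) * fr r)%fps).
{ rewrite !fr_real_central; rewrite <- (fmul1l (fr r)) at 1.
  rewrite (fmulA (fC (qconj a))); fring. }
assert (e2 : (fr r * G + fC a * fr r = (G + fC a) * fr r)%fps).
{ rewrite fr_real_central; fring. }
rewrite e1, e2; split; [apply fr_cancel_r|now intros ->].
Qed.

Lemma schur_den_neq0 (r : R) a (G : fps) : r * r < 1 -> qn a < 1 -> qn (G 0%nat) <= 1 ->
  ((fr r + fC (qconj a) * (fl r * G))%fps 0%nat) <> RtoQ 0.
Proof.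
intros hr ha hG; unfold fadd; rewrite fmul_C_l, fl_l0.
replace (fr r 0%nat) with (RtoQ 1).
2: unfold fr, fsub; rewrite fmul_X_l; simpl; qring.
apply unit_coef_neq0; [now rewrite qn_conj|].
rewrite qnN, qnM, qnR; pose proof (qn_ge0 (G 0%nat)); nra.
Qed.

Lemma schur_unique_l (r : R) a F1 F2 F' : r * r < 1 -> qn a < 1 -> contractive F' ->
  schur r a F1 F' -> schur r a F2 F' -> F1 = F2.
Proof.
intros hr ha hF' h1 h2; unfold schur in *; rewrite <- h2 in h1.
apply fps_unit_cancel_r in h1; [easy|].
apply schur_den_neq0; auto; now apply contractive_coef.
Qed.

Lemma moebius_den_neq0 F a : qn a < 1 -> contractive F ->
  (fC 1 - F * fC (qconj a))%fps 0%nat <> RtoQ 0.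
Proof.
intros ha hF; unfold fsub; rewrite fmul_C_r; simpl.
replace (RtoQ 1 - F 0%nat * qconj a)%Q with
  (qconj (RtoQ 1 + (- a) * qconj (F 0%nat)))%Q by qring.
intros e; apply (f_equal qconj) in e; rewrite qconjK, qconjR in e.
revert e; apply unit_coef_neq0; [now rewrite qnN|].
rewrite qn_conj; now apply contractive_coef.
Qed.

Lemma schur_unique_r (r : R) a F F1 F2 : qn a < 1 -> contractive F ->
  schur r a F F1 -> schur r a F F2 -> F1 = F2.
Proof.
intros ha hF h1 h2; unfold schur in *.
assert (e : forall G, (F * (fr r + fC (qconj a) * (fl r * G)) = fl r * G + fC a * fr r)%fps ->
  ((fC 1 - F * fC (qconj a)) * (fl r * G) = F * fr r - fC a * fr r)%fps).
{ intros G hG.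
  transitivity (fl r * G + fC a * fr r - (F * (fr r + fC (qconj a) * (fl r * G)))
    + F * fr r - fC a * fr r)%fps; [|rewrite hG; fring].
  rewrite <- (fmul1l (fl r * G)%fps) at 2; fring. }
apply (fl_cancel_l r).
apply (fps_unit_cancel_l (fC 1 - F * fC (qconj a))%fps).
- now apply moebius_den_neq0.
- now rewrite (e F1), (e F2).
Qed.

(** Weighted form of the parallelogram inequality. *)
Lemma qn_convex t u v : t * (1 - t) * qn (u + v) <= t * qn u + (1 - t) * qn v.
Proof.
pose proof (qn_ge0 (t * u - (1 - t)%R * v)) as h.
replace (qn (t * u - (1 - t)%R * v)) with
  (t * qn u + (1 - t) * qn v - t * (1 - t) * qn (u + v)) in h by qreal; lra.
Qed.

(** Multiplication by [F conj a] has norm at most [|a| < 1], so the partial sums for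
    [y] are bounded in terms of those for [b]. *)
Lemma l2_resolvent F a y b : contractive F -> qn a < 1 ->
  ((fC 1 - F * fC (qconj a)) * y)%fps = b -> l2 b -> l2 y.
Proof.
intros hF ha e [c hc].
assert (ey : y = (b + F * (fC (qconj a) * y))%fps).
{ rewrite <- e; rewrite <- (fmul1l y) at 1; fring. }
assert (hc0 : 0 <= c) by (eapply Rle_trans; [apply (sumsq_ge0 b 0)|apply hc]).
exists (c / ((1 - qn a) * (1 - qn a) / 4)); intros n.
assert (h1 : sumsq (F * (fC (qconj a) * y)) n <= qn a * sumsq y n).
{ eapply Rle_trans; [apply hF|]; unfold sumsq; rewrite <- rsum_scal.
  apply rsum_le; intros k _; rewrite fmul_C_l, qnM, qn_conj; lra. }
set (t := (1 + qn a) / 2).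
assert (h2 : t * (1 - t) * sumsq y n <=
  t * sumsq b n + (1 - t) * sumsq (F * (fC (qconj a) * y)) n).
{ unfold sumsq; rewrite <- !rsum_scal, <- rsum_add; apply rsum_le; intros k _.
  rewrite (f_equal (fun u => u k) ey); apply qn_convex. }
specialize (hc n); pose proof (qn_ge0 a).
assert (ht : 0 <= t <= 1) by (unfold t; lra).
assert (h3 : t * (1 - t) * sumsq y n <= c + (1 - t) * (qn a * sumsq y n)).
{ pose proof (sumsq_ge0 b n); nra. }
apply Rmult_le_reg_l with ((1 - qn a) * (1 - qn a) / 4); [nra|].
replace ((1 - qn a) * (1 - qn a) / 4 * (c / ((1 - qn a) * (1 - qn a) / 4))) with c
  by (field; lra).
unfold t in h3; lra.
Qed.

Lemma contractive_X : contractive fX.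
Proof.
intros g [|n]; [unfold sumsq; simpl; lra|]; rewrite fmul_X_l.
apply Rle_trans with (sumsq g n); [|apply sumsq_mono; lia].
induction n as [|n IH]; [unfold sumsq; simpl; rewrite qnR; lra|].
change (sumsq (shift g) (S (S n))) with (sumsq (shift g) (S n) + qn (g n)).
change (sumsq g (S n)) with (sumsq g n + qn (g n)); lra.
Qed.

Lemma l2_geom q a : qn q < 1 -> l2 a -> l2 (fgeom q * a).
Proof.
intros hq; apply (l2_resolvent fX (qconj q)).
- apply contractive_X.
- now rewrite qn_conj.
- rewrite qconjK; change (fC 1 - fX * fC q)%fps with (fr q).
  now rewrite fmulA, fr_geom, fmul1l.
Qed.

Lemma fr_neq0 q : fr q 0%nat <> RtoQ 0.
Proof.
unfold fr, fsub; rewrite fmul_X_l; simpl.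
replace (RtoQ 1 - RtoQ 0)%Q with (RtoQ 1) by qring.
intros e; apply RtoQ_inj in e; lra.
Qed.

(** A Schur step: the Moebius transform of [F] sending [a] to zero is divided by
    the Blaschke factor of [r]. *)
Lemma schur_down (r : R) a F : r * r < 1 -> qn a < 1 -> contractive F ->
  hasval F r a -> exists F', contractive F' /\ schur r a F F'.
Proof.
intros hr ha hF [L [hL e]].
destruct (fps_unit (fC 1 - F * fC (qconj a))%fps) as [w [hw1 hw2]].
{ now apply moebius_den_neq0. }
set (L' := (w * L)%fps).
assert (hL' : l2 L').
{ apply (l2_resolvent F a L' L); auto; unfold L'; now rewrite fmulA, hw1, fmul1l. }
set (G := (fl r * L')%fps).
assert (hG : (F * (fC 1 + fC (qconj a) * G) = G + fC a)%fps).
{ assert (hG1 : ((fC 1 - F * fC (qconj a)) * G = F - fC a)%fps).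
  { unfold G, L'; rewrite (fl_real_central r), !fmulA, hw1, fmul1l.
    rewrite <- fl_real_central, e; fring. }
  transitivity (F - ((fC 1 - F * fC (qconj a)) * G) + fC 1 * G)%fps; [fring|].
  rewrite hG1, fmul1l; fring. }
exists (fr r * L')%fps; split.
- rewrite <- (qconjR r); apply contractive_div.
  + now rewrite qnR.
  + now apply l2_tends0.
  + apply (moebius_contractive_down a F G); easy.
- apply (schur_moebius r a F _ G); [|easy].
  unfold G; rewrite !fmulA; f_equal.
  symmetry; apply fl_fr_comm; qring.
Qed.

(** [F] is the Moebius transform of a multiple of the Blaschke factor of [r], so it
    takes the value [a] at [r]. *)
Lemma schur_up (r : R) a F' : r * r < 1 -> qn a < 1 -> contractive F' ->
  exists F, contractive F /\ schur r a F F' /\ hasval F r a.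
Proof.
intros hr ha hF'.
set (G := (fblaschke r * F')%fps).
assert (hGc : contractive G).
{ apply contractive_mul; [apply contractive_blaschke; now rewrite qnR|easy]. }
assert (hG : (fr r * G = fl r * F')%fps).
{ unfold G; rewrite fmulA; f_equal; rewrite <- (qconjR r) at 1; apply fblaschke_l. }
destruct (fps_unit (fC 1 + fC (qconj a) * G)%fps) as [v [_ hv]].
{ unfold fadd; rewrite fmul_C_l; simpl; apply unit_coef_neq0.
  - now rewrite qn_conj.
  - now apply contractive_coef. }
exists ((G + fC a) * v)%fps.
assert (e : ((G + fC a) * v * (fC 1 + fC (qconj a) * G) = G + fC a)%fps).
{ now rewrite <- fmulA, hv, fmul1r. }
assert (hF := moebius_contractive_up a _ G ha e hGc).
split; [easy|split; [now apply (schur_moebius r a _ _ G)|]].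
set (F := ((G + fC a) * v)%fps) in *.
set (L := (fgeom r * F')%fps).
assert (hL : l2 L) by (apply l2_geom; [now rewrite qnR|now apply contractive_is_l2]).
assert (eG : G = (fl r * L)%fps).
{ apply (fps_unit_cancel_l (fr r)); [apply fr_neq0|].
  rewrite hG, (fr_real_central r (fl r * L)%fps), <- fmulA, <- fr_real_central.
  unfold L; now rewrite fmulA, fmulA, <- (fmulA _ (fr r)), fr_geom, fmul1r. }
exists (L - F * (fC (qconj a) * L))%fps; split.
- apply l2_sub; [easy|]; apply contractive_l2; [easy|now apply l2_C_l].
- transitivity (fC a + G - F * (fC (qconj a) * G))%fps.
  + transitivity (F * (fC 1 + fC (qconj a) * G) - F * (fC (qconj a) * G))%fps.
    * rewrite <- (fmul1r F) at 1; fring.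
    * rewrite e; fring.
  + rewrite eG, (fl_real_central r L), (fmulA (fC (qconj a))), (fmulA F).
    rewrite <- !fl_real_central; fring.
Qed.

Lemma hasval_add A B q u v : hasval A q u -> hasval B q v -> hasval (A + B) q (u + v)%Q.
Proof.
intros [L [hL ->]] [M [hM ->]]; exists (L + M)%fps; split; [now apply l2_add|].
rewrite fC_add; fring.
Qed.

Lemma hasval_C_mul (x : R) c A u : hasval A x u -> hasval (fC c * A) x (c * u)%Q.
Proof.
intros [L [hL ->]]; exists (fC c * L)%fps; split; [now apply l2_C_l|].
rewrite fC_mul, fmulDr, (fmulA (fC c) (fl x)), <- (fl_real_central x (fC c)).
now rewrite <- fmulA.
Qed.

(** Evaluation at a real point is multiplicative because the point is central. *)
Lemma hasval_mul (x : R) F A u v : contractive F ->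
  hasval F x u -> hasval A x v -> hasval (F * A) x (u * v)%Q.
Proof.
intros hF [L [hL e]] [M [hM ->]]; exists (L * fC v + F * M)%fps; split.
- now apply l2_add; [apply l2_C_r|apply contractive_l2].
- transitivity (F * fC v + F * fl x * M)%fps; [fring|].
  rewrite <- fl_real_central, fC_mul.
  transitivity ((fC u + fl x * L) * fC v + fl x * F * M)%fps; [now rewrite <- e|fring].
Qed.

(** Evaluation of the equation that defines [schur]; with the denominators cleared
    it only contains sums and products. *)
Lemma schur_value (r x : R) a F F' v w :
  r * r < 1 -> x * x < 1 -> qn a < 1 -> contractive F -> contractive F' ->
  schur r a F F' -> hasval F x v -> hasval F' x w ->
  (v * ((1 - r * x)%R + qconj a * ((x - r)%R * w)) = (x - r)%R * w + a * (1 - r * x)%R)%Q.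
Proof.
intros hr hx ha hF hF' h hv hw.
assert (hr1 : hasval (fr r) x (1 - r * x)%R).
{ exists (fC (- r)%R); split; [apply l2_C|].
  apply fps_ext; intros [|[|m]]; unfold fadd; rewrite ?fl_l0, ?fl_lS;
    unfold fr, fsub; rewrite fmul_X_l; simpl; qring. }
assert (hl : forall B u, l2 B -> hasval B x u -> hasval (fl r * B) x ((x - r)%R * u)%Q).
{ intros B u hB hu.
  replace (fl r * B)%fps with (fC (x - r)%R * B + fl x * B)%fps.
  - replace ((x - r)%R * u)%Q with ((x - r)%R * u + RtoQ 0)%Q by qring.
    apply hasval_add; [now apply hasval_C_mul|].
    exists B; split; [easy|]; rewrite fC0; fpoint; qring.
  - replace (fC (x - r)%R) with (fC x - fC r)%fps; [unfold fl; fring|].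
    fpoint; destruct m; simpl; qring. }
apply (hasval_unique (F * (fr r + fC (qconj a) * (fl r * F'))) x).
- now rewrite qnR.
- apply hasval_mul; auto; apply hasval_add; [easy|].
  apply hasval_C_mul, hl; [now apply contractive_is_l2|easy].
- rewrite h; apply hasval_add; [|now apply hasval_C_mul].
  apply hl; [now apply contractive_is_l2|easy].
Qed.

(** * Convergence of quaternionic series *)

(** This is [is_series] (see [is_series_qser]), in a form suited to estimates: sums
    over [k < m], and the multiplicative modulus in place of the norm. *)
Definition is_qser (u : nat -> quat) (v : quat) : Prop :=
  is_lim_seq (fun m => qmod (qsum u m - v)) 0.

Lemma norm_qmod (q : quat) : norm q = qmod q.
Proof.
destruct q as [[[a b] c] d]; unfold qmod.
change (sqrt (sqrt (sqrt (Rabs a ^ 2 + Rabs b ^ 2) ^ 2 + Rabs c ^ 2) ^ 2 + Rabs d ^ 2)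
  = sqrt (a ^ 2 + b ^ 2 + c ^ 2 + d ^ 2)).
pose proof (pow2_ge_0 a); pose proof (pow2_ge_0 b); pose proof (pow2_ge_0 c).
rewrite !pow2_abs, (pow2_sqrt (a ^ 2 + b ^ 2)), pow2_sqrt by lra; easy.
Qed.

Lemma plus_quat (p q : quat) : plus p q = (p + q)%Q.
Proof. now destruct p as [[[? ?] ?] ?], q as [[[? ?] ?] ?]. Qed.

Lemma minus_quat (p q : quat) : minus p q = (p - q)%Q.
Proof. now destruct p as [[[? ?] ?] ?], q as [[[? ?] ?] ?]. Qed.

Lemma sum_n_qsum (u : nat -> quat) n : sum_n u n = qsum u (S n).
Proof.
induction n as [|n IH]; [rewrite sum_O; simpl; qring|].
rewrite sum_Sn, IH; apply plus_quat.
Qed.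

Lemma is_series_qser (u : nat -> quat) (v : quat) : is_series u v <-> is_qser u v.
Proof.
etransitivity; [apply (filterlim_locally_ball_norm (F := eventually))|].
unfold is_qser; rewrite is_lim_seq_incr_1, is_lim_seq_0.
split; intros h eps; destruct (h eps) as [n hn]; exists n; intros m hm; specialize (hn m hm);
  unfold ball_norm in *; rewrite sum_n_qsum, minus_quat, norm_qmod in *;
  rewrite Rabs_pos_eq in * by apply qmod_ge0; exact hn.
Qed.

Lemma is_qser_ext u v w : (forall m, u m = v m) -> is_qser u w -> is_qser v w.
Proof. intros h; now rewrite (functional_extensionality _ _ h). Qed.

Lemma is_qser_qmod_le u v c : is_qser u v -> (forall n, qmod (qsum u n) <= c) -> qmod v <= c.
Proof.
intros h hb; apply (le_of_lim_0 _ _ _ h); intros n; specialize (hb n).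
pose proof (qmod_triangle_sub (qsum u n) (qsum u n - v)) as e.
replace (qsum u n - (qsum u n - v))%Q with v in e by qring; lra.
Qed.

Lemma is_qser_add u v x y : is_qser u x -> is_qser v y ->
  is_qser (fun m => u m + v m)%Q (x + y)%Q.
Proof.
intros hu hv; eapply squeeze_0; [|exact (is_lim_seq_plus_0 _ _ hu hv)].
intros m; split; [apply qmod_ge0|]; rewrite qsum_add.
replace (qsum u m + qsum v m - (x + y))%Q with ((qsum u m - x) + (qsum v m - y))%Q by qring.
apply qmod_triangle.
Qed.

Lemma is_qser_mul_l c u v : is_qser u v -> is_qser (fun m => c * u m)%Q (c * v)%Q.
Proof.
intros h; apply (is_lim_seq_scal_0 (qmod c)) in h; revert h; apply is_lim_seq_ext.
intros m; rewrite qsum_mul_l, <- qmodM; f_equal; qring.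
Qed.

Lemma is_qser_mul_r c u v : is_qser u v -> is_qser (fun m => u m * c)%Q (v * c)%Q.
Proof.
intros h; apply (is_lim_seq_scal_0 (qmod c)) in h; revert h; apply is_lim_seq_ext.
intros m; rewrite qsum_mul_r, Rmult_comm, <- qmodM; f_equal; qring.
Qed.

Lemma is_qser_unique u v w : is_qser u v -> is_qser u w -> v = w.
Proof.
intros hv hw; apply qsub_eq0, qmod0, Rle_antisym; [|apply qmod_ge0].
apply (is_qser_qmod_le (fun m => u m + RtoQ (-1) * u m)%Q).
- replace (v - w)%Q with (v + RtoQ (-1) * w)%Q by qring.
  now apply is_qser_add, is_qser_mul_l.
- intros n; rewrite qsum_0, qmodR, Rabs_R0; [lra|intros; qring].
Qed.

Lemma is_qser_shift k u v : is_qser (fun m => u (k + m)%nat) v -> is_qser u (qsum u k + v)%Q.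
Proof.
intros h; apply (is_lim_seq_incr_n _ k); revert h; apply is_lim_seq_ext; intros m; f_equal.
replace (qsum u (m + k)) with (qsum u k + qsum (fun m => u (k + m)%nat) m)%Q; [qring|].
induction m as [|m IH]; simpl; [qring|].
rewrite <- IH, (Nat.add_comm m k); qring.
Qed.

(** Coordinates are the functionals [qdot (qe i)] with [i < 4]; real analysis is
    applied to [qdot w] for arbitrary [w], which commutes with sums. *)
Definition qe (i : nat) : quat :=
  match i with
  | 0%nat => (1, 0, 0, 0) | 1%nat => (0, 1, 0, 0)
  | 2%nat => (0, 0, 1, 0) | _ => (0, 0, 0, 1)
  end.

Arguments qe : simpl never.

Lemma qdot_basis w q : qdot w q = rsum (fun i => qdot w (qe i) * qdot (qe i) q) 4.
Proof. simpl rsum; unfold qe; qreal. Qed.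

Lemma qdot_sum w u n : qdot w (qsum u n) = rsum (fun k => qdot w (u k)) n.
Proof. induction n as [|n IH]; simpl; [qreal|]; rewrite <- IH; qreal. Qed.

Lemma qdot_real_r w (x : R) q : qdot w (x * q) = x * qdot w q.
Proof. qreal. Qed.

Lemma qdot_inj p q : (forall w, qdot w p = qdot w q) -> p = q.
Proof.
intros h; apply qsub_eq0, qn0.
replace (qn (p - q)) with (qdot (p - q) p - qdot (p - q) q) by qreal.
rewrite h; ring.
Qed.

Lemma Rabs_qdot w q : Rabs (qdot w q) <= qmod w * qmod q.
Proof.
apply Rabs_le; split; [|apply qdot_le].
pose proof (qdot_le (- w) q) as h; rewrite qdotNl, qmodN in h; lra.
Qed.

Lemma qmod_coords q : qmod q <= rsum (fun i => Rabs (qdot (qe i) q)) 4.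
Proof.
rewrite qmod_sqrt, qdot_self, qdot_basis; simpl rsum.
set (x := qdot (qe 0) q); set (y := qdot (qe 1) q).
set (z := qdot (qe 2) q); set (t := qdot (qe 3) q).
rewrite !(qdotC q); fold x y z t.
pose proof (Rabs_pos x); pose proof (Rabs_pos y); pose proof (Rabs_pos z); pose proof (Rabs_pos t).
match goal with |- _ <= ?b => rewrite <- (sqrt_square b) by lra end.
apply sqrt_le_1_alt.
assert (e : forall u, u * u = Rabs u * Rabs u) by (intros u; apply Rsqr_abs).
rewrite (e x), (e y), (e z), (e t); nra.
Qed.

Lemma sum_n_qdot w u n : sum_n (fun m => qdot w (u m)) n = qdot w (qsum u (S n)).
Proof.
rewrite qdot_sum; induction n as [|n IH]; [rewrite sum_O; simpl; ring|].
now rewrite sum_Sn, IH.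
Qed.

Lemma is_qser_qdot w u v : is_qser u v -> is_series (fun m => qdot w (u m)) (qdot w v).
Proof.
intros h; apply (is_lim_seq_scal_0 (qmod w)), is_lim_seq_incr_1 in h.
apply (is_lim_seq_spec _ (qdot w v)); intros eps.
destruct (proj1 (is_lim_seq_0 _) h eps) as [n hn]; exists n; intros m hm.
specialize (hn m hm); eapply Rle_lt_trans; [|exact hn].
rewrite (Rabs_pos_eq (_ * _)) by (apply Rmult_le_pos; apply qmod_ge0).
eapply Rle_trans; [|apply Rabs_qdot]; right; f_equal.
rewrite sum_n_qdot; qreal.
Qed.

Lemma is_qser_of_coords u v :
  (forall i, (i < 4)%nat -> is_series (fun m => qdot (qe i) (u m)) (qdot (qe i) v)) -> is_qser u v.
Proof.
intros h; apply squeeze_0 with (fun m => rsum (fun i => Rabs (qdot (qe i) (qsum u m - v))) 4).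
{ intros m; split; [apply qmod_ge0|apply qmod_coords]. }
assert (h' : forall k, (k <= 4)%nat ->
  is_lim_seq (fun m => rsum (fun i => Rabs (qdot (qe i) (qsum u m - v))) k) 0); [|now apply h'].
induction k as [|k IH]; intros hk; [apply is_lim_seq_const|]; simpl.
apply is_lim_seq_plus_0; [apply IH; lia|].
apply is_lim_seq_incr_1; specialize (h k ltac:(lia)); apply is_lim_seq_0; intros eps.
apply (is_lim_seq_spec _ (qdot (qe k) v)) in h; destruct (h eps) as [n hn].
exists n; intros m hm; specialize (hn m hm); rewrite Rabs_Rabsolu.
eapply Rle_lt_trans; [|exact hn]; rewrite sum_n_qdot; right; f_equal; qreal.
Qed.

Lemma qSeries_unique u v : is_qser u v -> qSeries u = v.
Proof.
intros h.
assert (e : forall i c, (forall q, qdot (qe i) q = c q) -> Series (fun m => c (u m)) = c v).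
{ intros i c hc; rewrite <- hc; apply is_series_unique.
  generalize (is_qser_qdot (qe i) u v h); apply is_series_ext; intros m; apply hc. }
unfold qSeries; repeat apply injective_projections; simpl;
  [rewrite (e 0%nat (fun q => let '(a, _, _, _) := q in a))
  |rewrite (e 1%nat (fun q => let '(_, b, _, _) := q in b))
  |rewrite (e 2%nat (fun q => let '(_, _, c, _) := q in c))
  |rewrite (e 3%nat (fun q => let '(_, _, _, d) := q in d))];
  try (intros [[[? ?] ?] ?]; unfold qe, qdot; ring); now destruct v as [[[? ?] ?] ?].
Qed.

Lemma qser_ex u b : (forall m, qmod (u m) <= b m) -> ex_series b -> exists v, is_qser u v.
Proof.
intros h hb; set (S i := Series (fun m => qdot (qe i) (u m))).
exists (S 0%nat, S 1%nat, S 2%nat, S 3%nat); apply is_qser_of_coords; intros i hi.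
replace (qdot (qe i) (S 0%nat, S 1%nat, S 2%nat, S 3%nat)) with (S i).
- apply Series_correct, (ex_series_le (V := R_CompleteNormedModule) _ b); [|easy].
  intros m; eapply Rle_trans; [apply Rabs_qdot|].
  replace (qmod (qe i)) with 1; [rewrite Rmult_1_l; apply h|].
  symmetry; apply qmod_eq1; unfold qe, qn.
  destruct i as [|[|[|i]]]; ring.
- unfold qe, qdot; destruct i as [|[|[|[|i]]]]; try lia; ring.
Qed.

(** * Power series functions *)

Notation term q a := (fun m : nat => (qpow q m * a m)%Q).

Lemma has_expansion_qser f a :
  has_expansion f a <-> forall q, inB q -> is_qser (term q a) (f q).
Proof. split; intros h q hq; apply is_series_qser, h, hq. Qed.

Lemma expansion_qPSeries a :
  (forall q, inB q -> exists v, is_qser (term q a) v) -> has_expansion (qPSeries a) a.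
Proof.
intros h; apply has_expansion_qser; intros q hq; destruct (h q hq) as [v hv].
unfold qPSeries; now rewrite (qSeries_unique _ v).
Qed.

Lemma expansion_unique_fun f g a q :
  has_expansion f a -> has_expansion g a -> inB q -> f q = g q.
Proof.
intros hf hg hq; apply (is_qser_unique (term q a)); now apply has_expansion_qser.
Qed.

Lemma inB_real (x : R) : inB (RtoQ x) <-> -1 < x < 1.
Proof. unfold inB; rewrite qmodR; apply Rabs_lt_between. Qed.

Lemma coord_radius w a x : (exists v, is_qser (term (RtoQ x) a) v) ->
  Rbar_le (Rabs x) (CV_radius (fun m => qdot w (a m))).
Proof.
intros [v hv]; apply Rbar_not_lt_le; intros h; apply (CV_disk_outside _ _ h).
apply (is_qser_qdot w) in hv; apply ex_series_lim_0; exists (qdot w v).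
revert hv; apply is_series_ext; intros m.
rewrite qpow_real, qdot_real_r; apply Rmult_comm.
Qed.

(** At real points every [qdot w] of the series is a real power series. *)
Lemma qser_coef_unique delta (g : R -> quat) a b : 0 < delta ->
  (forall x, Rabs x < delta -> is_qser (term (RtoQ x) a) (g x)) ->
  (forall x, Rabs x < delta -> is_qser (term (RtoQ x) b) (g x)) -> a = b.
Proof.
intros hd ha hb; apply functional_extensionality; intros n; apply qdot_inj; intros w.
assert (hr : forall a, (forall x, Rabs x < delta -> is_qser (term (RtoQ x) a) (g x)) ->
  Rbar_lt 0 (CV_radius (fun m => qdot w (a m)))).
{ clear - hd; intros a h; assert (e : Rabs (delta / 2) = delta / 2) by (apply Rabs_pos_eq; lra).
  apply Rbar_lt_le_trans with (Rabs (delta / 2)); [simpl; lra|].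
  apply coord_radius; exists (g (delta / 2)); apply h; lra. }
assert (hv : forall a x, is_qser (term (RtoQ x) a) (g x) ->
  PSeries (fun m => qdot w (a m)) x = qdot w (g x)).
{ clear; intros a x h; apply is_series_unique.
  apply (is_qser_qdot w) in h; revert h; apply is_series_ext; intros m.
  rewrite qpow_real, qdot_real_r; apply Rmult_comm. }
apply (PSeries_ext_recip (fun m => qdot w (a m)) (fun m => qdot w (b m)) n);
  [exact (hr a ha)|exact (hr b hb)|].
apply (locally_interval _ 0 (- delta) delta); try (simpl; lra).
intros x hx1 hx2; simpl in hx1, hx2.
assert (hx : Rabs x < delta) by (apply Rabs_lt_between; lra).
now rewrite (hv a), (hv b) by auto.
Qed.

Lemma expansion_unique f g a b :
  has_expansion f a -> has_expansion g b ->
  (forall x, -1 < x < 1 -> f (RtoQ x) = g (RtoQ x)) -> a = b.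
Proof.
intros hf hg e; apply (qser_coef_unique 1 (fun x => f (RtoQ x))); [lra| |];
  intros x hx; apply Rabs_lt_between in hx; [|rewrite e by lra];
  (apply (has_expansion_qser f a) || apply (has_expansion_qser g b)); auto; now apply inB_real.
Qed.

Lemma coeffs_unique f a : has_expansion f a -> coeffs f = a.
Proof.
intros h; apply (expansion_unique f f); [|easy|easy].
unfold coeffs; apply epsilon_spec; now exists a.
Qed.

Lemma is_qser_geom_le u v c t : 0 <= c -> 0 <= t < 1 -> is_qser u v ->
  (forall m, qmod (u m) <= c * t ^ m) -> qmod v <= c / (1 - t).
Proof.
intros hc ht h hu; apply (is_qser_qmod_le u); [easy|]; intros n.
eapply Rle_trans; [apply qmod_qsum|].
eapply Rle_trans; [apply rsum_le; intros k _; apply hu|].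
rewrite rsum_scal; now apply Rmult_le_compat_l, rsum_geom_le.
Qed.

Lemma qser_geom u c t : 0 <= c -> 0 <= t < 1 -> (forall m, qmod (u m) <= c * t ^ m) ->
  exists v, is_qser u v /\ qmod v <= c / (1 - t).
Proof.
intros hc ht h; destruct (qser_ex u _ h) as [v hv].
- apply (ex_series_scal_l (V := R_NormedModule) c (fun m => t ^ m)); exists (/ (1 - t)).
  apply is_series_geom; rewrite Rabs_pos_eq; lra.
- exists v; split; [easy|now apply (is_qser_geom_le u)].
Qed.

Lemma is_qser_tail u v c x k : 0 <= c -> 0 <= x < 1 -> is_qser u v ->
  (forall m, qmod (u m) <= c * x ^ m) -> qmod (qsum u k - v) <= c * x ^ k / (1 - x).
Proof.
intros hc hx h hu.
destruct (qser_geom (fun m => u (k + m)%nat) (c * x ^ k) x) as [w [hw hb]]; [|easy| |].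
- apply Rmult_le_pos; [easy|now apply pow_le].
- intros m; rewrite Rmult_assoc, <- pow_add; apply hu.
- rewrite (is_qser_unique u v _ h (is_qser_shift k u w hw)).
  replace (qsum u k - (qsum u k + w))%Q with (- w)%Q by qring; now rewrite qmodN.
Qed.

Lemma is_qser_bounded u v : is_qser u v -> exists c, forall m, qmod (u m) <= c.
Proof.
intros h; apply is_lim_seq_Reals in h; destruct (maj_by_pos _ (exist _ _ h)) as [c [_ hc]].
exists (c + c); intros m.
replace (u m) with ((qsum u (S m) - v) - (qsum u m - v))%Q by (simpl; qring).
eapply Rle_trans; [apply qmod_triangle_sub|].
apply Rplus_le_compat; (eapply Rle_trans; [apply Rle_abs|apply hc]).
Qed.

Lemma bounded_qser a c q : (forall m, qmod (a m) <= c) -> inB q ->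
  is_qser (term q a) (qSeries (term q a)) /\
  qmod (qSeries (term q a)) <= c / (1 - qmod q).
Proof.
intros h hq; pose proof (qmod_ge0 q).
destruct (qser_geom (term q a) c (qmod q)) as [v [hv hc]].
- eapply Rle_trans; [apply (qmod_ge0 (a 0%nat))|apply h].
- split; [easy|exact hq].
- intros m; rewrite qmodM, qmod_pow, Rmult_comm.
  apply Rmult_le_compat_r; [now apply pow_le|apply h].
- now rewrite (qSeries_unique _ v hv).
Qed.

(** For bounded [L] the boundary term in [blaschke_energy] is bounded, so that
    [fl q * L] may be replaced by [fr (qconj q) * L], whose second factor is
    recovered by a geometric series. *)
Lemma l2_quotient q L : qn q < 1 -> (exists c, forall m, qmod (L m) <= c) ->
  l2 (fl q * L) -> l2 L.
Proof.
intros hq [c hc] [d hd].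
assert (hh : l2 (fr (qconj q) * L)).
{ exists (d + (1 - qn q) * (c * c)); intros n.
  eapply Rle_trans; [apply (sumsq_mono _ n (S n)); lia|].
  rewrite blaschke_energy; apply Rplus_le_compat; [apply hd|].
  apply Rmult_le_compat_l; [lra|]; rewrite <- qmod_sqr.
  pose proof (qmod_ge0 (L n)); specialize (hc n); nra. }
replace L with (fgeom (qconj q) * (fr (qconj q) * L))%fps.
- apply l2_geom; [now rewrite qn_conj|easy].
- now rewrite fmulA, geom_fr, fmul1l.
Qed.

(** The coefficients of the quotient of [F - v] by [fl q] are the sums of the tails
    of the series. *)
Lemma hasval_qSeries F q : contractive F -> inB q ->
  is_qser (term q F) (qSeries (term q F)) /\ hasval F q (qSeries (term q F)).
Proof.
intros hF hq.
assert (hb : forall k m, qmod (F (k + m)%nat) <= 1)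
  by (intros k m; apply qmod_le1, contractive_coef, hF).
set (V := fun k => qSeries (term q (fun m => F (k + m)%nat))).
assert (hV : forall k, is_qser (term q (fun m => F (k + m)%nat)) (V k))
  by (intros k; apply (bounded_qser _ 1); auto).
split; [apply (hV 0%nat)|].
assert (rec : forall k, V k = (F k + q * V (S k))%Q).
{ intros k; apply (is_qser_unique _ _ _ (hV k)).
  replace (F k) with (qsum (term q (fun m => F (k + m)%nat)) 1)
    by (simpl; rewrite Nat.add_0_r; qring).
  apply is_qser_shift.
  apply (is_qser_ext (fun m => q * (qpow q m * F (S k + m)%nat))%Q).
  - intros m; simpl; rewrite <- qmultA; do 3 f_equal; lia.
  - apply is_qser_mul_l, hV. }
set (L := fun m => V (S m)).
assert (eF : F = (fC (V 0%nat) + fl q * L)%fps).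
{ apply fps_ext; intros [|m]; unfold fadd; [rewrite fl_l0|rewrite fl_lS]; simpl; unfold L.
  - rewrite (rec 0%nat); qring.
  - rewrite (rec (S m)); qring. }
exists L; split; [|exact eF].
apply (l2_quotient q); [now apply qmod_lt1|exists (1 / (1 - qmod q)); intros m|].
- unfold L; apply (bounded_qser (fun j => F (S m + j)%nat)); auto.
- replace (fl q * L)%fps with (F - fC (V 0%nat))%fps by (rewrite eF at 1; fring).
  apply l2_sub; [now apply contractive_is_l2|apply l2_C].
Qed.

Lemma hasval_qser F q v : contractive F -> inB q -> is_qser (term q F) v -> hasval F q v.
Proof.
intros hF hq h; destruct (hasval_qSeries F q hF hq) as [h1 h2].
now rewrite (is_qser_unique _ _ _ h h1).
Qed.

(** * Calculus of quaternion-valued functions *)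

Lemma inS_imaginary I : inS I -> qconj I = (- I)%Q /\ qn I = 1.
Proof.
destruct I as [[[a b] c] d]; unfold inS, qmult, RtoQ; intros h; injection h as h1 h2 h3 h4.
assert (a = 0).
{ destruct (Req_dec a 0) as [|ne]; [easy|].
  assert (b = 0) by nra; assert (c = 0) by nra; assert (d = 0) by nra; subst; nra. }
subst; split; [|unfold qn; lra].
unfold qconj, qopp; repeat apply injective_projections; simpl; ring.
Qed.

Lemma inS_i : inS (0, 1, 0, 0).
Proof. unfold inS; qring. Qed.

Lemma slice_mul I x y x' y' : inS I ->
  (slice I x y * slice I x' y')%Q = slice I (x * x' - y * y') (x * y' + y * x').
Proof.
unfold inS, slice; intros h.
transitivity ((x * x')%R + (x * y' + y * x')%R * I + (y * y')%R * (I * I))%Q; [qring|].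
rewrite h; qring.
Qed.

Lemma slice_qn I x y : inS I -> qn (slice I x y) = x * x + y * y.
Proof.
intros h; destruct (inS_imaginary I h) as [h1 h2]; apply RtoQ_inj.
rewrite <- qmult_conj; unfold slice; rewrite qconjD, qconjM, !qconjR, h1.
transitivity ((x * x)%R - (y * y)%R * (I * I))%Q; [qring|].
rewrite h; qring.
Qed.

Lemma qmod_circle I rho th : inS I -> 0 <= rho ->
  qmod (slice I (rho * cos th) (rho * sin th)) = rho.
Proof.
intros hI hr; rewrite qmod_sqrt, slice_qn by easy.
replace (_ + _) with (rho * rho * (Rsqr (sin th) + Rsqr (cos th))) by (unfold Rsqr; ring).
rewrite sin2_cos2, Rmult_1_r; now apply sqrt_square.
Qed.

Section QuaternionContinuity.
Context {T : UniformSpace}.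
Implicit Types (g h : T -> quat) (u : T -> R) (x : T).

(** Continuity of all real functionals, which is how continuity is both produced
    and used by one-variable real analysis. *)
Definition qcont g x : Prop := forall w, continuous (fun t => qdot w (g t)) x.

Lemma continuous_Rmult u v x :
  continuous u x -> continuous v x -> continuous (fun t : T => u t * v t) x.
Proof. apply (continuous_mult (K := R_AbsRing)). Qed.

Lemma continuous_Rplus u v x :
  continuous u x -> continuous v x -> continuous (fun t : T => u t + v t) x.
Proof. apply (continuous_plus (V := R_NormedModule)). Qed.

Lemma continuous_Rscal k u x : continuous u x -> continuous (fun t : T => k * u t) x.
Proof. apply (continuous_Rmult (fun _ => k)), continuous_const. Qed.

Lemma continuous_Rshift k u x : continuous u x -> continuous (fun t : T => u t - k) x.
Proof. intros h; apply (continuous_Rplus u (fun _ => - k)); [easy|apply continuous_const]. Qed.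

Lemma continuous_rsum (u : nat -> T -> R) n x :
  (forall k, continuous (u k) x) -> continuous (fun t => rsum (fun k => u k t) n) x.
Proof.
intros h; induction n as [|n IH]; [apply continuous_const|].
now apply (continuous_Rplus (fun t => rsum (fun k => u k t) n)).
Qed.

Lemma qcont_const k x : qcont (fun _ => k) x.
Proof. intros w; apply continuous_const. Qed.

Lemma qcont_add g h x : qcont g x -> qcont h x -> qcont (fun t => g t + h t)%Q x.
Proof.
intros hg hh w; eapply continuous_ext; [|exact (continuous_Rplus _ _ x (hg w) (hh w))].
intros t; qreal.
Qed.

Lemma qcont_real u x : continuous u x -> qcont (fun t => RtoQ (u t)) x.
Proof.
intros hu w; eapply continuous_ext; [|exact (continuous_Rscal (qdot w 1) u x hu)].
intros t; qreal.
Qed.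

Lemma qcont_mul g h x : qcont g x -> qcont h x -> qcont (fun t => g t * h t)%Q x.
Proof.
intros hg hh w.
apply continuous_ext with
  (fun t => rsum (fun i => qdot (qe i) (g t) * qdot (qconj (qe i) * w) (h t)) 4).
- intros t; cbn [rsum]; unfold qe; qreal.
- apply (continuous_rsum (fun i t => qdot (qe i) (g t) * qdot (qconj (qe i) * w) (h t))).
  intros i; apply continuous_Rmult; [apply hg|apply hh].
Qed.

Lemma qcont_sum (g : nat -> T -> quat) n x :
  (forall k, qcont (g k) x) -> qcont (fun t => qsum (fun k => g k t) n) x.
Proof. intros hg; induction n as [|n IH]; [apply qcont_const|apply qcont_add; auto]. Qed.

Lemma qcont_slice I u v x :
  continuous u x -> continuous v x -> qcont (fun t => slice I (u t) (v t)) x.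
Proof.
intros hu hv; apply qcont_add; [now apply qcont_real|].
apply qcont_mul; [now apply qcont_real|apply qcont_const].
Qed.
End QuaternionContinuity.

Lemma scal_quat (x : R) (q : quat) : scal x q = (RtoQ x * q)%Q.
Proof.
destruct q as [[[b c] d] e].
transitivity ((x * b, x * c, x * d, x * e) : quat); [easy|qring].
Qed.

Lemma is_linear_qdot w :
  is_linear (K := R_AbsRing) (U := prod_NormedModule _ (prod_NormedModule _
    (prod_NormedModule _ R_NormedModule R_NormedModule) R_NormedModule) R_NormedModule)
    (V := R_NormedModule) (qdot w).
Proof.
split.
- intros p q; rewrite plus_quat; apply qdotDr.
- intros k q; rewrite scal_quat; apply qdot_real_r.
- exists (qmod w + 1); pose proof (qmod_ge0 w); split; [lra|]; intros q.
  change (Rabs (qdot w q) <= (qmod w + 1) * norm (q : quat)); rewrite norm_qmod.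
  pose proof (Rabs_qdot w q); pose proof (qmod_ge0 q); lra.
Qed.

Lemma continuous_qcont {T : UniformSpace} (g : T -> quat) x : continuous g x -> qcont g x.
Proof.
intros h w; apply (continuous_comp g (qdot w)); [exact h|].
exact (linear_cont _ _ (is_linear_qdot w)).
Qed.

Lemma is_derive_qdot w (g : R -> quat) x l :
  is_derive g x l -> is_derive (fun t => qdot w (g t)) x (qdot w l).
Proof.
intros h; eapply filterdiff_ext_lin.
- apply (filterdiff_comp' g (qdot w) x (fun y => scal y l) (qdot w)); [exact h|].
  apply filterdiff_linear, is_linear_qdot.
- intros y; apply (linear_scal _ (is_linear_qdot w)).
Qed.

Definition qInt (g : R -> quat) (a b : R) : quat :=
  qsum (fun i => RtoQ (RInt (fun t => qdot (qe i) (g t)) a b) * qe i)%Q 4.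

Lemma is_RInt_inj (f : R -> R) a b x y : is_RInt f a b x -> is_RInt f a b y -> x = y.
Proof.
intros hx hy; apply (is_RInt_unique (V := R_CompleteNormedModule)) in hx, hy.
now rewrite <- hx.
Qed.

Lemma is_RInt_0 a b : is_RInt (fun _ => 0) a b 0.
Proof.
assert (h : is_RInt (fun _ => 0) a b ((b - a) * 0)) by apply (is_RInt_const (V := R_NormedModule)).
now rewrite Rmult_0_r in h.
Qed.

Lemma ex_RInt_cont (f : R -> R) a b : (forall t : R, continuous f t) -> ex_RInt f a b.
Proof. intros h; apply (ex_RInt_continuous (V := R_CompleteNormedModule)); auto. Qed.

Lemma RInt_qdot w (g : R -> quat) a b : (forall t : R, qcont g t) ->
  is_RInt (fun t => qdot w (g t)) a b (qdot w (qInt g a b)).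
Proof.
intros hg; apply is_RInt_ext with (fun t => rsum (fun i => qdot w (qe i) * qdot (qe i) (g t)) 4).
{ intros t _; symmetry; apply qdot_basis. }
unfold qInt; rewrite qdot_sum.
rewrite (rsum_ext _ (fun i => qdot w (qe i) * RInt (fun t => qdot (qe i) (g t)) a b))
  by (intros; rewrite qdot_real_r; ring).
generalize 4%nat; induction n as [|n IH]; simpl.
- apply is_RInt_0.
- apply (is_RInt_plus (V := R_NormedModule)); [easy|].
  apply (is_RInt_scal (V := R_NormedModule)), (RInt_correct (V := R_CompleteNormedModule)).
  apply ex_RInt_cont; intros t; apply hg.
Qed.

(** Identities between quaternionic integrals are reduced to real ones. *)
Lemma qInt_unique (g : R -> quat) a b v : (forall t : R, qcont g t) ->
  (forall w, is_RInt (fun t => qdot w (g t)) a b (qdot w v)) -> qInt g a b = v.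
Proof.
intros hg h; apply qdot_inj; intros w.
exact (is_RInt_inj _ a b _ _ (RInt_qdot w g a b hg) (h w)).
Qed.

Lemma qInt_mul_l k (g : R -> quat) a b : (forall t : R, qcont g t) ->
  qInt (fun t => k * g t)%Q a b = (k * qInt g a b)%Q.
Proof.
intros hg; apply qInt_unique; [intros t; apply qcont_mul; [apply qcont_const|easy]|].
intros w; replace (qdot w (k * qInt g a b)) with (qdot (qconj k * w) (qInt g a b)) by qreal.
eapply is_RInt_ext; [|exact (RInt_qdot (qconj k * w) g a b hg)]; intros t _; qreal.
Qed.

Lemma qInt_mul_r k (g : R -> quat) a b : (forall t : R, qcont g t) ->
  qInt (fun t => g t * k)%Q a b = (qInt g a b * k)%Q.
Proof.
intros hg; apply qInt_unique; [intros t; apply qcont_mul; [easy|apply qcont_const]|].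
intros w; replace (qdot w (qInt g a b * k)) with (qdot (w * qconj k) (qInt g a b)) by qreal.
eapply is_RInt_ext; [|exact (RInt_qdot (w * qconj k) g a b hg)]; intros t _; qreal.
Qed.

Lemma qInt_sum (g : nat -> R -> quat) n a b : (forall k (t : R), qcont (g k) t) ->
  qInt (fun t => qsum (fun k => g k t) n) a b = qsum (fun k => qInt (g k) a b) n.
Proof.
intros hg; apply qInt_unique; [intros t; now apply qcont_sum|]; intros w.
induction n as [|n IH]; simpl.
- replace (qdot w 0) with 0 by qreal; generalize (is_RInt_0 a b).
  apply is_RInt_ext; intros t _; qreal.
- replace (qdot w (qsum (fun k => qInt (g k) a b) n + qInt (g n) a b)) with
    (qdot w (qsum (fun k => qInt (g k) a b) n) + qdot w (qInt (g n) a b)) by qreal.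
  eapply is_RInt_ext; [|exact (is_RInt_plus (V := R_NormedModule) _ _ _ _ _ _ IH
    (RInt_qdot w (g n) a b (hg n)))].
  intros t _; unfold plus; simpl; qreal.
Qed.

Lemma RInt_of_derivative (F dF : R -> R) a b :
  (forall x : R, is_derive F x (dF x)) -> (forall x : R, continuous dF x) ->
  is_RInt dF a b (F b - F a).
Proof. intros h1 h2; apply (is_RInt_derive (V := R_CompleteNormedModule)); auto. Qed.

(** Compactness is applied to a gauge that is small where the function is large. *)
Lemma bounded_2d (g : R -> R -> R) a b a' b' :
  (forall x y, a <= x <= b -> a' <= y <= b' -> continuity_2d_pt g x y) ->
  exists c, forall x y, a <= x <= b -> a' <= y <= b' -> Rabs (g x y) <= c.
Proof.
intros hg.
assert (hd : forall x y, exists d : posreal, d * (1 + Rabs (g x y)) <= 1 /\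
  (a <= x <= b -> a' <= y <= b' ->
   forall u v, Rabs (u - x) < d -> Rabs (v - y) < d -> Rabs (g u v - g x y) < 1)).
{ intros x y; pose proof (Rabs_pos (g x y)) as hp.
  assert (hp' : 0 < / (1 + Rabs (g x y))) by (apply Rinv_0_lt_compat; lra).
  assert (hi : / (1 + Rabs (g x y)) * (1 + Rabs (g x y)) = 1) by (field; lra).
  destruct (excluded_middle_informative
    (a <= x <= b /\ a' <= y <= b')) as [[h1 h2]|n].
  - destruct (hg x y h1 h2 (mkposreal 1 Rlt_0_1)) as [d h].
    assert (hm : 0 < Rmin d (/ (1 + Rabs (g x y)))) by (apply Rmin_pos; [apply d|easy]).
    exists (mkposreal _ hm); simpl; split.
    + eapply Rle_trans; [apply Rmult_le_compat_r; [lra|apply Rmin_r]|lra].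
    + intros _ _ u v hu hv; apply h; eapply Rlt_le_trans; eauto; apply Rmin_l.
  - exists (mkposreal _ hp'); simpl; split; [lra|tauto]. }
set (delta := fun x y => proj1_sig (constructive_indefinite_description _ (hd x y))).
destruct (compactness_value_2d a b a' b' delta) as [d h].
exists (1 + / d); intros x y hx hy.
apply Rnot_lt_le; intros hlt; apply (h x y hx hy); intros [u [v [hu [hv [h1 [h2 h3]]]]]].
unfold delta in *.
destruct (constructive_indefinite_description _ (hd u v)) as [e [e1 e2]]; simpl in *.
specialize (e2 hu hv x y h1 h2).
pose proof (cond_pos d) as hd0; pose proof (cond_pos e) as he0.
assert (Rabs (g u v) <= / d).
{ pose proof (Rabs_pos (g u v)); apply Rmult_le_reg_l with d; [easy|].
  rewrite Rinv_r by lra; nra. }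
pose proof (Rabs_triang (g x y - g u v) (g u v)) as ht.
replace (g x y - g u v + g u v) with (g x y) in ht by ring; lra.
Qed.

(** * The Cauchy expansion of a slice regular function *)

Section Cauchy.
Variables (I : quat) (f : quat -> quat) (fx fy : R -> R -> quat).
Hypothesis hI : inS I.
Hypothesis H : forall x y : R, inB (slice I x y) ->
    is_derive (fun t : R => f (slice I t y)) x (fx x y) /\
    is_derive (fun t : R => f (slice I x t)) y (fy x y) /\
    continuous (fun z : R * R => fx (fst z) (snd z)) (x, y) /\
    continuous (fun z : R * R => fy (fst z) (snd z)) (x, y) /\
    (RtoQ (/ 2) * (fx x y + I * fy x y))%Q = RtoQ 0.

Let D (x y : R) : Prop := x * x + y * y < 1.

Lemma disc_inB x y : D x y <-> inB (slice I x y).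
Proof. unfold inB, D; now rewrite qmod_lt1, slice_qn. Qed.

Lemma cauchy_riemann x y : D x y -> fy x y = (I * fx x y)%Q.
Proof.
intros h; apply disc_inB, H in h; destruct h as [_ [_ [_ [_ h]]]].
assert (e : (fx x y + I * fy x y)%Q = RtoQ 0).
{ apply (qmult_eq0 (RtoQ (/ 2))); [|intros e; apply RtoQ_inj in e; lra].
  exact h. }
apply (f_equal (fun q => I * q)%Q) in e; rewrite qmultDr, qmultA, hI, qmult0r in e.
apply qsub_eq0; replace (fy x y - I * fx x y)%Q
  with (- (I * fx x y + RtoQ (-1) * fy x y))%Q by qring.
rewrite e; qring.
Qed.

Lemma continuous_disc (T : UniformSpace) (X Y : T -> R) t :
  continuous X t -> continuous Y t -> D (X t) (Y t) -> locally t (fun s => D (X s) (Y s)).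
Proof.
intros hX hY h.
assert (c : continuous (fun s => X s * X s + Y s * Y s) t).
{ apply (continuous_Rplus (fun s => X s * X s)); now apply continuous_Rmult. }
apply (c (fun v => v < 1)); now apply (open_lt 1).
Qed.

Lemma chain_rule w (X Y : R -> R) t X' Y' :
  is_derive X t X' -> is_derive Y t Y' -> D (X t) (Y t) ->
  is_derive (fun s => qdot w (f (slice I (X s) (Y s)))) t
    (qdot w (slice I X' Y' * fx (X t) (Y t))).
Proof.
intros hX hY h; apply is_derive_Reals.
replace (qdot w (slice I X' Y' * fx (X t) (Y t)))
  with (qdot w (fx (X t) (Y t)) * X' + qdot w (fy (X t) (Y t)) * Y').
- apply (derivable_pt_lim_comp_2d (fun x y => qdot w (f (slice I x y))));
    [|now apply is_derive_Reals|now apply is_derive_Reals].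
  apply filterdiff_differentiable_pt_lim.
  assert (hd := proj1 (disc_inB _ _) h).
  apply (is_derive_filterdiff (fun x y => qdot w (f (slice I x y))) (X t) (Y t)
    (fun x y => qdot w (fx x y)) (qdot w (fy (X t) (Y t)))).
  + assert (hl := continuous_disc (prod_UniformSpace R_UniformSpace R_UniformSpace)
      fst snd (X t, Y t) (continuous_fst _ _) (continuous_snd _ _) h).
    revert hl; apply filter_imp; intros [x y] hxy; simpl in *.
    apply is_derive_qdot; apply disc_inB in hxy; now destruct (H _ _ hxy) as [hd1 _].
  + apply is_derive_qdot; now destruct (H _ _ hd) as [_ [hd2 _]].
  + destruct (H _ _ hd) as [_ [_ [hd3 _]]]; exact (continuous_qcont _ _ hd3 w).
- rewrite (cauchy_riemann _ _ h); unfold slice; qreal.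
Qed.

(** The point [Z] of the disc is joined to the circle of radius [rho] by segments;
    [X t th] and [Y t th] are the coordinates, at time [t], on the segment that ends
    in [W th]. The condition [good t] keeps these points inside the unit disc, on an
    open set of times that contains the unit interval. *)
Section Homotopy.
Variables (rho x0 y0 : R).
Hypotheses (hrho : 0 < rho < 1) (hz : x0 * x0 + y0 * y0 < rho * rho).

Let X (t th : R) : R := x0 + t * (rho * cos th - x0).
Let Y (t th : R) : R := y0 + t * (rho * sin th - y0).
Let W (th : R) : quat := slice I (rho * cos th) (rho * sin th).
Let Z : quat := slice I x0 y0.

Let good (t : R) : Prop := rho * (Rabs t + Rabs (1 - t)) < 1.

Lemma qmod_W th : qmod (W th) = rho.
Proof. apply qmod_circle; [easy|lra]. Qed.

Lemma qmod_Z : qmod Z < rho.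
Proof.
unfold Z; rewrite qmod_sqrt, slice_qn by easy.
rewrite <- (sqrt_square rho) by lra; apply sqrt_lt_1; nra.
Qed.

Lemma good_disc t th : good t -> D (X t th) (Y t th).
Proof.
intros h; apply disc_inB; unfold inB.
replace (slice I (X t th) (Y t th)) with (RtoQ t * W th + RtoQ (1 - t) * Z)%Q
  by (unfold W, Z, X, Y, slice; qring).
eapply Rle_lt_trans; [apply qmod_triangle|]; rewrite !qmodM, !qmodR, qmod_W.
pose proof qmod_Z; pose proof (qmod_ge0 Z); unfold good in h.
pose proof (Rabs_pos t); pose proof (Rabs_pos (1 - t)); nra.
Qed.

Lemma good_01 t : 0 <= t <= 1 -> good t.
Proof. intros h; unfold good; rewrite !Rabs_pos_eq; lra. Qed.

Lemma good_open t : good t -> locally t good.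
Proof.
intros h.
assert (c : continuous (fun s : R => rho * (Rabs s + Rabs (1 - s))) t).
{ apply continuous_Rscal, (continuous_Rplus Rabs); [apply continuous_Rabs|].
  apply (continuous_comp (fun s => 1 - s) Rabs); [|apply continuous_Rabs].
  apply (continuous_minus (V := R_NormedModule) (fun _ => 1) (fun s => s));
    [apply continuous_const|apply continuous_id]. }
apply (c (fun v => v < 1)); now apply (open_lt 1).
Qed.

Lemma continuous_trig (g : R -> R) (T : UniformSpace) (u : T -> R) t :
  (forall x : R, continuous g x) -> continuous u t -> continuous (fun s => rho * g (u s)) t.
Proof. intros hg hu; apply continuous_Rscal; now apply (continuous_comp u g). Qed.

Lemma continuous_path (g : R -> R) x p : (forall y : R, continuous g y) ->
  continuous (fun q : R * R => x + fst q * (rho * g (snd q) - x)) p.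
Proof.
intros hg; apply (continuous_Rplus (fun _ => x)); [apply continuous_const|].
apply (continuous_Rmult (fun q : R * R => fst q)); [apply continuous_fst|].
apply (continuous_Rshift x); now apply continuous_trig, continuous_snd.
Qed.

Lemma qcont_W (T : UniformSpace) (u : T -> R) t :
  continuous u t -> qcont (fun s => W (u s)) t.
Proof.
intros hu; apply qcont_slice; apply continuous_trig; try easy;
  [apply continuous_cos|apply continuous_sin].
Qed.

Lemma qcont_fx_path (t th : R) : good t ->
  qcont (fun q : R * R => fx (X (fst q) (snd q)) (Y (fst q) (snd q))) (t, th).
Proof.
intros h w; apply (continuous_comp_2 (fun q : R * R => X (fst q) (snd q))
  (fun q => Y (fst q) (snd q)) (fun x y => qdot w (fx x y))).
- apply continuous_path, continuous_cos.
- apply continuous_path, continuous_sin.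
- apply (good_disc t th), disc_inB, H in h; destruct h as [_ [_ [h _]]].
  exact (continuous_qcont _ _ h w).
Qed.

Lemma qcont_fx_circle (t th : R) : good t -> qcont (fun s => fx (X t s) (Y t s)) th.
Proof.
intros h w; apply (continuous_comp_2 (fun _ : R => t) (fun s => s)
  (fun a b => qdot w (fx (X a b) (Y a b)))).
- apply continuous_const.
- apply continuous_id.
- eapply continuous_ext; [|exact (qcont_fx_path t th h w)]; now intros [a b].
Qed.

Lemma is_derive_circle w t th : good t ->
  is_derive (fun s => qdot w (f (slice I (X t s) (Y t s)))) th
    (qdot w (RtoQ t * (I * W th) * fx (X t th) (Y t th))).
Proof.
intros h.
replace (RtoQ t * (I * W th))%Q with (slice I (t * (rho * - sin th)) (t * (rho * cos th))).
- apply (chain_rule w (fun s => X t s) (fun s => Y t s)); [| |now apply good_disc].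
  + unfold X; auto_derive; [easy|ring].
  + unfold Y; auto_derive; [easy|ring].
- unfold W, slice.
  transitivity ((t * (rho * sin th))%R * (I * I) + (t * (rho * cos th))%R * I)%Q;
    [rewrite hI|]; qring.
Qed.

Lemma qcont_f_circle (t th : R) : good t -> qcont (fun s => f (slice I (X t s) (Y t s))) th.
Proof.
intros h w; apply (ex_derive_continuous (V := R_NormedModule)).
eexists; now apply is_derive_circle.
Qed.

Section Kernel.
Variables (w : quat) (k : R -> quat).
Hypothesis (hk : forall th : R, qcont k th).

Let Phi (t th : R) : R := qdot w (k th * f (slice I (X t th) (Y t th))).
Let dPhi (t th : R) : R := qdot w (k th * ((W th - Z) * fx (X t th) (Y t th))).

Lemma is_derive_Phi t th : good t -> is_derive (fun s => Phi s th) t (dPhi t th).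
Proof.
intros h; unfold Phi, dPhi.
apply is_derive_ext with (fun s => qdot (qconj (k th) * w) (f (slice I (X s th) (Y s th)))).
{ intros s; qreal. }
replace (qdot w (k th * ((W th - Z) * fx (X t th) (Y t th)))) with (qdot (qconj (k th) * w)
  (slice I (rho * cos th - x0) (rho * sin th - y0) * fx (X t th) (Y t th)))
  by (unfold W, Z, slice; qreal).
apply (chain_rule _ (fun s => X s th) (fun s => Y s th)); [| |now apply good_disc].
- unfold X; auto_derive; [easy|ring].
- unfold Y; auto_derive; [easy|ring].
Qed.

Lemma continuous_dPhi t th : good t ->
  continuous (fun q : R * R => dPhi (fst q) (snd q)) (t, th).
Proof.
intros h; refine (qcont_mul (fun q : R * R => k (snd q)) (fun q => (W (snd q) - Z)
  * fx (X (fst q) (snd q)) (Y (fst q) (snd q)))%Q (t, th) _ _ w).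
- intros v; apply (continuous_comp snd (fun s => qdot v (k s)));
    [apply continuous_snd|apply hk].
- apply qcont_mul; [|now apply qcont_fx_path].
  apply qcont_add; [|apply qcont_const].
  apply (qcont_W _ snd); apply continuous_snd.
Qed.

Lemma is_derive_integral t : good t ->
  is_derive (fun s => RInt (Phi s) 0 (2 * PI)) t (RInt (dPhi t) 0 (2 * PI)).
Proof.
intros h.
rewrite <- (RInt_ext (fun th => Derive (fun s => Phi s th) t) (dPhi t)).
2: { intros th _; apply is_derive_unique, is_derive_Phi, h. }
apply (is_derive_RInt_param Phi).
- generalize (good_open t h); apply filter_imp; intros s hs th _.
  eexists; now apply is_derive_Phi.
- intros th _.
  apply continuity_2d_pt_ext_loc with dPhi.
  + apply locally_2d_locally.
    generalize (good_open t h); intros [d hd]; exists d; intros [s v] [hs hv]; simpl.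
    symmetry; apply is_derive_unique, is_derive_Phi, hd; exact hs.
  + apply continuity_2d_pt_filterlim, continuous_dPhi, h.
- generalize (good_open t h); apply filter_imp; intros s hs.
  apply ex_RInt_cont; intros th.
  apply (qcont_mul k (fun th => f (slice I (X s th) (Y s th)))); [apply hk|].
  now apply qcont_f_circle.
Qed.
End Kernel.

(** The rotating factor [e^(- I m theta)]. *)
Let E (m : nat) (th : R) : quat := slice I (cos (INR m * th)) (- sin (INR m * th)).
Let kappa : quat := (Z * RtoQ (/ rho))%Q.
(* The sum of the [(Z / W th) ^ m], a truncation of the Cauchy kernel [W / (W - Z)]. *)
Let K (n : nat) (th : R) : quat := qsum (fun m => qpow kappa m * E m th)%Q n.

Lemma qcont_E m (th : R) : qcont (E m) th.
Proof.
assert (c : continuous (fun s => INR m * s) th) by apply continuous_Rscal, continuous_id.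
apply (qcont_slice I (fun s => cos (INR m * s)) (fun s => - sin (INR m * s))).
- apply (continuous_comp _ cos); [easy|apply continuous_cos].
- apply (continuous_opp (V := R_NormedModule) (fun s => sin (INR m * s))).
  apply (continuous_comp _ sin); [easy|apply continuous_sin].
Qed.

Lemma qcont_KE m (th : R) : qcont (fun s => qpow kappa m * E m s)%Q th.
Proof. apply qcont_mul; [apply qcont_const|apply qcont_E]. Qed.

Lemma qcont_K n (th : R) : qcont (K n) th.
Proof. apply (qcont_sum (fun m s => qpow kappa m * E m s)%Q); intros m; apply qcont_KE. Qed.

Lemma E_0 th : E 0 th = RtoQ 1.
Proof. unfold E, slice; simpl; rewrite Rmult_0_l, cos_0, sin_0; qring. Qed.

Lemma E_W m th : (E (S m) th * W th)%Q = (RtoQ rho * E m th)%Q.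
Proof.
unfold E, W; rewrite slice_mul by easy.
replace (INR m * th) with (INR (S m) * th - th) by (rewrite S_INR; ring).
rewrite cos_minus, sin_minus; unfold slice; qring.
Qed.

Lemma E_Z m th : (E m th * Z)%Q = (Z * E m th)%Q.
Proof. unfold E, Z; rewrite !slice_mul by easy; f_equal; ring. Qed.

Lemma E_kappa m : qpow kappa (S m) = (qpow kappa m * Z * RtoQ (/ rho))%Q.
Proof. simpl; rewrite qpow_comm; unfold kappa at 2; now rewrite qmultA. Qed.

Lemma kernel_telescope n th :
  (K n th * (W th - Z))%Q = (W th - qpow kappa n * (E n th * W th))%Q.
Proof.
induction n as [|n IH].
- unfold K; simpl; rewrite E_0; qring.
- change (K (S n) th) with (K n th + qpow kappa n * E n th)%Q.
  rewrite qmultDl, IH, E_W, E_kappa.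
  replace (qpow kappa n * Z * RtoQ (/ rho) * (RtoQ rho * E n th))%Q
    with (RtoQ (/ rho * rho) * (qpow kappa n * (Z * E n th)))%Q by (rewrite RtoQM; qring).
  rewrite Rinv_l, qmult1l, <- E_Z by lra; qring.
Qed.

Lemma qmod_E m th : qmod (E m th) = 1.
Proof.
apply qmod_eq1; unfold E; rewrite slice_qn by easy.
replace (cos (INR m * th) * cos (INR m * th) + - sin (INR m * th) * - sin (INR m * th))
  with (Rsqr (sin (INR m * th)) + Rsqr (cos (INR m * th))) by (unfold Rsqr; ring).
apply sin2_cos2.
Qed.

(** By the Cauchy-Riemann equation the integrand is a derivative in the angle. *)
Lemma boundary_integral t : 0 < t <= 1 ->
  qInt (fun th => W th * fx (X t th) (Y t th))%Q 0 (2 * PI) = RtoQ 0.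
Proof.
intros ht; assert (hg := good_01 t ltac:(lra)).
assert (hc : forall th : R, qcont (fun s => W s * fx (X t s) (Y t s))%Q th).
{ intros th; apply qcont_mul; [|now apply qcont_fx_circle].
  apply (qcont_W _ (fun s => s)), continuous_id. }
apply qInt_unique; [easy|]; intros w.
set (F := fun th => qdot (RtoQ (/ t) * (I * w)) (f (slice I (X t th) (Y t th)))).
replace (qdot w (RtoQ 0)) with (F (2 * PI) - F 0).
- apply (RInt_of_derivative F (fun th => qdot w (W th * fx (X t th) (Y t th))));
    [|intros th; apply hc]; intros th.
  replace (qdot w (W th * fx (X t th) (Y t th))) with
    (qdot (RtoQ (/ t) * (I * w)) (RtoQ t * (I * W th) * fx (X t th) (Y t th)));
    [now apply is_derive_circle|].
  transitivity (/ t * t * qn I * qdot w (W th * fx (X t th) (Y t th))); [qreal|].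
  rewrite (proj2 (inS_imaginary I hI)); field; lra.
- unfold F, X, Y; rewrite cos_2PI, sin_2PI, cos_0, sin_0, Rminus_diag; qreal.
Qed.

Lemma integral_E m : qInt (E m) 0 (2 * PI) = RtoQ (if Nat.eqb m 0 then 2 * PI else 0).
Proof.
apply qInt_unique; [apply qcont_E|]; intros w.
destruct m as [|m]; simpl Nat.eqb; cbv iota.
- replace (qdot w (RtoQ (2 * PI))) with ((2 * PI - 0) * qdot w (RtoQ 1)) by qreal.
  apply is_RInt_ext with (fun _ => qdot w (RtoQ 1)); [intros t _; now rewrite E_0|].
  apply (is_RInt_const (V := R_NormedModule)).
- set (k := INR (S m)).
  assert (hk : 0 < k) by (unfold k; apply lt_0_INR; lia).
  assert (e : k * (2 * PI) = 0 + 2 * INR (S m) * PI) by (unfold k; ring).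
  set (F := fun th => qdot w (slice I (sin (k * th) / k) (cos (k * th) / k))).
  replace (qdot w (RtoQ 0)) with (F (2 * PI) - F 0).
  + apply (RInt_of_derivative F (fun th => qdot w (E (S m) th)));
      [|intros t; apply qcont_E]; intros t.
    unfold E; fold k.
    assert (es : forall x y, qdot w (slice I x y) = x * qdot w (RtoQ 1) + y * qdot w I)
      by (intros; unfold slice; qreal).
    rewrite es; eapply is_derive_ext; [intros u; symmetry; apply es|].
    auto_derive; [lra|field; lra].
  + unfold F; rewrite e, sin_period, cos_period, Rmult_0_r, Rminus_diag; qreal.
Qed.

Lemma integral_K n : (0 < n)%nat -> qInt (K n) 0 (2 * PI) = RtoQ (2 * PI).
Proof.
intros hn; unfold K; rewrite (qInt_sum (fun m th => qpow kappa m * E m th)%Q)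
  by (intros; apply qcont_KE).
destruct n as [|n]; [lia|]; rewrite qsum_head, qsum_0.
- rewrite qInt_mul_l, integral_E by (intros; apply qcont_E); simpl; qring.
- intros k hk; rewrite qInt_mul_l, integral_E by (intros; apply qcont_E); simpl; qring.
Qed.

(** The Taylor coefficients at the center, as integrals over the circle of
    radius [rho]. *)
Definition cauchy_coef (m : nat) : quat :=
  (RtoQ (/ (2 * PI) * (/ rho) ^ m) * qInt (fun th => E m th * f (W th)) 0 (2 * PI))%Q.

Lemma fx_bounded : exists c, forall t th, 0 <= t <= 1 -> 0 <= th <= 2 * PI ->
  qmod (fx (X t th) (Y t th)) <= c.
Proof.
enough (h : exists c, forall t th, 0 <= t <= 1 -> 0 <= th <= 2 * PI ->
  rsum (fun i => Rabs (qdot (qe i) (fx (X t th) (Y t th)))) 4 <= c).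
{ destruct h as [c h]; exists c; intros t th ht hth.
  eapply Rle_trans; [apply qmod_coords|now apply h]. }
generalize 4%nat; intros n; induction n as [|n [c IH]]; [exists 0; intros; simpl; lra|].
destruct (bounded_2d (fun t th => qdot (qe n) (fx (X t th) (Y t th))) 0 1 0 (2 * PI)) as [b hb].
{ intros t th ht _; apply continuity_2d_pt_filterlim.
  exact (qcont_fx_path t th (good_01 t ht) (qe n)). }
exists (c + b); intros t th ht hth; simpl; apply Rplus_le_compat; auto.
Qed.

Lemma qcont_fW (th : R) : qcont (fun s => f (W s)) th.
Proof.
intros w; eapply continuous_ext; [|exact (qcont_f_circle 1 th (good_01 1 ltac:(lra)) w)].
intros s; unfold W, X, Y; do 3 f_equal; ring.
Qed.

Lemma qmod_kappa : qmod kappa < 1.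
Proof.
unfold kappa; rewrite qmodM, qmodR, Rabs_pos_eq.
- apply Rmult_lt_reg_r with rho; [lra|]; pose proof qmod_Z.
  rewrite Rmult_assoc, Rinv_l; lra.
- left; apply Rinv_0_lt_compat; lra.
Qed.

(** The kernel sum, integrated along the segments from [Z] to the circle: by the
    telescoping identity the derivative in [t] of the integral involves the last
    power of [kappa] only. *)
Lemma cauchy_estimate : exists c, forall n, (0 < n)%nat ->
  qmod (qInt (fun th => K n th * f (W th))%Q 0 (2 * PI) - RtoQ (2 * PI) * f Z)
  <= c * qmod kappa ^ n.
Proof.
destruct fx_bounded as [c hc]; pose proof PI_RGT_0 as hpi.
exists (2 * PI * (rho * c)); intros n hn.
set (w := (qInt _ _ _ - _)%Q).
set (psi := fun s => RInt (fun th => qdot w (K n th * f (slice I (X s th) (Y s th)))) 0 (2 * PI)).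
set (dpsi := fun t => RInt (fun th =>
  qdot w (K n th * ((W th - Z) * fx (X t th) (Y t th)))) 0 (2 * PI)).
assert (h1 : psi 1 = qdot w (qInt (fun th => K n th * f (W th))%Q 0 (2 * PI))).
{ apply (is_RInt_unique (V := R_CompleteNormedModule)).
  apply is_RInt_ext with (fun th => qdot w (K n th * f (W th))).
  - intros th _; do 3 f_equal; unfold W, X, Y; f_equal; ring.
  - apply (RInt_qdot w (fun th => K n th * f (W th))%Q).
    intros th; apply qcont_mul; [apply qcont_K|apply qcont_fW]. }
assert (h0 : psi 0 = qdot w (RtoQ (2 * PI) * f Z)).
{ rewrite <- (integral_K n hn), <- qInt_mul_r by apply qcont_K.
  apply (is_RInt_unique (V := R_CompleteNormedModule)).
  apply is_RInt_ext with (fun th => qdot w (K n th * f Z)).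
  - intros th _; do 3 f_equal; unfold Z, X, Y; f_equal; ring.
  - apply (RInt_qdot w (fun th => K n th * f Z)%Q); intros th.
    apply qcont_mul; [apply qcont_K|apply qcont_const]. }
destruct (MVT_cor2 psi dpsi 0 1 Rlt_0_1) as [t [e ht]].
{ intros t ht; apply is_derive_Reals.
  apply (is_derive_integral w (K n) (qcont_K n)), good_01, ht. }
set (g := fun s => (qpow kappa n * (E n s * W s) * fx (X t s) (Y t s))%Q).
assert (hg := good_01 t ltac:(lra)).
assert (hW : forall th : R, qcont W th)
  by (intros th; apply (qcont_W _ (fun s => s)), continuous_id).
assert (cg : forall th : R, qcont g th).
{ intros th; apply qcont_mul; [|now apply qcont_fx_circle].
  apply qcont_mul; [apply qcont_const|apply qcont_mul; [apply qcont_E|apply hW]]. }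
assert (ei : ex_RInt (fun s => qdot w (g s)) 0 (2 * PI))
  by (apply ex_RInt_cont; intros th; apply cg).
assert (ed : dpsi t = - RInt (fun s => qdot w (g s)) 0 (2 * PI)).
{ apply (is_RInt_unique (V := R_CompleteNormedModule)).
  replace (- RInt _ 0 (2 * PI)) with (qdot w (qInt (fun th => W th * fx (X t th) (Y t th)) 0 (2 * PI))%Q
    - RInt (fun s => qdot w (g s)) 0 (2 * PI)) by (rewrite boundary_integral by lra; qreal).
  eapply is_RInt_ext; [|exact (is_RInt_minus (V := R_NormedModule) _ _ _ _ _ _
    (RInt_qdot w (fun th => W th * fx (X t th) (Y t th))%Q 0 (2 * PI)
      (fun th => qcont_mul _ _ th (hW th) (qcont_fx_circle t th hg)))
    (RInt_correct (V := R_CompleteNormedModule) _ _ _ ei))].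
  intros th _; unfold minus, plus, opp, g; simpl.
  rewrite (qmultA (K n th)), kernel_telescope; qreal. }
assert (hw : qmod w * qmod w <= 2 * PI * (rho * c) * qmod kappa ^ n * qmod w).
{ rewrite qmod_sqr; replace (qn w) with (dpsi t).
  2: { replace (dpsi t) with (psi 1 - psi 0) by lra; rewrite h1, h0, qdot_self.
       unfold w at 4; qreal. }
  rewrite ed; eapply Rle_trans; [apply Rle_abs|]; rewrite Rabs_Ropp.
  eapply Rle_trans; [apply (abs_RInt_le_const _ _ _ (qmod w * (qmod kappa ^ n * rho * c)));
    [lra|easy|]|right; ring].
  intros th hth; eapply Rle_trans; [apply Rabs_qdot|].
  apply Rmult_le_compat_l; [apply qmod_ge0|]; unfold g.
  rewrite !qmodM, qmod_pow, qmod_E, qmod_W, Rmult_1_l.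
  apply Rmult_le_compat_l; [|apply hc; lra].
  apply Rmult_le_pos; [apply pow_le, qmod_ge0|lra]. }
pose proof (qmod_ge0 w) as hw0; destruct (Req_dec (qmod w) 0) as [->|ne].
- assert (c0 : 0 <= c)
    by (eapply Rle_trans; [apply (qmod_ge0 (fx (X 0 0) (Y 0 0)))|apply hc; lra]).
  apply Rmult_le_pos; [|apply pow_le, qmod_ge0].
  apply Rmult_le_pos; [lra|apply Rmult_le_pos; lra].
- apply Rmult_le_reg_r with (qmod w); [lra|easy].
Qed.

Lemma cauchy_expansion : is_qser (term Z cauchy_coef) (f Z).
Proof.
pose proof PI_RGT_0 as hpi; destruct cauchy_estimate as [c hc].
assert (hS : forall n, qInt (fun th => K n th * f (W th))%Q 0 (2 * PI)
  = (RtoQ (2 * PI) * qsum (term Z cauchy_coef) n)%Q).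
{ intros n; rewrite <- qsum_mul_l.
  transitivity (qInt (fun th => qsum (fun m => qpow kappa m * (E m th * f (W th)))%Q n) 0 (2 * PI)).
  - f_equal; apply functional_extensionality; intros th; unfold K; rewrite <- qsum_mul_r.
    apply qsum_ext; intros m _; now rewrite qmultA.
  - assert (hEf : forall m (th : R), qcont (fun th => E m th * f (W th))%Q th)
      by (intros; apply qcont_mul; [apply qcont_E|apply qcont_fW]).
    rewrite (qInt_sum (fun m th => qpow kappa m * (E m th * f (W th)))%Q)
      by (intros; apply qcont_mul; [apply qcont_const|apply hEf]).
    apply qsum_ext; intros m _; rewrite qInt_mul_l by apply hEf.
    unfold cauchy_coef.
    assert (e : qpow kappa m = (qpow Z m * RtoQ ((/ rho) ^ m))%Q).
    { unfold kappa; induction m as [|m IH]; simpl; [qring|].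
      rewrite IH, RtoQM; qring. }
    rewrite e, (RtoQM (/ (2 * PI))).
    transitivity (RtoQ (2 * PI * / (2 * PI)) * (qpow Z m * RtoQ ((/ rho) ^ m)
      * qInt (fun th => E m th * f (W th)) 0 (2 * PI)))%Q; [|rewrite RtoQM; qring].
    rewrite Rinv_r, qmult1l by lra; easy. }
apply is_lim_seq_incr_1.
apply squeeze_0 with (fun n => c / (2 * PI) * qmod kappa ^ (S n)).
- intros n; split; [apply qmod_ge0|]; specialize (hc (S n) ltac:(lia)).
  rewrite hS in hc; set (s := qsum _ _) in *.
  replace (RtoQ (2 * PI) * s - RtoQ (2 * PI) * f Z)%Q with (RtoQ (2 * PI) * (s - f Z))%Q
    in hc by qring.
  rewrite qmodM, qmodR, Rabs_pos_eq in hc by lra.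
  apply Rmult_le_reg_l with (2 * PI); [lra|].
  eapply Rle_trans; [exact hc|right; field; lra].
- apply is_lim_seq_scal_0; apply (is_lim_seq_incr_1 (fun n => qmod kappa ^ n)).
  apply is_lim_seq_geom; rewrite Rabs_pos_eq by apply qmod_ge0; apply qmod_kappa.
Qed.

End Homotopy.
End Cauchy.

Lemma in_some_slice q : exists I x y, inS I /\ q = slice I x y.
Proof.
destruct q as [[[a b] c] d].
set (n := sqrt (b * b + c * c + d * d)).
assert (hn : n * n = b * b + c * c + d * d) by (apply sqrt_sqrt; nra).
destruct (Req_dec n 0) as [e|e].
- exists (0, 1, 0, 0), a, 0; split; [apply inS_i|].
  rewrite e in hn; unfold slice, qplus, qmult, RtoQ.
  repeat apply injective_projections; simpl; nra.
- exists (0, b / n, c / n, d / n), a, n; split.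
  + unfold inS, qmult, RtoQ; repeat apply injective_projections; simpl; try ring.
    replace (0 * 0 - b / n * (b / n) - c / n * (c / n) - d / n * (d / n))
      with (- ((b * b + c * c + d * d) / (n * n))) by (field; easy).
    rewrite hn; field; rewrite <- hn; nra.
  + unfold slice, qplus, qmult, RtoQ.
    repeat apply injective_projections; simpl; field; easy.
Qed.

(** A slice regular function has the same Taylor coefficients on all slices, as
    they are determined by its values on the real diameter. *)
Theorem slice_regular_expansion f : slice_regular f -> exists a, has_expansion f a.
Proof.
intros hf.
assert (h : forall I rho, inS I -> 0 < rho < 1 -> exists a, forall x y,
  x * x + y * y < rho * rho -> is_qser (term (slice I x y) a) (f (slice I x y))).
{ intros I rho hI hrho; destruct (hf I hI) as [fx [fy h]].
  exists (cauchy_coef I f rho); intros x y hxy.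
  now apply (cauchy_expansion I f fx fy hI h). }
destruct (h (0, 1, 0, 0) (/ 2) inS_i) as [a ha]; [lra|].
assert (hu : forall I rho b, inS I -> 0 < rho < 1 -> (forall x y,
  x * x + y * y < rho * rho -> is_qser (term (slice I x y) b) (f (slice I x y))) -> b = a).
{ intros I rho b hI hrho hb.
  assert (real : forall I' rho' c', (forall x y, x * x + y * y < rho' * rho' ->
    is_qser (term (slice I' x y) c') (f (slice I' x y))) ->
    forall x, x * x < rho' * rho' -> is_qser (term (RtoQ x) c') (f (RtoQ x))).
  { intros I' rho' c' hc x hx; specialize (hc x 0 ltac:(lra)).
    now replace (slice I' x 0) with (RtoQ x) in hc by (unfold slice; qring). }
  apply (qser_coef_unique (Rmin rho (/ 2)) (fun x => f (RtoQ x)));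
    [apply Rmin_pos; lra|intros x hx; apply (real I rho); auto
    |intros x hx; apply (real (0, 1, 0, 0) (/ 2)); auto];
    pose proof (Rmin_l rho (/ 2)); pose proof (Rmin_r rho (/ 2));
    apply Rabs_lt_between in hx; nra. }
exists a; apply has_expansion_qser; intros q hq.
destruct (in_some_slice q) as [I [x [y [hI ->]]]].
set (rho := (1 + qmod (slice I x y)) / 2).
pose proof (qmod_ge0 (slice I x y)); unfold inB in hq.
destruct (h I rho hI) as [b hb]; [unfold rho; lra|].
rewrite <- (hu I rho b); auto; [|unfold rho; lra].
apply hb; rewrite <- (slice_qn I) by easy; rewrite <- qmod_sqr; unfold rho; nra.
Qed.

(** * Functions bounded by one have contractive series *)

(** [|a + J b|^2] depends on [J] through its inner product with [2 a conj b] and is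
    maximal for [J] in the direction of the imaginary part of [a conj b]. *)
Lemma sup_over_slices a b : exists J, inS J /\
  qn (a + J * b) = qn a + qn b + sqrt (qn (qconj b * a - qconj (qconj b * a))).
Proof.
assert (e : forall J, qn (a + J * b) = qn a + qn J * qn b + 2 * qdot (a * qconj b) J) by qreal.
set (v := (a * qconj b - qconj (a * qconj b))%Q).
assert (ev : qn (qconj b * a - qconj (qconj b * a)) = qn v) by (unfold v; qreal).
rewrite ev, <- qmod_sqrt.
destruct (Req_dec (qmod v) 0) as [h|h].
- exists (0, 1, 0, 0); split; [apply inS_i|]; rewrite e, h.
  assert (hv := qmod0 _ h); unfold v in hv; clear - hv.
  revert hv; generalize (a * qconj b)%Q; intros [[[x y] z] t] hv.
  unfold qconj, qopp, qplus, RtoQ in hv; injection hv as _ h1 h2 h3.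
  unfold qn at 2, qdot; replace y with 0 by lra; simpl; ring.
- exists (RtoQ (/ qmod v) * v)%Q.
  assert (hh : qconj v = (- v)%Q) by (unfold v; qring).
  assert (h2 : (v * v)%Q = (- RtoQ (qn v))%Q).
  { rewrite <- qmult_conj, hh; qring. }
  assert (hS : inS (RtoQ (/ qmod v) * v)%Q).
  { unfold inS.
    replace (RtoQ (/ qmod v) * v * (RtoQ (/ qmod v) * v))%Q
      with (RtoQ (/ qmod v * / qmod v) * (v * v))%Q by qring.
    rewrite h2, <- qmod_sqr.
    replace (RtoQ (/ qmod v * / qmod v) * - RtoQ (qmod v * qmod v))%Q
      with (RtoQ (- (/ qmod v * / qmod v * (qmod v * qmod v)))) by qring.
    f_equal; field; easy. }
  split; [easy|]; rewrite e, (proj2 (inS_imaginary _ hS)), qdot_real_r.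
  assert (hd : 2 * qdot (a * qconj b) v = qn v) by (unfold v; qreal).
  replace (2 * (/ qmod v * qdot (a * qconj b) v)) with (/ qmod v * qn v) by (rewrite <- hd; ring).
  rewrite <- (qmod_sqr v); field; easy.
Qed.

(** The Hilbert-Schmidt norm of a product of stem values [(a + i b) (c + i d)],
    [i] being a central imaginary unit, is controlled by the operator norm of
    the left factor, and this is the largest modulus of [a + J b]. *)
Lemma stem_product_le k a b c d : (forall J, inS J -> qn (a + J * b) <= k) ->
  qn (a * c - b * d) + qn (a * d + b * c) <= k * (qn c + qn d).
Proof.
intros h; destruct (sup_over_slices a b) as [J [hJ e]].
specialize (h J hJ); rewrite e in h; clear e.
set (w := (qconj b * a)%Q) in *.
assert (e : qn (a * c - b * d) + qn (a * d + b * c)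
  = (qn a + qn b) * (qn c + qn d) + 2 * qdot c ((w - qconj w) * d)) by (unfold w; qreal).
rewrite e; clear e; rewrite <- qmod_sqrt in h.
pose proof (qdot_le c ((w - qconj w) * d)) as h1; rewrite qmodM in h1.
set (s := qmod (w - qconj w)) in *.
assert (h2 : 2 * (qmod c * qmod d) <= qn c + qn d).
{ rewrite <- (qmod_sqr c), <- (qmod_sqr d).
  pose proof (Rle_0_sqr (qmod c - qmod d)) as hs; unfold Rsqr in hs; lra. }
pose proof (qmod_ge0 (w - qconj w)); fold s in H.
pose proof (qn_ge0 c); pose proof (qn_ge0 d).
assert (2 * qdot c ((w - qconj w) * d) <= s * (qn c + qn d)) by nra.
nra.
Qed.

Section CircleSums.
Variable (rho : R).

(* The real and imaginary parts of the [m]-th power of [rho * e ^ (i th)]. *)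
Definition cosc (th : R) (m : nat) : R := rho ^ m * cos (INR m * th).
Definition sinc (th : R) (m : nat) : R := rho ^ m * sin (INR m * th).

Lemma cosc_add th m k : cosc th (m + k) = cosc th m * cosc th k - sinc th m * sinc th k.
Proof.
unfold cosc, sinc; rewrite plus_INR, Rmult_plus_distr_r, cos_plus, pow_add; ring.
Qed.

Lemma sinc_add th m k : sinc th (m + k) = cosc th m * sinc th k + sinc th m * cosc th k.
Proof.
unfold cosc, sinc; rewrite plus_INR, Rmult_plus_distr_r, sin_plus, pow_add; ring.
Qed.

Lemma qpow_slice J th m : inS J ->
  qpow (slice J (rho * cos th) (rho * sin th)) m = slice J (cosc th m) (sinc th m).
Proof.
intros hJ; induction m as [|m IH].
- unfold cosc, sinc; simpl; rewrite Rmult_0_l, cos_0, sin_0; unfold slice; qring.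
- simpl qpow; rewrite IH, slice_mul by easy.
  change (S m) with (1 + m)%nat; rewrite cosc_add, sinc_add.
  replace (cosc th 1) with (rho * cos th) by (unfold cosc; simpl; rewrite Rmult_1_l; ring).
  replace (sinc th 1) with (rho * sin th) by (unfold sinc; simpl; rewrite Rmult_1_l; ring).
  easy.
Qed.

(** The real and imaginary parts of a truncated stem function on the circle. *)
Definition stemA (p : fps) (n : nat) (th : R) : quat := qsum (fun m => RtoQ (cosc th m) * p m)%Q n.
Definition stemB (p : fps) (n : nat) (th : R) : quat := qsum (fun m => RtoQ (sinc th m) * p m)%Q n.

Lemma stem_eval J p n th : inS J ->
  qsum (term (slice J (rho * cos th) (rho * sin th)) p) n
  = (stemA p n th + J * stemB p n th)%Q.
Proof.
intros hJ; unfold stemA, stemB; rewrite <- qsum_mul_l, <- qsum_add.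
apply qsum_ext; intros m _; rewrite qpow_slice by easy; unfold slice; qring.
Qed.

Lemma qsum_extend u n k : (n <= k)%nat -> (forall m, (n <= m)%nat -> u m = RtoQ 0) ->
  qsum u k = qsum u n.
Proof.
induction 1 as [|k hk IH]; intros h; [easy|].
simpl; rewrite IH, h by auto; apply qplus0r.
Qed.

(** The product of power series is the product of stem functions in the algebra of
    quaternions tensored with the complex numbers. *)
Lemma stem_mul a g k n th :
  stemA (trunc k a * trunc n g) (k + n) th =
    (stemA (trunc k a) (k + n) th * stemA (trunc n g) (k + n) th
     - stemB (trunc k a) (k + n) th * stemB (trunc n g) (k + n) th)%Q
  /\ stemB (trunc k a * trunc n g) (k + n) th =
    (stemA (trunc k a) (k + n) th * stemB (trunc n g) (k + n) th
     + stemB (trunc k a) (k + n) th * stemA (trunc n g) (k + n) th)%Q.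
Proof.
set (F := trunc k a); set (G := trunc n g).
assert (gen : forall (u : nat -> R), qsum (fun m => RtoQ (u m) * (F * G)%fps m)%Q (k + n)
  = qsum (fun l => qsum (fun i => RtoQ (u (l + i)%nat) * F i)%Q (k + n) * G l)%Q (k + n)).
{ intros u.
  transitivity (qsum (fun m => qsum (fun l => RtoQ (u m) * (F (m - l)%nat * G l))%Q (S m)) (k + n)).
  { apply qsum_ext; intros m _; unfold fmul; now rewrite qsum_mul_l. }
  rewrite (qsum_triangle (fun m l => RtoQ (u m) * (F (m - l)%nat * G l))%Q).
  apply qsum_ext; intros l hl; rewrite <- qsum_mul_r.
  destruct (Nat.lt_ge_cases l n) as [hn|hn].
  - rewrite (qsum_extend _ k (k + n)), (qsum_extend _ k (k + n - l)); try lia.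
    + apply qsum_ext; intros i _; replace (l + i - l)%nat with i by lia; apply qmultA.
    + intros i hi; replace (l + i - l)%nat with i by lia.
      unfold F; rewrite trunc_ge by easy; qring.
    + intros i hi; unfold F; rewrite trunc_ge by easy; qring.
  - assert (e : G l = RtoQ 0) by (unfold G; now apply trunc_ge).
    rewrite !qsum_0; [easy| |]; intros i _; rewrite e; qring. }
unfold stemA, stemB; split; rewrite gen, <- !qsum_mul_l.
- transitivity (qsum (fun l => (qsum (fun i => RtoQ (cosc th i) * F i) (k + n) * (RtoQ (cosc th l) * G l)
    + - RtoQ 1 * (qsum (fun i => RtoQ (sinc th i) * F i) (k + n) * (RtoQ (sinc th l) * G l))))%Q (k + n)).
  + apply qsum_ext; intros l _.
    rewrite (qsum_ext _ (fun i => RtoQ (cosc th l) * (RtoQ (cosc th i) * F i)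
      + - RtoQ (sinc th l) * (RtoQ (sinc th i) * F i))%Q).
    * rewrite qsum_add, !qsum_mul_l; qring.
    * intros i _; rewrite cosc_add; qring.
  + rewrite qsum_add, (qsum_mul_l (- RtoQ 1)); qring.
- rewrite <- qsum_add; apply qsum_ext; intros l _.
  rewrite (qsum_ext _ (fun i => RtoQ (sinc th l) * (RtoQ (cosc th i) * F i)
      + RtoQ (cosc th l) * (RtoQ (sinc th i) * F i))%Q).
  + rewrite qsum_add, !qsum_mul_l; qring.
  + intros i _; rewrite sinc_add; qring.
Qed.

Lemma dirichlet phi n :
  2 * sin (phi / 2) * rsum (fun j => cos (INR j * phi)) n
  = sin (INR n * phi - phi / 2) + sin (phi / 2).
Proof.
induction n as [|n IH].
- simpl; rewrite Rmult_0_l, Rmult_0_r.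
  replace (0 - phi / 2) with (- (phi / 2)) by ring; rewrite sin_neg; ring.
- change (rsum ?u (S n)) with (rsum u n + u n); cbv beta.
  rewrite Rmult_plus_distr_l, IH, S_INR.
  replace ((INR n + 1) * phi - phi / 2) with (INR n * phi + phi / 2) by field.
  rewrite sin_minus, sin_plus; ring.
Qed.

Lemma roots_of_unity_sum M k : (0 < k < M)%nat ->
  rsum (fun j => cos (INR k * (2 * PI * INR j / INR M))) M = 0.
Proof.
intros hk; pose proof PI_RGT_0.
assert (h1 : 0 < INR k) by (apply lt_0_INR; lia).
assert (h2 : INR k < INR M) by (apply lt_INR; lia).
set (phi := 2 * PI * INR k / INR M).
assert (hs : 0 < sin (phi / 2)).
{ apply sin_gt_0.
  - unfold phi; replace (2 * PI * INR k / INR M / 2) with (PI * INR k / INR M) by (field; lra).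
    apply Rdiv_lt_0_compat; nra.
  - unfold phi; apply Rmult_lt_reg_r with (INR M); [lra|].
    replace (2 * PI * INR k / INR M / 2 * INR M) with (PI * INR k) by (field; lra); nra. }
assert (e := dirichlet phi M).
replace (INR M * phi - phi / 2) with (- (phi / 2) + 2 * INR k * PI) in e
  by (unfold phi; field; lra).
rewrite sin_period, sin_neg in e.
rewrite (rsum_ext _ (fun j => cos (INR j * phi))).
- nra.
- intros j _; f_equal; unfold phi; field; lra.
Qed.

Lemma rsum_swap (u : nat -> nat -> R) n k :
  rsum (fun i => rsum (fun j => u i j) k) n = rsum (fun j => rsum (fun i => u i j) n) k.
Proof.
induction n as [|n IH]; simpl.
- induction k as [|k IHk]; simpl; [easy|rewrite <- IHk; ring].
- rewrite IH, <- rsum_add; easy.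
Qed.

Lemma rsum_const c n : rsum (fun _ => c) n = INR n * c.
Proof. induction n as [|n IH]; [simpl; ring|]; rewrite S_INR; simpl rsum; rewrite IH; ring. Qed.

(** The characters [m < n] of the cyclic group of order [M] are orthogonal as [n <= M]. *)
Lemma parseval p M n : (n <= M)%nat -> (0 < M)%nat ->
  rsum (fun j => qn (stemA p n (2 * PI * INR j / INR M))
     + qn (stemB p n (2 * PI * INR j / INR M))) M
  = INR M * rsum (fun m => rho ^ m * rho ^ m * qn (p m)) n.
Proof.
intros hn hM; induction n as [|n IH].
- unfold stemA, stemB; simpl; rewrite Rmult_0_r.
  rewrite (rsum_ext _ (fun _ => 0)); [|intros; rewrite qnR; ring].
  rewrite rsum_const; ring.
- change (rsum ?u (S n)) with (rsum u n + u n); cbv beta.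
  rewrite Rmult_plus_distr_l, <- IH by lia.
  set (th := fun j => 2 * PI * INR j / INR M).
  assert (e : forall j, qn (stemA p (S n) (th j)) + qn (stemB p (S n) (th j))
    = (qn (stemA p n (th j)) + qn (stemB p n (th j)))
      + (2 * rsum (fun m => rho ^ n * rho ^ m * qdot (p m) (p n) * cos (INR (n - m) * th j)) n
        + rho ^ n * rho ^ n * qn (p n))).
  { intros j.
    change (stemA p (S n) (th j)) with (stemA p n (th j) + RtoQ (cosc (th j) n) * p n)%Q.
    change (stemB p (S n) (th j)) with (stemB p n (th j) + RtoQ (sinc (th j) n) * p n)%Q.
    rewrite !qnD, !qnM, !qnR, !qdot_real_r; unfold stemA at 2, stemB at 2.
    rewrite !(qdotC (qsum _ _)), !qdot_sum.
    replace (rsum (fun m => rho ^ n * rho ^ m * qdot (p m) (p n) * cos (INR (n - m) * th j)) n)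
      with (cosc (th j) n * rsum (fun m => qdot (p n) (RtoQ (cosc (th j) m) * p m)) n
        + sinc (th j) n * rsum (fun m => qdot (p n) (RtoQ (sinc (th j) m) * p m)) n).
    - assert (ec : cosc (th j) n * cosc (th j) n + sinc (th j) n * sinc (th j) n = rho ^ n * rho ^ n).
      { unfold cosc, sinc.
        replace (rho ^ n * cos (INR n * th j) * (rho ^ n * cos (INR n * th j)) +
          rho ^ n * sin (INR n * th j) * (rho ^ n * sin (INR n * th j)))
          with (rho ^ n * rho ^ n * (Rsqr (sin (INR n * th j)) + Rsqr (cos (INR n * th j))))
          by (unfold Rsqr; ring).
        rewrite sin2_cos2; ring. }
      rewrite <- ec; ring.
    - rewrite <- !rsum_scal, <- rsum_add; apply rsum_ext; intros m hm.
      rewrite !qdot_real_r, (qdotC (p m)).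
      replace (INR (n - m) * th j) with (INR n * th j - INR m * th j)
        by (rewrite minus_INR by lia; ring).
      rewrite cos_minus; unfold cosc, sinc; ring. }
  rewrite (rsum_ext _ (fun j => (qn (stemA p n (th j)) + qn (stemB p n (th j)))
      + (2 * rsum (fun m => rho ^ n * rho ^ m * qdot (p m) (p n) * cos (INR (n - m) * th j)) n
        + rho ^ n * rho ^ n * qn (p n)))) by (intros; apply e).
  rewrite rsum_add; f_equal; rewrite rsum_add, rsum_scal, rsum_swap.
  rewrite (rsum_ext _ (fun m => 0)).
  + rewrite !rsum_const; ring.
  + intros m hm; rewrite rsum_scal; unfold th.
    rewrite roots_of_unity_sum by lia; ring.
Qed.
End CircleSums.

Lemma rsum_mono u n k : (n <= k)%nat -> (forall m, 0 <= u m) -> rsum u n <= rsum u k.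
Proof. induction 1 as [|k _ IH]; simpl; intros h; [lra|]; specialize (IH h); specialize (h k); lra. Qed.

(** Averaging over roots of unity on the circle of radius [rho], with [f]
    replaced by a partial sum of its expansion. *)
Lemma bounded_circle f a rho g n : has_expansion f a ->
  (forall q, inB q -> qmod (f q) <= 1) -> 0 < rho < 1 ->
  rsum (fun m => rho ^ m * rho ^ m * qn ((a * g)%fps m)) n <= sumsq g n.
Proof.
intros hf hb hrho.
set (r := (1 + rho) / 2).
assert (hr : inB (RtoQ r)) by (apply inB_real; unfold r; lra).
destruct (is_qser_bounded _ _ (proj1 (is_series_qser _ _) (hf _ hr))) as [c hc].
assert (hc0 : 0 <= c) by (eapply Rle_trans; [apply qmod_ge0|apply (hc 0%nat)]).
set (x := rho / r).
assert (hx : 0 <= x < 1).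
{ split; [apply Rdiv_le_0_compat; unfold r; lra|].
  apply Rmult_lt_reg_r with r; [unfold r; lra|].
  unfold x, Rdiv; rewrite Rmult_assoc, Rinv_l; unfold r; lra. }
set (T := sumsq g n); assert (hT : 0 <= T) by apply sumsq_ge0.
set (d := fun k => c / (1 - x) * x ^ k).
assert (hd0 : is_lim_seq d 0).
{ apply is_lim_seq_scal_0, is_lim_seq_geom; rewrite Rabs_pos_eq; lra. }
assert (lim : is_lim_seq (fun k => (1 + d (k + S n)%nat) * (1 + d (k + S n)%nat) * T) T).
{ assert (l1 : is_lim_seq (fun k => 1 + d (k + S n)%nat) (1 + 0)).
  { apply is_lim_seq_plus'; [apply is_lim_seq_const|now apply is_lim_seq_incr_n]. }
  apply (is_lim_seq_mult' _ _ _ _ l1), (fun h => is_lim_seq_mult' _ _ _ T h (is_lim_seq_const T)) in l1.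
  now replace ((1 + 0) * (1 + 0) * T) with T in l1 by ring. }
refine (is_lim_seq_le (fun _ => _) _ _ T _ (is_lim_seq_const _) lim); intros k0; fold T.
set (k := (k0 + S n)%nat).
assert (hd : 0 <= d k).
{ apply Rmult_le_pos; [apply Rdiv_le_0_compat; lra|now apply pow_le]. }
set (F := trunc k a); set (G := trunc n g).
set (M := (k + n)%nat).
assert (hF : forall J th, inS J -> qn (stemA rho F M th + J * stemB rho F M th) <= (1 + d k) * (1 + d k)).
{ intros J th hJ; rewrite <- stem_eval by easy.
  set (q := slice J (rho * cos th) (rho * sin th)).
  assert (hq : qmod q = rho) by (apply qmod_circle; [easy|lra]).
  assert (hqB : inB q) by (unfold inB; lra).
  replace (qsum (term q F) M) with (qsum (term q a) k).
  - assert (h1 : qmod (qsum (term q a) k - f q) <= d k).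
    { unfold d; replace (c / (1 - x) * x ^ k) with (c * x ^ k / (1 - x)) by (field; lra).
      apply is_qser_tail; auto.
      - now apply is_series_qser, hf.
      - intros m; specialize (hc m); rewrite qmodM, qmod_pow in *; rewrite hq.
        rewrite qmodR, Rabs_pos_eq in hc by (unfold r; lra).
        replace (x ^ m) with (rho ^ m * (/ r) ^ m)
          by (unfold x, Rdiv; now rewrite Rpow_mult_distr).
        assert (hrm : 0 < r ^ m) by (apply pow_lt; unfold r; lra).
        rewrite pow_inv.
        apply Rmult_le_reg_r with (r ^ m); [easy|].
        replace (c * (rho ^ m * / r ^ m) * r ^ m) with (rho ^ m * c) by (field; lra).
        pose proof (pow_le rho m ltac:(lra)); nra. }
    pose proof (hb q hqB) as h2.
    pose proof (qmod_triangle (qsum (term q a) k - f q) (f q)) as h3.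
    replace (qsum (term q a) k - f q + f q)%Q with (qsum (term q a) k) in h3 by qring.
    rewrite <- qmod_sqr; pose proof (qmod_ge0 (qsum (term q a) k)); nra.
  - symmetry; rewrite (qsum_extend _ k).
    + apply qsum_ext; intros m hm; unfold F; now rewrite trunc_lt.
    + unfold M; lia.
    + intros m hm; unfold F; rewrite trunc_ge by easy; apply qmult0r. }
assert (hM : (0 < M)%nat) by (unfold M, k; lia).
assert (hMR : 0 < INR M) by now apply lt_0_INR.
assert (main : rsum (fun m => rho ^ m * rho ^ m * qn ((F * G)%fps m)) M
  <= (1 + d k) * (1 + d k) * rsum (fun m => rho ^ m * rho ^ m * qn (G m)) M).
{ apply Rmult_le_reg_l with (INR M); [easy|].
  replace (INR M * ((1 + d k) * (1 + d k) * rsum (fun m => rho ^ m * rho ^ m * qn (G m)) M))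
    with ((1 + d k) * (1 + d k) * (INR M * rsum (fun m => rho ^ m * rho ^ m * qn (G m)) M)) by ring.
  rewrite <- !parseval by easy.
  rewrite <- rsum_scal; apply rsum_le; intros j _.
  destruct (stem_mul rho a g k n (2 * PI * INR j / INR M)) as [e1 e2].
  fold F G M in e1, e2; rewrite e1, e2; apply stem_product_le; auto. }
assert (l1 : rsum (fun m => rho ^ m * rho ^ m * qn ((a * g)%fps m)) n
  <= rsum (fun m => rho ^ m * rho ^ m * qn ((F * G)%fps m)) M).
{ apply Rle_trans with (rsum (fun m => rho ^ m * rho ^ m * qn ((F * G)%fps m)) n).
  - apply rsum_le; intros m hm; right; do 2 f_equal; apply qsum_ext; intros l hl.
    unfold F, G; rewrite !trunc_lt by (unfold k; lia); easy.
  - apply rsum_mono; [unfold M; lia|]; intros m.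
    apply Rmult_le_pos; [apply Rmult_le_pos; apply pow_le; lra|apply qn_ge0]. }
assert (l2 : rsum (fun m => rho ^ m * rho ^ m * qn (G m)) M <= T).
{ unfold T; rewrite <- (sumsq_trunc n M) by (unfold M; lia).
  apply rsum_le; intros m _; fold G; pose proof (qn_ge0 (G m)).
  assert (0 <= rho ^ m <= 1) by (split; [apply pow_le|rewrite <- (pow1 m); apply pow_incr]; lra).
  assert (rho ^ m * rho ^ m <= 1) by nra; nra. }
assert (l3 : (1 + d k) * (1 + d k) * rsum (fun m => rho ^ m * rho ^ m * qn (G m)) M
  <= (1 + d k) * (1 + d k) * T) by (apply Rmult_le_compat_l; nra).
lra.
Qed.

(** The limit [rho = 1] of [bounded_circle]. *)
Theorem bounded_contractive f a : has_expansion f a ->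
  (forall q, inB q -> qmod (f q) <= 1) -> contractive a.
Proof.
intros hf hb g n; apply Rnot_lt_le; intros hlt.
set (phi := fun rho => rsum (fun m => rho ^ m * rho ^ m * qn ((a * g)%fps m)) n).
assert (h1 : phi 1 = sumsq (a * g) n).
{ apply rsum_ext; intros m _; rewrite pow1; ring. }
assert (cont : continuous phi 1).
{ apply (continuous_rsum (fun m rho => rho ^ m * rho ^ m * qn ((a * g)%fps m))); intros m.
  apply (ex_derive_continuous (V := R_NormedModule)); auto_derive; easy. }
rewrite <- h1 in hlt; destruct (cont (fun v => sumsq g n < v)) as [d hd].
{ now apply (open_gt (sumsq g n)). }
set (rho := Rmax (/ 2) (1 - d / 2)); pose proof (cond_pos d) as hd0.
assert (hrho : / 2 <= rho < 1 /\ 1 - d / 2 <= rho).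
{ split; [split; [apply Rmax_l|apply Rmax_lub_lt; lra]|apply Rmax_r]. }
assert (hb' : ball 1 d rho).
{ apply (Rabs_lt_between' rho 1 d); lra. }
pose proof (bounded_circle f a rho g n hf hb ltac:(lra)) as h2.
specialize (hd rho hb'); unfold phi in hd; lra.
Qed.

(** * Power series with bounded coefficients are slice regular *)

Lemma linear_geom_bound t m : 0 <= t < 1 -> INR m * t ^ m <= / (1 - t).
Proof.
intros ht.
assert (h : INR m * t ^ m <= rsum (fun k => t ^ k) m).
{ assert (h : forall k, (k <= m)%nat -> INR k * t ^ m <= rsum (fun k => t ^ k) k).
  { induction k as [|k IH]; intros hk; [simpl; lra|].
    rewrite S_INR; change (rsum (fun k => t ^ k) (S k)) with (rsum (fun k => t ^ k) k + t ^ k).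
    assert (t ^ m <= t ^ k).
    { replace m with (k + (m - k))%nat by lia; rewrite pow_add.
      pose proof (pow_le t k (proj1 ht)).
      assert (t ^ (m - k) <= 1) by (rewrite <- (pow1 (m - k)); apply pow_incr; lra); nra. }
    specialize (IH ltac:(lia)); lra. }
  now apply h. }
eapply Rle_trans; [exact h|now apply rsum_geom_le].
Qed.

Lemma square_geom_bound x : 0 < x < 1 ->
  exists c t, 0 <= c /\ 0 <= t < 1 /\ forall m, INR m * INR m * x ^ m <= c * t ^ m.
Proof.
intros hx; set (t := 1 - (1 - x) / 3).
assert (ht : 0 <= t < 1) by (unfold t; lra).
assert (h3 : x <= t * t * t).
{ replace (t * t * t) with (x + (1 - x) * (1 - x) * (/ 3 - (1 - x) * / 27))
    by (unfold t; field).
  assert (0 <= (1 - x) * (1 - x) * (/ 3 - (1 - x) * / 27)) by (apply Rmult_le_pos; nra).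
  lra. }
assert (hi : 0 < / (1 - t)) by (apply Rinv_0_lt_compat; lra).
exists (/ (1 - t) * / (1 - t)), t; split; [apply Rmult_le_pos; lra|split; [easy|]]; intros m.
pose proof (linear_geom_bound t m ht) as h.
pose proof (pow_le t m (proj1 ht)) as hp; pose proof (pos_INR m).
apply Rle_trans with (INR m * INR m * (t * t * t) ^ m).
- apply Rmult_le_compat_l; [now apply Rmult_le_pos|apply pow_incr; lra].
- rewrite !Rpow_mult_distr.
  replace (INR m * INR m * (t ^ m * t ^ m * t ^ m))
    with ((INR m * t ^ m) * (INR m * t ^ m) * t ^ m) by ring.
  apply Rmult_le_compat_r; [easy|]; apply Rmult_le_compat; try easy; now apply Rmult_le_pos.
Qed.

(** The derivative of the [m]-th power. *)
Definition dpow (q : quat) (m : nat) : quat :=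
  match m with O => RtoQ 0 | S k => (RtoQ (INR (S k)) * qpow q k)%Q end.

Lemma dpow_S q m : dpow q (S m) = (q * dpow q m + qpow q m)%Q.
Proof.
destruct m as [|m]; simpl; [qring|].
change (match m with O => 1 | S _ => INR m + 1 end) with (INR (S m)).
rewrite RtoQD; generalize (qpow q m) (INR (S m)); intros; qring.
Qed.

Section PowerBounds.
Variables (q h : quat) (r : R).
Hypotheses (comm : (q * h = h * q)%Q) (hr : 0 < r < 1).
Hypotheses (hq : qmod q <= r) (hqh : qmod (q + h) <= r).

Lemma qpow_bound (p : quat) m : qmod p <= r -> qmod (qpow p m) <= r ^ m.
Proof. intros hp; rewrite qmod_pow; apply pow_incr; split; [apply qmod_ge0|easy]. Qed.

Lemma dpow_bound (p : quat) m : qmod p <= r -> qmod (dpow p m) * r <= INR m * r ^ m.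
Proof.
intros hp; destruct m as [|m]; [unfold dpow; rewrite qmodR, Rabs_R0; simpl; lra|].
unfold dpow; rewrite qmodM, qmodR, Rabs_pos_eq by apply pos_INR.
pose proof (qpow_bound p m hp); pose proof (pos_INR (S m)); simpl pow.
replace (INR (S m) * (r * r ^ m)) with (INR (S m) * r ^ m * r) by ring.
apply Rmult_le_compat_r; [lra|]; now apply Rmult_le_compat_l.
Qed.

Lemma qpow_increment m : qmod (qpow (q + h) m - qpow q m) * r <= INR m * r ^ m * qmod h.
Proof.
induction m as [|m IH].
- simpl; replace (RtoQ 1 - RtoQ 1)%Q with (RtoQ 0) by qring; rewrite qmodR, Rabs_R0; lra.
- replace (qpow (q + h) (S m) - qpow q (S m))%Q with
    (q * (qpow (q + h) m - qpow q m) + h * qpow (q + h) m)%Q by (simpl; qring).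
  pose proof (qmod_triangle (q * (qpow (q + h) m - qpow q m)) (h * qpow (q + h) m)) as e.
  rewrite !qmodM in e; rewrite S_INR; simpl pow.
  pose proof (qpow_bound (q + h) m hqh); pose proof (qmod_ge0 h).
  pose proof (qmod_ge0 (qpow (q + h) m - qpow q m)); pose proof (qmod_ge0 q).
  set (A := qmod (qpow (q + h) m - qpow q m)) in *.
  assert (s1 : qmod q * (A * r) <= r * (INR m * r ^ m * qmod h)).
  { apply Rmult_le_compat; try easy; apply Rmult_le_pos; lra. }
  assert (s2 : qmod h * qmod (qpow (q + h) m) * r <= qmod h * r ^ m * r).
  { apply Rmult_le_compat_r; [lra|]; now apply Rmult_le_compat_l. }
  match goal with |- qmod ?x * _ <= _ =>
    assert (qmod x * r <= (qmod q * A + qmod h * qmod (qpow (q + h) m)) * r) end.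
  { apply Rmult_le_compat_r; lra. }
  lra.
Qed.

(** The increment [h] commutes with [q], as it does inside a slice, so the remainder
    of the binomial formula can be estimated as for real numbers. *)
Lemma qpow_taylor m : qmod (qpow (q + h) m - qpow q m - h * dpow q m) * (r * r)
  <= INR m * INR m * r ^ m * (qmod h * qmod h).
Proof.
induction m as [|m IH].
- simpl; replace (RtoQ 1 - RtoQ 1 - h * RtoQ 0)%Q with (RtoQ 0) by qring.
  rewrite qmodR, Rabs_R0; lra.
- rewrite dpow_S; simpl qpow.
  replace ((q + h) * qpow (q + h) m - q * qpow q m - h * (q * dpow q m + qpow q m))%Q with
    (q * (qpow (q + h) m - qpow q m - h * dpow q m) + h * (qpow (q + h) m - qpow q m))%Q.
  2: { rewrite (qmultDr (q * dpow q m)), (qmultA h q), <- comm; qring. }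
  match goal with |- qmod (?a + ?b) * _ <= _ => pose proof (qmod_triangle a b) as e end.
  rewrite !qmodM in e; rewrite S_INR; simpl pow.
  pose proof (qpow_increment m) as e1; pose proof (qmod_ge0 h) as h0.
  set (A := qmod (qpow (q + h) m - qpow q m)) in *.
  set (B := qmod (qpow (q + h) m - qpow q m - h * dpow q m)) in *.
  assert (hA : 0 <= A) by apply qmod_ge0; assert (hB : 0 <= B) by apply qmod_ge0.
  pose proof (qmod_ge0 q); pose proof (pos_INR m).
  pose proof (pow_le r m ltac:(lra)) as hp.
  assert (s1 : qmod q * B * (r * r) <= r * (INR m * INR m * r ^ m * (qmod h * qmod h))).
  { rewrite Rmult_assoc; apply Rmult_le_compat; try easy; apply Rmult_le_pos; nra. }
  assert (s2 : qmod h * A * (r * r) <= r * (INR m * r ^ m * (qmod h * qmod h))).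
  { replace (qmod h * A * (r * r)) with (r * qmod h * (A * r)) by ring.
    replace (r * (INR m * r ^ m * (qmod h * qmod h)))
      with (r * qmod h * (INR m * r ^ m * qmod h)) by ring.
    apply Rmult_le_compat_l; [nra|easy]. }
  assert (s3 : 0 <= r * ((INR m + 1) * r ^ m * (qmod h * qmod h))).
  { repeat apply Rmult_le_pos; lra. }
  match goal with |- qmod ?x * _ <= _ => assert (qmod x * (r * r) <= (qmod q * B + qmod h * A) * (r * r)) end.
  { apply Rmult_le_compat_r; nra. }
  nra.
Qed.

Lemma dpow_increment m :
  qmod (dpow (q + h) m - dpow q m) * (r * r) <= INR m * INR m * r ^ m * qmod h.
Proof.
destruct m as [|m].
- simpl; replace (RtoQ 0 - RtoQ 0)%Q with (RtoQ 0) by qring; rewrite qmodR, Rabs_R0; lra.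
- unfold dpow.
  replace (RtoQ (INR (S m)) * qpow (q + h) m - RtoQ (INR (S m)) * qpow q m)%Q
    with (RtoQ (INR (S m)) * (qpow (q + h) m - qpow q m))%Q by qring.
  rewrite qmodM, qmodR, Rabs_pos_eq by apply pos_INR.
  pose proof (qpow_increment m) as e; pose proof (pos_INR m); pose proof (qmod_ge0 h).
  pose proof (pow_le r m ltac:(lra)).
  replace (INR (S m) * qmod (qpow (q + h) m - qpow q m) * (r * r))
    with (INR (S m) * r * (qmod (qpow (q + h) m - qpow q m) * r)) by ring.
  apply Rle_trans with (INR (S m) * r * (INR m * r ^ m * qmod h)).
  + apply Rmult_le_compat_l; [rewrite S_INR; nra|easy].
  + rewrite S_INR; simpl pow.
    assert (0 <= (INR m + 1) * r * (r ^ m * qmod h)) by (repeat apply Rmult_le_pos; lra).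
    nra.
Qed.
End PowerBounds.

Section Differentiation.
Variables (a : nat -> quat).
Hypothesis ha : forall m, qmod (a m) <= 1.

Let f := qPSeries a.
Definition dPSeries (q : quat) : quat := qSeries (fun m => dpow q m * a m)%Q.

Lemma f_qser q : inB q -> is_qser (term q a) (f q).
Proof. intros hq; now apply (bounded_qser a 1). Qed.

Lemma d_qser q : inB q -> is_qser (fun m => dpow q m * a m)%Q (dPSeries q).
Proof.
intros hq; unfold inB in hq; pose proof (qmod_ge0 q).
set (r := (1 + qmod q) / 2); assert (hr : 0 < r < 1) by (unfold r; lra).
destruct (square_geom_bound r hr) as [c [t [hc [ht h]]]].
destruct (qser_geom (fun m => dpow q m * a m)%Q (c / r) t) as [v [hv _]].
- apply Rdiv_le_0_compat; lra.
- easy.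
- intros m; rewrite qmodM; specialize (h m).
  pose proof (dpow_bound r hr q m ltac:(unfold r; lra)) as hd.
  apply Rmult_le_reg_r with r; [lra|].
  replace (c / r * t ^ m * r) with (c * t ^ m) by (field; lra).
  pose proof (pow_le r m ltac:(lra)).
  assert (INR m <= INR m * INR m).
  { destruct m; [simpl; lra|]; rewrite S_INR; pose proof (pos_INR m); nra. }
  pose proof (qmod_ge0 (dpow q m)); pose proof (qmod_ge0 (a m)); specialize (ha m).
  assert (qmod (dpow q m) * qmod (a m) <= qmod (dpow q m)) by nra.
  nra.
- unfold dPSeries; now rewrite (qSeries_unique _ v).
Qed.

Lemma termwise_le r c t u v y : 0 < r -> 0 <= c -> 0 <= t < 1 -> 0 <= y ->
  (forall m, INR m * INR m * r ^ m <= c * t ^ m) ->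
  (forall m, qmod (u m) * (r * r) <= INR m * INR m * r ^ m * y) ->
  is_qser (fun m => u m * a m)%Q v -> qmod v <= c / (r * r) / (1 - t) * y.
Proof.
intros hr hc ht hy h hu hv; assert (hr2 : 0 < r * r) by nra.
replace (c / (r * r) / (1 - t) * y) with (c / (r * r) * y / (1 - t)) by (field; lra).
apply (is_qser_geom_le _ _ _ _ (Rmult_le_pos _ _ (Rdiv_le_0_compat _ _ hc hr2) hy) ht hv).
intros m; rewrite qmodM; specialize (h m); specialize (hu m); specialize (ha m).
apply (Rmult_le_compat_r y) in h; [|easy].
apply Rmult_le_reg_r with (r * r); [easy|].
replace (c / (r * r) * y * t ^ m * (r * r)) with (c * t ^ m * y) by (field; lra).
pose proof (qmod_ge0 (u m)); pose proof (qmod_ge0 (a m)).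
assert (qmod (u m) * qmod (a m) <= qmod (u m)) by nra.
assert (qmod (u m) * qmod (a m) * (r * r) <= qmod (u m) * (r * r)) by nra.
lra.
Qed.

(** The estimates for powers are summed on the ball of a radius [r] between [qmod q]
    and one, where the weights [m ^ 2 * r ^ m] decrease geometrically. *)
Lemma uniform_estimates q : inB q -> exists c d, 0 <= c /\ 0 < d /\
  forall h, (q * h = h * q)%Q -> qmod h < d ->
    qmod (f (q + h) - f q - h * dPSeries q) <= c * (qmod h * qmod h) /\
    qmod (dPSeries (q + h) - dPSeries q) <= c * qmod h.
Proof.
intros hq; pose proof hq as hq'; unfold inB in hq'; pose proof (qmod_ge0 q).
set (r := (1 + qmod q) / 2); assert (hr : 0 < r < 1) by (unfold r; lra).
destruct (square_geom_bound r hr) as [c [t [hc [ht h]]]].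
exists (c / (r * r) / (1 - t)), (r - qmod q); split; [|split; [unfold r; lra|]].
{ apply Rdiv_le_0_compat; [|lra]; apply Rdiv_le_0_compat; nra. }
intros k comm hk.
pose proof (qmod_triangle q k) as htr; pose proof (qmod_ge0 k) as hk0.
assert (hqk : qmod (q + k) <= r) by lra.
assert (hqr : qmod q <= r) by (unfold r; lra).
assert (hB : inB (q + k)) by (unfold inB; lra).
split; (eapply termwise_le; [apply hr|easy|easy| |exact h| |]).
- nra.
- apply (qpow_taylor q k r comm hr hqr hqk).
- apply (is_qser_ext (fun m => (qpow (q + k) m * a m + RtoQ (-1) * (qpow q m * a m))
    + (- k) * (dpow q m * a m))%Q); [intros m; qring|].
  replace (f (q + k) - f q - k * dPSeries q)%Q with
    (f (q + k) + RtoQ (-1) * f q + (- k) * dPSeries q)%Q by qring.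
  repeat apply is_qser_add; repeat apply is_qser_mul_l; now (apply f_qser || apply d_qser).
- easy.
- apply (dpow_increment q k r hr hqr hqk).
- apply (is_qser_ext (fun m => (dpow (q + k) m * a m + RtoQ (-1) * (dpow q m * a m)))%Q);
    [intros m; qring|].
  replace (dPSeries (q + k) - dPSeries q)%Q with
    (dPSeries (q + k) + RtoQ (-1) * dPSeries q)%Q by qring.
  apply is_qser_add; [|apply is_qser_mul_l]; now apply d_qser.
Qed.

Lemma is_derive_of_estimate (g : R -> quat) x l c d : 0 <= c -> 0 < d ->
  (forall t, Rabs (t - x) < d ->
     qmod (g t - g x - RtoQ (t - x) * l) <= c * (Rabs (t - x) * Rabs (t - x))) ->
  is_derive g x l.
Proof.
intros hc hd h; split; [apply is_linear_scal_l|].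
intros y hy; apply (is_filter_lim_locally_unique x y) in hy; subst y.
intros [eps heps].
assert (hp : 0 < Rmin d (eps / (c + 1))).
{ apply Rmin_pos; [easy|apply Rdiv_lt_0_compat; lra]. }
exists (mkposreal _ hp); intros t ht; simpl.
assert (ht' : Rabs (t - x) < Rmin d (eps / (c + 1))) by exact ht.
pose proof (Rmin_l d (eps / (c + 1))); pose proof (Rmin_r d (eps / (c + 1))) as h2.
change (norm (minus (minus (g t) (g x)) (scal (t - x) l) : quat) <= eps * Rabs (t - x)).
rewrite norm_qmod, !minus_quat, scal_quat.
eapply Rle_trans; [apply h; lra|].
rewrite <- Rmult_assoc; apply Rmult_le_compat_r; [apply Rabs_pos|].
assert (h3 : Rabs (t - x) < eps / (c + 1)) by lra.
apply (Rmult_lt_compat_r (c + 1)) in h3; [|lra].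
replace (eps / (c + 1) * (c + 1)) with eps in h3 by (field; lra).
pose proof (Rabs_pos (t - x)); nra.
Qed.

Lemma continuous_of_estimate (g : R -> R -> quat) x y c d : 0 <= c -> 0 < d ->
  (forall u v, Rabs (u - x) < d -> Rabs (v - y) < d ->
     qmod (g u v - g x y) <= c * (Rabs (u - x) + Rabs (v - y))) ->
  continuous (fun z : R * R => g (fst z) (snd z)) (x, y).
Proof.
intros hc hd h.
apply (proj2 (filterlim_locally_ball_norm (K := R_AbsRing) (F := locally (x, y))
  (fun z : R * R => g (fst z) (snd z)) (g x y))).
intros [eps heps].
assert (hp : 0 < Rmin d (eps / (2 * (c + 1)))).
{ apply Rmin_pos; [easy|apply Rdiv_lt_0_compat; lra]. }
exists (mkposreal _ hp); intros [u v] [hu hv]; simpl in hu, hv |- *.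
assert (hu' : Rabs (u - x) < Rmin d (eps / (2 * (c + 1)))) by exact hu.
assert (hv' : Rabs (v - y) < Rmin d (eps / (2 * (c + 1)))) by exact hv.
pose proof (Rmin_l d (eps / (2 * (c + 1)))); pose proof (Rmin_r d (eps / (2 * (c + 1)))) as h2.
unfold ball_norm; simpl.
change (norm (minus (g u v) (g x y) : quat) < eps); rewrite norm_qmod, minus_quat.
eapply Rle_lt_trans; [apply h; lra|].
assert (h3 : Rabs (u - x) + Rabs (v - y) < eps / (c + 1)).
{ replace (eps / (c + 1)) with (eps / (2 * (c + 1)) + eps / (2 * (c + 1))) by (field; lra); lra. }
apply (Rmult_lt_compat_r (c + 1)) in h3; [|lra].
replace (eps / (c + 1) * (c + 1)) with eps in h3 by (field; lra).
pose proof (Rabs_pos (u - x)); pose proof (Rabs_pos (v - y)); nra.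
Qed.

(** Within a slice [dPSeries] is a complex derivative: [f] has increment
    [h * dPSeries q] to first order both for real [h] and for [h] in [R I]. *)
Theorem power_series_slice_regular : slice_regular (qPSeries a).
Proof.
intros I hI; fold f.
exists (fun x y => dPSeries (slice I x y)), (fun x y => (I * dPSeries (slice I x y))%Q).
intros x y hq; destruct (inS_imaginary I hI) as [_ hI1].
assert (hIm : qmod I = 1) by now apply qmod_eq1.
destruct (uniform_estimates (slice I x y) hq) as [c [d [hc [hd h]]]].
assert (sl : forall u v, (slice I x y * slice I u v = slice I u v * slice I x y)%Q).
{ intros u v; rewrite !slice_mul by easy; f_equal; ring. }
assert (shift : forall u v, slice I u v = (slice I x y + slice I (u - x) (v - y))%Q)
  by (intros; unfold slice; qring).
assert (cont : forall (k : quat), qmod k = 1 ->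
  continuous (fun z : R * R => (k * dPSeries (slice I (fst z) (snd z)))%Q) (x, y)).
{ intros k hk; apply (continuous_of_estimate (fun u v => k * dPSeries (slice I u v))%Q x y c (d / 2));
    [easy|lra|].
  intros u v hu hv.
  assert (hs : qmod (slice I (u - x) (v - y)) <= Rabs (u - x) + Rabs (v - y)).
  { unfold slice; eapply Rle_trans; [apply qmod_triangle|].
    rewrite qmodM, !qmodR, hIm; lra. }
  replace (k * dPSeries (slice I u v) - k * dPSeries (slice I x y))%Q
    with (k * (dPSeries (slice I u v) - dPSeries (slice I x y)))%Q by qring.
  rewrite qmodM, hk, Rmult_1_l, (shift u v).
  destruct (h (slice I (u - x) (v - y)) (sl _ _) ltac:(lra)) as [_ e].
  eapply Rle_trans; [exact e|]; now apply Rmult_le_compat_l. }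
split; [|split; [|split; [|split]]].
- apply (is_derive_of_estimate (fun t => f (slice I t y)) x _ c d hc hd); intros t ht.
  rewrite (shift t y), Rminus_diag.
  replace (slice I (t - x) 0) with (RtoQ (t - x)) by (unfold slice; qring).
  rewrite <- (qmodR (t - x)); apply h; [|now rewrite qmodR].
  symmetry; apply qrealC.
- apply (is_derive_of_estimate (fun t => f (slice I x t)) y _ c d hc hd); intros t ht.
  rewrite (shift x t), Rminus_diag.
  replace (slice I 0 (t - y)) with (RtoQ (t - y) * I)%Q by (unfold slice; qring).
  assert (hm : qmod (RtoQ (t - y) * I) = Rabs (t - y)) by (rewrite qmodM, qmodR, hIm; ring).
  rewrite qmultA, <- hm; apply h; [|now rewrite hm].
  replace (RtoQ (t - y) * I)%Q with (slice I 0 (t - y)) by (unfold slice; qring); apply sl.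
- generalize (cont (RtoQ 1) ltac:(rewrite qmodR; apply Rabs_R1)).
  apply continuous_ext; intros z; apply qmult1l.
- now apply cont.
- rewrite qmultA, hI; qring.
Qed.
End Differentiation.

Lemma slice_regular_contractive a : contractive a -> slice_regular (qPSeries a).
Proof. intros h; apply power_series_slice_regular; intros m; apply qmod_le1, contractive_coef, h. Qed.

(** * Zeros of quaternionic polynomials *)

(** The fundamental theorem of algebra, for the polynomial that is the sum of the
    squares of four real polynomials; its leading coefficient is a sum of squares of
    real numbers, so nonzero. *)
Module ComplexRoot.
Import all_boot all_order all_algebra complex Rstruct.
Import Order.TTheory GRing.Theory Num.Theory.
Local Open Scope ring_scope.
Local Open Scope complex_scope.

Lemma sum_of_squares_root (c : nat -> nat -> R) (d : nat) : (0 < d)%N ->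
  rsum (fun i => Rmult (c i d) (c i d)) 4 != 0 ->
  exists (z : R[i]), \sum_(i < 4) (\sum_(k < d.+1) (c i k)%:C * z ^+ k) ^+ 2 = 0.
Proof.
move=> d0; rewrite /= Rplus_0_l => hc.
pose P i := \poly_(k < d.+1) (c i k)%:C.
pose p := \sum_(i < 4) P i ^+ 2.
have sq i : (P i ^+ 2)`_(d + d) = (c i d * c i d)%:C.
  rewrite expr2 coefM.
  have hd : (d < (d + d).+1)%N by rewrite ltnS leq_addr.
  rewrite (bigD1 (Ordinal hd)) //= addnK !coef_poly ltnSn rmorphM /= big1 ?addr0 // => j hj.
  rewrite !coef_poly; case: ifP => h1; last by rewrite mul0r.
  case: ifP => h2; last by rewrite mulr0.
  exfalso; move/eqP: hj; apply; apply/val_inj => /=.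
  by move: h1 h2; rewrite !ltnS leq_subLR leq_add2r => h1 h2; apply/eqP; rewrite eqn_leq h1 h2.
have hp : p`_(d + d) != 0.
  rewrite /p coef_sum !big_ord_recr big_ord0 /= !sq add0r -!rmorphD /=.
  by rewrite fmorph_eq0.
have [z hz] : exists z, root p z.
  apply/closed_rootP; apply: contra hp => /eqP hs.
  by rewrite nth_default // hs addn_gt0 d0.
exists z; move/rootP: hz; rewrite /p horner_sum => hz.
rewrite -[RHS]hz; apply: eq_bigr => i _.
by rewrite horner_exp horner_poly.
Qed.

Lemma sum_split (z : R[i]) (c : nat -> R) n :
  \sum_(k < n) (c k)%:C * z ^+ k =
  (rsum (fun k => Rmult (complex.Re (z ^+ k)) (c k)) n +i*
   rsum (fun k => Rmult (complex.Im (z ^+ k)) (c k)) n)%C.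
Proof.
elim: n => [|n IH]; first by rewrite big_ord0.
rewrite big_ord_recr /= {}IH; case: (z ^+ n) => a b /=.
by apply/eqP; rewrite eq_complex /= !mul0r subr0 addr0 !RplusE !RmultE ![c n * _]mulrC !eqxx.
Qed.

(** The real form of the previous lemma; [u k] and [v k] are the real and
    imaginary parts of the [k]-th power of the root [x + i y]. *)
Lemma sum_of_squares_real_root (c : nat -> nat -> R) (d : nat) : is_true (0 < d)%N ->
  (rsum (fun i => Rmult (c i d) (c i d)) 4 <> IZR 0)%type ->
  exists (x y : R) (u v : nat -> R), (u 0%N = IZR 1 /\ v 0%N = IZR 0 /\
    (forall k, u (S k) = Rminus (Rmult x (u k)) (Rmult y (v k))) /\
    (forall k, v (S k) = Rplus (Rmult x (v k)) (Rmult y (u k))) /\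
    let A i := rsum (fun k => Rmult (u k) (c i k)) (S d) in
    let B i := rsum (fun k => Rmult (v k) (c i k)) (S d) in
    rsum (fun i => Rmult (A i) (A i)) 4 = rsum (fun i => Rmult (B i) (B i)) 4 /\
    rsum (fun i => Rmult (A i) (B i)) 4 = IZR 0)%type.
Proof.
move=> d0 hc.
have [|z hz] := @sum_of_squares_root c d d0; first by apply/eqP.
exists (complex.Re z), (complex.Im z), (fun k => complex.Re (z ^+ k)), (fun k => complex.Im (z ^+ k)).
split; first by [].
split; first by [].
split; first by move=> k; rewrite exprS; case: (z) (z ^+ k) => a b [a' b'].
split; first by move=> k; rewrite exprS; case: (z) (z ^+ k) => a b [a' b'].
move=> A B.
have {hz} : \sum_(i < 4) (A i +i* B i)%C ^+ 2 = 0.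
  by rewrite -[RHS]hz; apply: eq_bigr => i _; rewrite sum_split.
clearbody A B; rewrite !big_ord_recr big_ord0 /=.
move: (A 0%N) (A 1%N) (A 2%N) (A 3%N) (B 0%N) (B 1%N) (B 2%N) (B 3%N) => a0 a1 a2 a3 b0 b1 b2 b3.
rewrite !expr2 => /eqP; rewrite eq_complex /= !add0r => /andP [/eqP h1 /eqP h2].
have {}h1 : Rplus (Rplus (Rplus (Rminus (Rmult a0 a0) (Rmult b0 b0))
  (Rminus (Rmult a1 a1) (Rmult b1 b1))) (Rminus (Rmult a2 a2) (Rmult b2 b2)))
  (Rminus (Rmult a3 a3) (Rmult b3 b3)) = IZR 0 := h1.
have {}h2 : Rplus (Rplus (Rplus (Rplus (Rmult a0 b0) (Rmult b0 a0))
  (Rplus (Rmult a1 b1) (Rmult b1 a1))) (Rplus (Rmult a2 b2) (Rmult b2 a2)))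
  (Rplus (Rmult a3 b3) (Rmult b3 a3)) = IZR 0 by rewrite -[RHS]h2.
by simpl; split; lra.
Qed.
End ComplexRoot.

(** Horner division: the remainder is the value at [q]. *)
Lemma poly_left_division d q B : deg_le d B -> exists X, deg_le (d - 1) X /\
  B = (fl q * X + fC (qsum (term q B) (S d)))%fps.
Proof.
revert B; induction d as [|d IH]; intros B hB.
- exists (fC 0); split.
  + intros m _; now rewrite fC0.
  + rewrite (deg_le_0 B hB) at 1; simpl.
    replace (RtoQ 0 + RtoQ 1 * B 0%nat)%Q with (B 0%nat) by qring.
    rewrite fC0; fpoint; destruct m; [rewrite fl_l0|rewrite fl_lS]; simpl; qring.
- set (B' := (fun m => B (S m)) : fps).
  destruct (IH B') as [X [hX e]]; [intros m hm; apply hB; lia|].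
  set (r := qsum (term q B') (S d)) in *.
  exists (B' + fC q * X)%fps; split.
  + intros m hm; unfold fadd; rewrite fmul_C_l, hX by lia.
    unfold B'; rewrite hB by lia; qring.
  + replace (qsum (term q B) (S (S d))) with (B 0%nat + q * r)%Q.
    * rewrite fC_add, fC_mul.
      transitivity (fC (B 0%nat) + fX * B')%fps; [apply fps_head|].
      transitivity (fC (B 0%nat) + fl q * B' + fC q * B')%fps; [unfold fl; fring|].
      rewrite e at 2.
      assert (hc : (fl q * fC q = fC q * fl q)%fps) by (unfold fl;
        transitivity (fX * fC q - fC q * fC q)%fps; [fring|]; rewrite fX_central; fring).
      transitivity (fC (B 0%nat) + fl q * B' + (fC q * fl q) * X + fC q * fC r)%fps; [fring|].
      rewrite <- hc; fring.
    * rewrite (qsum_head (term q B)); unfold r; rewrite <- qsum_mul_l; f_equal; [simpl; qring|].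
      apply qsum_ext; intros k _; simpl; now rewrite <- qmultA.
Qed.

(** The sum of the squares of the four coordinate polynomials has a complex root
    [x + i y]; there the stem value [a + i b] of [B] has [|a| = |b|] and [a]
    orthogonal to [b], so that [a + J b = 0] for some imaginary unit [J]. *)
Lemma poly_root d B : deg_le (S d) B -> B (S d) <> RtoQ 0 ->
  exists q X, deg_le d X /\ B = (fl q * X)%fps.
Proof.
intros hB hd.
destruct (ComplexRoot.sum_of_squares_real_root (fun i k => qdot (qe i) (B k)) (S d)) as
  [x [y [u [v [u0 [v0 [hu [hv [h1 h2]]]]]]]]]; [easy| |].
{ intros e; apply hd, qn0; rewrite qdot_self, qdot_basis, <- e.
  apply rsum_ext; intros i _; now rewrite (qdotC (B (S d))). }
set (a := qsum (fun k => RtoQ (u k) * B k)%Q (S (S d))).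
set (b := qsum (fun k => RtoQ (v k) * B k)%Q (S (S d))).
assert (hc : forall t i, rsum (fun k => t k * qdot (qe i) (B k)) (S (S d))
  = qdot (qe i) (qsum (fun k => RtoQ (t k) * B k)%Q (S (S d)))).
{ intros t i; rewrite qdot_sum; apply rsum_ext; intros; symmetry; apply qdot_real_r. }
assert (h : forall p q, rsum (fun i => qdot (qe i) p * qdot (qe i) q) 4 = qdot p q).
{ intros p q; rewrite (qdot_basis p); apply rsum_ext; intros; now rewrite (qdotC p). }
assert (e1 : qn a = qn b).
{ rewrite !qdot_self, <- (h a), <- (h b).
  etransitivity; [|etransitivity; [exact h1|]]; apply rsum_ext; intros i _; now rewrite !hc. }
assert (e2 : qdot a b = 0).
{ rewrite <- h, <- h2; apply rsum_ext; intros i _; now rewrite !hc. }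
assert (hJ : exists J, inS J /\ (a + J * b)%Q = RtoQ 0).
{ clearbody a b; destruct (Req_dec (qn b) 0) as [hb|hb].
  - exists (0, 1, 0, 0); split; [apply inS_i|].
    rewrite hb in e1; rewrite (qn0 b hb), (qn0 a e1); qring.
  - exists (RtoQ (- / qn b) * (a * qconj b))%Q.
    assert (hw : qconj (a * qconj b) = (- (a * qconj b))%Q).
    { replace (qconj (a * qconj b)) with (RtoQ (2 * qdot a b) - a * qconj b)%Q
        by (unfold qdot; qring).
      rewrite e2, Rmult_0_r; qring. }
    split.
    + unfold inS.
      transitivity (RtoQ (- (/ qn b * / qn b)) * (a * qconj b * - (a * qconj b)))%Q; [qring|].
      rewrite <- hw, qmult_conj, qnM, qn_conj, e1, <- RtoQM; f_equal; field; easy.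
    + transitivity (a + RtoQ (- / qn b) * a * (qconj b * b))%Q; [qring|].
      rewrite qconj_mult.
      transitivity (a + RtoQ (- / qn b * qn b) * a)%Q; [qring|].
      replace (- / qn b * qn b) with (-1) by (field; easy); qring. }
destruct hJ as [J [hJ e]].
assert (hp : forall k, qpow (slice J x y) k = slice J (u k) (v k)).
{ induction k as [|k IH]; [rewrite u0, v0; unfold slice; simpl; qring|].
  simpl qpow; rewrite IH, slice_mul, hu, hv by easy; f_equal. }
destruct (poly_left_division (S d) (slice J x y) B hB) as [X [hX eX]].
exists (slice J x y), X; split; [intros m hm; apply hX; lia|].
rewrite eX at 1.
replace (qsum (term (slice J x y) B) (S (S d))) with (RtoQ 0).
- rewrite fC0; fpoint; apply qplus0r.
- rewrite <- e; unfold a, b; rewrite <- qsum_mul_l, <- qsum_add.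
  apply qsum_ext; intros k _; rewrite hp; unfold slice; qring.
Qed.

(** * Reversed polynomials *)

(** The polynomial [z ^ d * conj (A (1 / conj z))]. *)
Definition frev (d : nat) (A : fps) : fps :=
  fun k => if Nat.leb k d then qconj (A (d - k)%nat) else RtoQ 0.

Lemma frev_le d A k : (k <= d)%nat -> frev d A k = qconj (A (d - k)%nat).
Proof. intros h; unfold frev; now rewrite (proj2 (Nat.leb_le k d) h). Qed.

Lemma frev_gt d A k : (d < k)%nat -> frev d A k = RtoQ 0.
Proof. intros h; unfold frev; now rewrite (proj2 (Nat.leb_gt k d) h). Qed.

Lemma frev_deg d A : deg_le d (frev d A).
Proof. intros k; apply frev_gt. Qed.

Lemma frev_rev d A : deg_le d A -> frev d (frev d A) = A.
Proof.
intros h; apply fps_ext; intros k; destruct (Nat.le_gt_cases k d) as [l|l].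
- rewrite !frev_le by lia; replace (d - (d - k))%nat with k by lia; apply qconjK.
- now rewrite frev_gt, h.
Qed.

Lemma frev_add d A B : frev d (A + B) = (frev d A + frev d B)%fps.
Proof.
fpoint; destruct (Nat.le_gt_cases m d) as [l|l]; [rewrite !frev_le by easy; apply qconjD|].
rewrite !frev_gt by easy; qring.
Qed.

Lemma frev_C_r d A c : frev d (A * fC c) = (fC (qconj c) * frev d A)%fps.
Proof.
fpoint; rewrite fmul_C_l; destruct (Nat.le_gt_cases m d) as [l|l].
- rewrite !frev_le, fmul_C_r by easy; apply qconjM.
- rewrite !frev_gt by easy; qring.
Qed.

Lemma frev_fl_l d q Y : deg_le d Y -> frev (S d) (fl q * Y) = (frev d Y * fr (qconj q))%fps.
Proof.
intros h; apply fps_ext; intros [|m].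
- rewrite fr_r0, !frev_le, !Nat.sub_0_r, fl_lS, (h (S d)) by lia; f_equal; qring.
- rewrite fr_rS; destruct (Nat.le_gt_cases m d) as [l|l].
  + rewrite (frev_le (S d)), (frev_le d Y m) by lia; simpl (S d - S m)%nat.
    destruct (d - m)%nat as [|j] eqn:e.
    * rewrite fl_l0, frev_gt by lia; qring.
    * rewrite fl_lS, frev_le by lia; replace (d - S m)%nat with j by lia; qring.
  + rewrite !frev_gt by lia; qring.
Qed.

Lemma frev_fl_r d p Y : deg_le d Y -> frev (S d) (Y * fl p) = (fr (qconj p) * frev d Y)%fps.
Proof.
intros h; apply fps_ext; intros [|m].
- rewrite fr_l0, !frev_le, !Nat.sub_0_r, fl_rS, (h (S d)) by lia; f_equal; qring.
- rewrite fr_lS; destruct (Nat.le_gt_cases m d) as [l|l].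
  + rewrite (frev_le (S d)), (frev_le d Y m) by lia; simpl (S d - S m)%nat.
    destruct (d - m)%nat as [|j] eqn:e.
    * rewrite fl_r0, frev_gt by lia; qring.
    * rewrite fl_rS, frev_le by lia; replace (d - S m)%nat with j by lia; qring.
  + rewrite !frev_gt by lia; qring.
Qed.

Lemma deg_fl_l d q Y : deg_le d Y -> deg_le (S d) (fl q * Y).
Proof. intros h [|m] hm; [lia|]; rewrite fl_lS, !h by lia; qring. Qed.
Lemma deg_fl_r d q Y : deg_le d Y -> deg_le (S d) (Y * fl q).
Proof. intros h [|m] hm; [lia|]; rewrite fl_rS, !h by lia; qring. Qed.
Lemma deg_fr_l d q Y : deg_le d Y -> deg_le (S d) (fr q * Y).
Proof. intros h [|m] hm; [lia|]; rewrite fr_lS, !h by lia; qring. Qed.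
Lemma deg_fr_r d q Y : deg_le d Y -> deg_le (S d) (Y * fr q).
Proof. intros h [|m] hm; [lia|]; rewrite fr_rS, !h by lia; qring. Qed.
Lemma deg_add d A B : deg_le d A -> deg_le d B -> deg_le d (A + B).
Proof. intros h k m hm; unfold fadd; rewrite h, k by easy; qring. Qed.
Lemma deg_C_r d A c : deg_le d A -> deg_le d (A * fC c).
Proof. intros h m hm; rewrite fmul_C_r, h by easy; qring. Qed.

Lemma frev_fr_r d q Y : deg_le d Y -> frev (S d) (Y * fr q) = (fl (qconj q) * frev d Y)%fps.
Proof.
intros h; rewrite <- (frev_rev d Y h) at 1.
replace (fr q) with (fr (qconj (qconj q))) by now rewrite qconjK.
rewrite <- frev_fl_l by apply frev_deg; apply frev_rev, deg_fl_l, frev_deg.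
Qed.

Lemma frev_fr_l d q Y : deg_le d Y -> frev (S d) (fr q * Y) = (frev d Y * fl (qconj q))%fps.
Proof.
intros h; rewrite <- (frev_rev d Y h) at 1.
replace (fr q) with (fr (qconj (qconj q))) by now rewrite qconjK.
rewrite <- frev_fl_r by apply frev_deg; apply frev_rev, deg_fl_r, frev_deg.
Qed.

(** Beyond degree [d] the coefficients of [h] satisfy the recurrence of
    [tail_zero_l]. *)
Lemma deg_quotient_fl d q h : qn q <= 1 -> tends0 h -> deg_le (S d) (fl q * h) -> deg_le d h.
Proof.
intros hq h0 hd m hm; apply (tail_zero_l (S d) q); auto.
intros k hk; specialize (hd (S k) ltac:(lia)); rewrite fl_lS in hd; now apply qsub_eq0.
Qed.

Lemma deg_quotient_fr d q k : 1 <= qn q -> tends0 k -> deg_le (S d) (k * fr q) -> deg_le d k.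
Proof.
intros hq h0 hd m hm.
assert (hq0 : q <> RtoQ 0) by (intros e; rewrite e, qnR in hq; lra).
apply (tail_zero_r (S d) (/ q)%Q); auto.
- assert (e := f_equal qn (qinv_l q hq0)); rewrite qnM, qnR in e.
  pose proof (qn_ge0 (/ q)%Q); nra.
- intros j hj; specialize (hd (S j) ltac:(lia)); rewrite fr_rS in hd; apply qsub_eq0 in hd.
  rewrite hd, <- qmultA, qinv_r, qmult1r; easy.
Qed.

(** * Contractive rational series are Blaschke products *)

(** [F] is the left fraction [A^-1 B] and also the right fraction of the reversed
    polynomials. This is how unimodularity of [F] on the sphere appears. *)
Definition inner_pair (d : nat) (F A B : fps) : Prop :=
  deg_le d A /\ deg_le d B /\ (A * F)%fps = B /\ (F * frev d B)%fps = frev d A /\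
  B d <> RtoQ 0.

Lemma inner_pair_C u : qn u = 1 -> inner_pair 0 (fC u) (fC 1) (fC u).
Proof.
intros hu.
assert (hr : forall c, frev 0 (fC c) = fC (qconj c)).
{ intros c; apply fps_ext; intros [|m]; [now rewrite frev_le|now rewrite frev_gt by lia]. }
split; [|split; [|split; [|split]]].
- intros [|m] hm; [lia|easy].
- intros [|m] hm; [lia|easy].
- apply fmul1l.
- rewrite !hr, <- fC_mul, qmult_conj, hu; f_equal; qring.
- simpl; intros e; rewrite e, qnR in hu; lra.
Qed.

(** [b = a u] and [u conj b = conj a] force [|u| = 1]. *)
Lemma inner_pair_0 F A B : inner_pair 0 F A B -> exists u, qn u = 1 /\ F = fC u.
Proof.
intros [hA [hB [e1 [e2 hb]]]].
rewrite (deg_le_0 A hA) in e1; rewrite (deg_le_0 B hB) in e1.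
assert (hr : forall C, deg_le 0 C -> frev 0 C = fC (qconj (C 0%nat))).
{ intros C hC; apply fps_ext; intros [|m]; [now rewrite frev_le|now rewrite frev_gt by lia]. }
rewrite (hr A hA), (hr B hB) in e2.
set (a := A 0%nat) in *; set (b := B 0%nat) in *.
assert (hF : F = fC (F 0%nat)).
{ apply fps_ext; intros [|m]; [easy|]; simpl.
  apply (f_equal (fun u => u (S m))) in e2; rewrite fmul_C_r in e2; simpl in e2.
  apply (qmult_cancel_r (qconj b)).
  - intros e; apply hb; rewrite <- (qconjK b), e; qring.
  - rewrite e2; qring. }
exists (F 0%nat); split; [|easy].
apply (f_equal (fun u => qn (u 0%nat))) in e1, e2.
rewrite fmul_C_l, qnM in e1; rewrite fmul_C_r, qnM in e2; simpl in e1, e2.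
rewrite !qn_conj in e2.
assert (hb' : qn b <> 0) by (intros e; now apply hb, qn0).
pose proof (qn_ge0 b); pose proof (qn_ge0 (F 0%nat)).
assert (hs : qn (F 0%nat) * qn (F 0%nat) = 1).
{ apply Rmult_eq_reg_r with (qn b); [|easy]; rewrite <- e1 at 2; rewrite <- e2; ring_simplify.
  rewrite <- e1; rewrite <- e2; ring_simplify; nra. }
nra.
Qed.

Lemma tends0_geom q : qn q < 1 -> tends0 (fgeom q).
Proof.
intros hq; apply l2_tends0; rewrite <- (fmul1r (fgeom q)).
apply l2_geom; [easy|apply l2_C].
Qed.

Lemma fX_C_comm c : (fX * fC c = fC c * fX)%fps.
Proof. apply fX_central. Qed.

Lemma fC_fl p q c : (c * p = q * c)%Q -> (fC c * fl p = fl q * fC c)%fps.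
Proof.
intros h; unfold fl.
transitivity (fC c * fX - fC c * fC p)%fps; [fring|].
rewrite <- fX_C_comm, <- fC_mul, h, fC_mul; fring.
Qed.

(** A zero [q] of the numerator lowers the degree. Outside the open ball, or if the
    denominator vanishes there too, [fl q] is a common left factor of [A] and [B].
    Otherwise the remainder [c] of [A] conjugates [q] to a zero [p] of [F], and [F]
    is divided by the Blaschke factor of [p]. Each quotient is a polynomial because
    it is a null sequence and its product with a linear factor is a polynomial. *)
Lemma inner_pair_reduce d F A B : contractive F -> inner_pair (S d) F A B ->
  (exists A' B', inner_pair d F A' B') \/
  (exists p F' A' B', qn p < 1 /\ F = (fblaschke p * F')%fps /\ contractive F' /\
     inner_pair d F' A' B').
Proof.
intros hF [hA [hB [e1 [e2 hb]]]].
destruct (poly_root d B hB hb) as [q [X1 [hX1 eB]]].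
assert (hx : X1 d <> RtoQ 0).
{ intros e; apply hb; rewrite eB, fl_lS, e, hX1 by lia; qring. }
assert (revB : frev (S d) B = (frev d X1 * fr (qconj q))%fps) by now rewrite eB, frev_fl_l.
destruct (Rle_lt_dec 1 (qn q)) as [hq|hq].
- left; set (k := (F * frev d X1)%fps).
  assert (ek : (k * fr (qconj q))%fps = frev (S d) A).
  { unfold k; rewrite <- fmulA, <- revB; exact e2. }
  assert (hk : deg_le d k).
  { apply (deg_quotient_fr d (qconj q)).
    - now rewrite qn_conj.
    - apply (tends0_poly_r d); [apply frev_deg|].
      now apply l2_tends0, contractive_is_l2.
    - rewrite ek; apply frev_deg. }
  assert (eA : A = (fl q * frev d k)%fps).
  { rewrite <- (frev_rev (S d) A hA), <- ek, frev_fr_r by easy; now rewrite qconjK. }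
  exists (frev d k), X1; split; [apply frev_deg|split; [easy|split; [|split; [|easy]]]].
  + apply (fl_cancel_l q); now rewrite fmulA, <- eA, e1.
  + rewrite frev_rev by easy; reflexivity.
- destruct (poly_left_division (S d) q A hA) as [Y [hY eA]].
  assert (hY' : deg_le d Y) by (intros m hm; apply hY; lia).
  set (c := qsum (term q A) (S (S d))) in *.
  destruct (excluded_middle_informative (c = RtoQ 0)) as [hc|hc].
  + left; exists Y, X1.
    assert (eA' : A = (fl q * Y)%fps).
    { rewrite eA, hc, fC0; fpoint; apply qplus0r. }
    split; [easy|split; [easy|split; [|split; [|easy]]]].
    * apply (fl_cancel_l q); now rewrite fmulA, <- eA', e1.
    * apply (fr_cancel_r (qconj q)).
      rewrite <- fmulA, <- revB, e2, eA', frev_fl_l; easy.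
  + right; set (p := (/ c * q * c)%Q).
    assert (hcp : (c * p = q * c)%Q).
    { unfold p; now rewrite !qmultA, qinv_r, qmult1l. }
    assert (hp : qn p < 1).
    { assert (e := f_equal qn hcp); rewrite !qnM in e.
      assert (qn c <> 0) by (intros z; now apply hc, qn0).
      pose proof (qn_ge0 c); nra. }
    set (L := (fC (/ c)%Q * (X1 - Y * F))%fps).
    assert (hci : (fC c * fC (/ c)%Q)%fps = fC 1) by now rewrite <- fC_mul, qinv_r.
    assert (hci' : (fC (/ c)%Q * fC c)%fps = fC 1) by now rewrite <- fC_mul, qinv_l.
    assert (ecF : (fC c * F = fl q * (X1 - Y * F))%fps).
    { transitivity (A * F - fl q * Y * F)%fps; [rewrite eA at 1; fring|].
      rewrite e1, eB; fring. }
    assert (ecL : (fC c * L = X1 - Y * F)%fps) by (unfold L; now rewrite fmulA, hci, fmul1l).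
    assert (eF : F = (fl p * L)%fps).
    { rewrite <- (fmul1l F), <- hci', <- fmulA, ecF, <- ecL, fmulA, fmulA.
      rewrite <- (fmulA (fC (/ c)%Q)), <- (fC_fl p q c hcp), (fmulA (fC (/ c)%Q)), hci'.
      now rewrite fmul1l. }
    assert (F0 : tends0 F) by now apply l2_tends0, contractive_is_l2.
    assert (L0 : tends0 L).
    { apply tends0_C_l, tends0_sub; [now apply (tends0_poly d)|now apply (tends0_poly_l d)]. }
    set (F' := (fr (qconj p) * L)%fps).
    assert (hF' : contractive F').
    { apply contractive_div; auto; now rewrite <- eF. }
    set (N := (L * frev (S d) B)%fps).
    assert (eN : (fl p * N)%fps = frev (S d) A).
    { unfold N; rewrite fmulA, <- eF; exact e2. }
    assert (hN : deg_le d N).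
    { apply (deg_quotient_fl d p); [lra| |rewrite eN; apply frev_deg].
      apply (tends0_poly_r (S d)); [apply frev_deg|easy]. }
    assert (eA2 : A = (frev d N * fr (qconj p))%fps).
    { now rewrite <- (frev_rev (S d) A hA), <- eN, frev_fl_l. }
    set (Z := (fC c + Y * fl p)%fps).
    assert (comm : (fl p * fr (qconj p) = fr (qconj p) * fl p)%fps).
    { apply fl_fr_comm; now rewrite qconj_mult, qmult_conj. }
    assert (eZ : (fl q * Z = frev d N * fl p * fr (qconj p))%fps).
    { rewrite <- fmulA, comm, fmulA, <- eA2.
      transitivity (fl q * fC c + fl q * Y * fl p)%fps; [unfold Z; fring|].
      rewrite <- (fC_fl p q c hcp), eA at 1; fring. }
    set (h := (Z * fgeom (qconj p))%fps).
    assert (eh : (h * fr (qconj p))%fps = Z).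
    { unfold h; now rewrite <- fmulA, geom_fr, fmul1r. }
    assert (eh2 : (fl q * h = frev d N * fl p)%fps).
    { unfold h; rewrite fmulA, eZ, <- fmulA, fr_geom; apply fmul1r. }
    assert (hh : deg_le d h).
    { apply (deg_quotient_fl d q); [lra| |rewrite eh2; apply deg_fl_r, frev_deg].
      apply (tends0_poly_l (S d)).
      - apply deg_add; [intros [|m] hm; [lia|easy]|now apply deg_fl_r].
      - apply tends0_geom; now rewrite qn_conj. }
    exists p, F', h, X1; split; [easy|split; [|split; [easy|]]].
    * unfold F'; now rewrite fmulA, fblaschke_r.
    * split; [easy|split; [easy|split; [|split; [|easy]]]].
      -- unfold F'; rewrite fmulA, eh.
         transitivity (fC c * L + Y * (fl p * L))%fps; [unfold Z; fring|].
         rewrite <- eF, ecL; fring.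
      -- apply (fr_cancel_r (qconj q)).
         rewrite <- fmulA, <- revB, <- frev_fl_l, eh2, frev_fl_r, frev_rev
           by (easy || apply frev_deg).
         unfold F'; now rewrite <- fmulA.
Qed.

Definition fprod (ts : list quat) (u : quat) : fps :=
  fold_right (fun p G => fblaschke p * G)%fps (fC u) ts.

Lemma inner_pair_factor d F A B : contractive F -> inner_pair d F A B ->
  exists ts u, List.Forall (fun p => qn p < 1) ts /\ qn u = 1 /\ F = fprod ts u.
Proof.
revert F A B; induction d as [|d IH]; intros F A B hF h.
- destruct (inner_pair_0 F A B h) as [u [hu e]].
  now exists nil, u.
- destruct (inner_pair_reduce d F A B hF h) as
    [[A' [B' h']]|[p [F' [A' [B' [hp [e [hF' h']]]]]]]].
  + exact (IH F A' B' hF h').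
  + destruct (IH F' A' B' hF' h') as [ts [u [h1 [h2 h3]]]].
    exists (p :: ts), u; split; [now constructor|split; [easy|]].
    simpl; now rewrite <- h3.
Qed.

(** With [G] the product of [F'] and the Blaschke factor of [r], the pairs of [F']
    and [F] are related by the linear substitution that belongs to the Moebius
    transformation; the degree grows by one, from the Blaschke factor. *)
Lemma inner_pair_schur (r : R) a d F F' A B : r * r < 1 -> qn a < 1 -> contractive F' ->
  schur r a F F' -> inner_pair d F' A B -> exists A2 B2, inner_pair (S d) F A2 B2.
Proof.
intros hr ha hF' hs [hA [hB [e1 [e2 hb]]]].
set (G := (fblaschke r * F')%fps).
assert (hGc : contractive G).
{ apply contractive_mul; [apply contractive_blaschke; now rewrite qnR|easy]. }
assert (hG : (fr r * G = fl r * F')%fps).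
{ unfold G; rewrite fmulA; f_equal; rewrite <- (qconjR r) at 1; apply fblaschke_l. }
apply (schur_moebius r a F F' G hG) in hs.
assert (hu : (fC 1 + fC (qconj a) * G)%fps 0%nat <> RtoQ 0).
{ unfold fadd; rewrite fmul_C_l; simpl; apply unit_coef_neq0.
  - now rewrite qn_conj.
  - now apply contractive_coef. }
assert (hs' : ((fC 1 + G * fC (qconj a)) * F = G + fC a)%fps).
{ apply (fps_unit_cancel_r _ _ _ hu).
  rewrite <- fmulA, hs.
  assert (hc : (fC (qconj a) * fC a = fC a * fC (qconj a))%fps).
  { now rewrite <- !fC_mul, qconj_mult, qmult_conj. }
  assert (hc' : (G * (fC (qconj a) * fC a) = fC a * (fC (qconj a) * G))%fps).
  { rewrite fmulA, <- fmulA, <- fC_mul, qconj_mult, <- fC_real_central.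
    now rewrite <- qmult_conj, fC_mul, fmulA. }
  transitivity (G + fC a + G * fC (qconj a) * G + G * (fC (qconj a) * fC a))%fps; [fring|].
  rewrite hc'; fring. }
set (A1 := (fr r * A)%fps); set (B1 := (fl r * B)%fps).
assert (eB1 : (A1 * G)%fps = B1).
{ unfold A1, B1; rewrite (fr_real_central r A), <- fmulA, hG, fmulA.
  rewrite <- fl_real_central, <- fmulA; now rewrite e1. }
assert (rA1 : frev (S d) A1 = (frev d A * fl r)%fps).
{ unfold A1; rewrite frev_fr_l by easy; now rewrite qconjR. }
assert (rB1 : frev (S d) B1 = (frev d B * fr r)%fps).
{ unfold B1; rewrite frev_fl_l by easy; now rewrite qconjR. }
assert (eA1 : (G * frev (S d) B1)%fps = frev (S d) A1).
{ rewrite rB1, rA1, <- (fr_real_central r (frev d B)), fmulA, <- (fr_real_central r G), hG.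
  rewrite <- fmulA, e2; apply fl_real_central. }
exists (A1 + B1 * fC (qconj a))%fps, (B1 + A1 * fC a)%fps.
assert (rB2 : frev (S d) (B1 + A1 * fC a) =
  ((fC 1 + fC (qconj a) * G) * frev (S d) B1)%fps).
{ rewrite frev_add, frev_C_r, <- eA1; rewrite <- (fmul1l (frev (S d) B1)) at 1; fring. }
assert (dA1 : deg_le (S d) A1) by now apply deg_fr_l.
assert (dB1 : deg_le (S d) B1) by now apply deg_fl_l.
split; [|split; [|split; [|split]]].
- apply deg_add; [easy|now apply deg_C_r].
- apply deg_add; [easy|now apply deg_C_r].
- rewrite <- eB1.
  transitivity (A1 * ((fC 1 + G * fC (qconj a)) * F))%fps.
  + rewrite <- (fmul1l F) at 1 2; fring.
  + rewrite hs'; fring.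
- rewrite rB2, fmulA, hs, frev_add, frev_C_r, qconjK, <- eA1; fring.
- intros e.
  assert (h0 : frev (S d) (B1 + A1 * fC a) 0%nat = RtoQ 0).
  { rewrite frev_le by lia; rewrite Nat.sub_0_r, e; qring. }
  rewrite rB2, fmul_0th in h0; apply qmult_eq0 in h0; [|exact hu].
  rewrite frev_le, Nat.sub_0_r in h0 by lia; unfold B1 in h0; rewrite fl_lS, (hB (S d)) in h0 by lia.
  apply hb; rewrite <- (qconjK (B d)).
  replace (qconj (B d)) with (qconj (B d - r * 0)) by qring; rewrite h0; qring.
Qed.

(** * Star products and regular Blaschke products *)

Lemma contractive_expansion a : contractive a -> has_expansion (qPSeries a) a.
Proof.
intros h; apply expansion_qPSeries; intros q hq; exists (qSeries (term q a)).
apply (bounded_qser a 1); [|easy]; intros m; apply qmod_le1, contractive_coef, h.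
Qed.

Lemma poly_qser d a q : deg_le d a -> is_qser (term q a) (qsum (term q a) (S d)).
Proof.
intros h; apply (is_lim_seq_ext_loc (fun _ => 0)); [|apply is_lim_seq_const].
exists (S d); intros m hm; rewrite (qsum_extend _ (S d) m hm), qplusN, qmodR, Rabs_R0; [easy|].
intros k hk; rewrite h by lia; apply qmult0r.
Qed.

Lemma poly_expansion d a f : deg_le d a -> (forall q, f q = qsum (term q a) (S d)) ->
  has_expansion f a.
Proof. intros h e; apply has_expansion_qser; intros q _; rewrite e; now apply poly_qser. Qed.

Lemma star_expansion f g a b : has_expansion f a -> has_expansion g b ->
  star f g = qPSeries (a * b)%fps.
Proof.
intros hf hg; unfold star; rewrite (coeffs_unique f a hf), (coeffs_unique g b hg).
f_equal; apply functional_extensionality; intros m; apply sum_n_qsum.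
Qed.

Lemma deg_fr q : deg_le 1 (fr q).
Proof. intros [|[|m]] hm; try lia; unfold fr, fsub; rewrite fmul_X_l; simpl; qring. Qed.

Lemma deg_fl q : deg_le 1 (fl q).
Proof. intros [|[|m]] hm; try lia; unfold fl, fsub; simpl; qring. Qed.

Lemma fr_expansion p : has_expansion (fun q => RtoQ 1 - q * p)%Q (fr p).
Proof.
apply (poly_expansion 1); [apply deg_fr|]; intros q; unfold fr, fsub; rewrite fmul_X_l.
simpl; qring.
Qed.

Lemma fl_expansion p : has_expansion (fun q => q - p)%Q (fl p).
Proof.
apply (poly_expansion 1); [apply deg_fl|]; intros q; unfold fl, fsub; simpl; qring.
Qed.

Lemma geom_value p q : inB p -> inB q -> exists S : quat,
  is_qser (term q (fgeom p)) S /\ S = (RtoQ 1 + q * S * p)%Q.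
Proof.
intros hp hq; exists (qSeries (term q (fgeom p))).
assert (h : is_qser (term q (fgeom p)) (qSeries (term q (fgeom p)))).
{ apply (bounded_qser _ 1); [|easy]; intros m; unfold fgeom; rewrite qmod_pow.
  unfold inB in hp; rewrite <- (pow1 m); apply pow_incr; pose proof (qmod_ge0 p); lra. }
split; [easy|]; apply (is_qser_unique _ _ _ h).
replace (RtoQ 1) with (qsum (term q (fgeom p)) 1) by (unfold fgeom; simpl; qring).
apply is_qser_shift.
apply (is_qser_ext (fun m => q * (qpow q m * fgeom p m) * p)%Q).
- intros m; unfold fgeom; simpl; rewrite (qpow_comm p); now rewrite !qmultA.
- now apply is_qser_mul_r, is_qser_mul_l.
Qed.

(** The sum [S] of the geometric series satisfies [S = 1 + q S conj p]. Multiplied by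
    the symmetrization of [1 - q conj p], which has real coefficients, this gives
    [1 - q p], the value of the regular conjugate. *)
Lemma star_inv_expansion p : inB p ->
  has_expansion (star_inv (fun q => RtoQ 1 - q * qconj p)%Q) (fgeom (qconj p)).
Proof.
intros hp; apply has_expansion_qser; intros q hq.
assert (hp' : inB (qconj p)) by (unfold inB; now rewrite qmod_conj).
destruct (geom_value (qconj p) q hp' hq) as [S [hS eS]].
set (f := fun q => (RtoQ 1 - q * qconj p)%Q).
assert (hf : has_expansion f (fr (qconj p))) by apply fr_expansion.
assert (ec : (fun m => qconj (coeffs f m)) = fr p).
{ rewrite (coeffs_unique f _ hf); apply functional_extensionality; intros [|[|m]];
    unfold fr, fsub; rewrite !fmul_X_l; simpl; qring. }
assert (hc : has_expansion (reg_conj f) (fr p)).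
{ unfold reg_conj; rewrite ec; apply expansion_qPSeries; intros x _; eexists.
  apply (poly_qser 1), deg_fr. }
assert (vc : reg_conj f q = (RtoQ 1 - q * p)%Q).
{ apply (expansion_unique_fun _ (fun q => RtoQ 1 - q * p)%Q (fr p)); [easy|apply fr_expansion|easy]. }
assert (vs : symmetrization f q
  = (RtoQ 1 - q * (p + qconj p) + q * q * (qconj p * p))%Q).
{ unfold symmetrization; rewrite (star_expansion _ _ _ _ hf hc).
  unfold qPSeries; rewrite (qSeries_unique _ _ (poly_qser 2 _ q (deg_fr_r 1 p _ (deg_fr (qconj p))))).
  simpl qsum; rewrite fr_r0, !fr_rS.
  unfold fr, fsub; rewrite !fmul_X_l; simpl; qring. }
assert (main : (symmetrization f q * S)%Q = (RtoQ 1 - q * p)%Q).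
{ rewrite vs.
  assert (e1 : (q * S * qconj p)%Q = (S - RtoQ 1)%Q) by (rewrite eS at 2; qring).
  assert (e2 : (q * S * (qconj p * p))%Q = (S * p - p)%Q).
  { rewrite qmultA, e1; qring. }
  assert (hr : forall x : quat, (x * (qconj p * p) = (qconj p * p) * x)%Q).
  { intros x; rewrite qconj_mult; symmetry; apply qrealC. }
  assert (ht : ((p + qconj p) * S = S * (p + qconj p))%Q).
  { replace (p + qconj p)%Q with (RtoQ (2 * qdot (qe 0) p)); [apply qrealC|].
    unfold qdot, qe; qring. }
  transitivity (S - q * ((p + qconj p) * S) + q * (q * ((qconj p * p) * S)))%Q; [qring|].
  rewrite ht, <- (hr S).
  transitivity (S - q * S * p - q * S * qconj p + q * (q * S * (qconj p * p)))%Q; [qring|].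
  rewrite e2, e1; qring. }
assert (hne : symmetrization f q <> RtoQ 0).
{ intros e; rewrite e, qmult0l in main.
  assert (h1 : qmod (q * p) = 1).
  { replace (q * p)%Q with (RtoQ 1 - (RtoQ 1 - q * p))%Q by qring.
    rewrite <- main; replace (RtoQ 1 - RtoQ 0)%Q with (RtoQ 1) by qring.
    rewrite qmodR; apply Rabs_R1. }
  rewrite qmodM in h1; unfold inB in hp, hq.
  pose proof (qmod_ge0 p); pose proof (qmod_ge0 q); nra. }
unfold star_inv; rewrite vc, <- main, qmultA, qinv_l, qmult1l; easy.
Qed.

Lemma reg_moebius_series p : inB p -> reg_moebius p = qPSeries (fblaschke p).
Proof.
intros hp; unfold reg_moebius, fblaschke.
exact (star_expansion _ _ _ _ (star_inv_expansion p hp) (fl_expansion p)).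
Qed.

Lemma fold_star_expansion ts g c : List.Forall inB ts -> contractive c -> has_expansion g c ->
  contractive (fold_left (fun c t => c * fblaschke t)%fps ts c) /\
  has_expansion (fold_left (fun g t => star g (reg_moebius t)) ts g)
    (fold_left (fun c t => c * fblaschke t)%fps ts c).
Proof.
intros hts; revert g c; induction hts as [|t ts ht _ IH]; intros g c hc hg; [easy|].
simpl; assert (hb : contractive (fblaschke t)) by now apply contractive_blaschke, qmod_lt1.
apply IH; [now apply contractive_mul|].
rewrite (star_expansion g (reg_moebius t) c (fblaschke t)); [|easy|].
- now apply contractive_expansion, contractive_mul.
- rewrite reg_moebius_series by easy; now apply contractive_expansion.
Qed.

Lemma fold_left_fprod ts c u :
  (fold_left (fun c t => c * fblaschke t)%fps ts c * fC u = c * fprod ts u)%fps.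
Proof.
revert c; induction ts as [|t ts IH]; intros c; simpl; [easy|].
now rewrite IH, fmulA.
Qed.

Lemma fprod_regular_Blaschke p ts u :
  List.Forall (fun p => qn p < 1) (p :: ts) -> qn u = 1 ->
  regular_Blaschke (qPSeries (fprod (p :: ts) u)).
Proof.
intros h hu.
assert (hB : forall x, qn x < 1 -> inB x) by (intros x; apply qmod_lt1).
assert (hp := hB _ (List.Forall_inv h)).
assert (hts : List.Forall inB ts).
{ apply List.Forall_impl with (2 := List.Forall_inv_tail h); exact hB. }
exists p, ts, u; split; [easy|split; [easy|split; [now apply qmod_eq1|]]].
intros q hq.
assert (hb : contractive (fblaschke p)) by now apply contractive_blaschke, qmod_lt1.
destruct (fold_star_expansion ts (reg_moebius p) (fblaschke p) hts hb) as [hc he].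
{ rewrite reg_moebius_series by easy; now apply contractive_expansion. }
unfold qPSeries at 1; apply qSeries_unique.
apply (is_qser_ext (fun m =>
  term q (fold_left (fun c t => c * fblaschke t)%fps ts (fblaschke p)) m * u)%Q).
- intros m; change (fprod (p :: ts) u) with (fblaschke p * fprod ts u)%fps.
  rewrite <- fold_left_fprod, fmul_C_r; symmetry; apply qmultA.
- now apply is_qser_mul_r, is_series_qser, he.
Qed.

(** * The interpolation problem *)

Lemma moebius_eq a v : qn a < 1 -> qn v <= 1 ->
  ((RtoQ 1 - v * qconj a) * moebius a v)%Q = (v - a)%Q.
Proof.
intros ha hv; unfold moebius; rewrite qmultA, qinv_r, qmult1l; [easy|].
replace (RtoQ 1 - v * qconj a)%Q with (RtoQ 1 + (- v) * qconj a)%Q by qring.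
intros e; apply (f_equal qconj) in e; revert e.
replace (qconj (RtoQ 1 + - v * qconj a)) with (RtoQ 1 + a * (- qconj v))%Q by qring.
rewrite qconjR; apply unit_coef_neq0; [easy|now rewrite qnN, qn_conj].
Qed.

Lemma moebius_inj a v b : qn a < 1 -> qn v <= 1 -> qn b <= 1 ->
  moebius a v = moebius a b -> v = b.
Proof.
intros ha hv hb e.
assert (h1 := moebius_eq a v ha hv); assert (h2 := moebius_eq a b ha hb); rewrite e in h1.
set (m := moebius a b) in *.
assert (k : forall x, ((RtoQ 1 - x * qconj a) * m)%Q = (x - a)%Q ->
  (x * (RtoQ 1 + qconj a * m))%Q = (m + a)%Q).
{ intros x hx; replace (x * (RtoQ 1 + qconj a * m))%Q
    with (x + m - (RtoQ 1 - x * qconj a) * m)%Q by qring.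
  rewrite hx; qring. }
apply k in h1, h2.
apply (qmult_cancel_r (RtoQ 1 + qconj a * m)); [|now rewrite h1].
intros z; rewrite z, qmult0r in h2.
assert (em : m = (- a)%Q).
{ apply qsub_eq0; replace (m - - a)%Q with (m + a)%Q by qring; now symmetry. }
rewrite em in z; replace (RtoQ 1 + qconj a * - a)%Q with (RtoQ 1 - qconj a * a)%Q in z by qring.
rewrite qconj_mult in z; replace (RtoQ 1 - RtoQ (qn a))%Q with (RtoQ (1 - qn a)) in z by qring.
apply RtoQ_inj in z; lra.
Qed.

Lemma moebius_real (r x : R) : r * r < 1 -> x * x < 1 ->
  moebius (RtoQ r) (RtoQ x) = RtoQ ((x - r) / (1 - r * x)).
Proof.
intros hr hx.
assert (hd : 0 < 1 - r * x) by nra.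
apply (qmult_cancel_l (RtoQ 1 - RtoQ x * qconj (RtoQ r))).
- rewrite qconjR; replace (RtoQ 1 - RtoQ x * RtoQ r)%Q with (RtoQ (1 - r * x)) by qring.
  intros e; apply RtoQ_inj in e; lra.
- rewrite moebius_eq by (rewrite qnR; lra); rewrite qconjR.
  replace (RtoQ 1 - RtoQ x * RtoQ r)%Q with (RtoQ (1 - r * x)) by qring.
  rewrite <- RtoQM; replace ((1 - r * x) * ((x - r) / (1 - r * x))) with (x - r) by (field; lra).
  qring.
Qed.

(** The recursion for the quantities Q is the effect of a Schur step on the values. *)
Lemma schur_value_moebius (r x : R) a F F' v w :
  r * r < 1 -> x * x < 1 -> qn a < 1 -> r <> x -> contractive F -> contractive F' ->
  schur r a F F' -> hasval F x v -> hasval F' x w ->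
  moebius a v = (moebius r x * w)%Q /\ w = (/ moebius r x * moebius a v)%Q.
Proof.
intros hr hx ha hne hF hF' hs hv hw.
assert (hv1 : qn v <= 1) by (apply (contractive_value_le F (RtoQ x) v); auto; now rewrite qnR).
assert (e := schur_value r x a F F' v w hr hx ha hF hF' hs hv hw).
assert (hd : 0 < 1 - r * x) by nra.
rewrite moebius_real by easy; set (m := (x - r) / (1 - r * x)).
assert (hm : m <> 0).
{ unfold m, Rdiv; apply Rmult_integral_contrapositive_currified; [lra|].
  apply Rinv_neq_0_compat; lra. }
assert (hx1 : x - r = m * (1 - r * x)) by (unfold m; field; lra).
rewrite hx1 in e.
assert (e' : (v * (RtoQ 1 + qconj a * (m * w)) = m * w + a)%Q).
{ apply (qmult_cancel_l (RtoQ (1 - r * x))); [intros z; apply RtoQ_inj in z; lra|].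
  rewrite RtoQM in e.
  transitivity (v * ((1 - r * x)%R + qconj a * (m * (1 - r * x)%R * w)))%Q; [clear; qring|].
  rewrite e; clear; qring. }
assert (em : moebius a v = (m * w)%Q).
{ apply (qmult_cancel_l (RtoQ 1 - v * qconj a)).
  - replace (RtoQ 1 - v * qconj a)%Q with (qconj (RtoQ 1 + a * (- qconj v))) by qring.
    intros z; apply (f_equal qconj) in z; rewrite qconjK, qconjR in z; revert z.
    apply unit_coef_neq0; [easy|now rewrite qnN, qn_conj].
  - rewrite moebius_eq by easy.
    transitivity (v * (RtoQ 1 + qconj a * (m * w)) - v * qconj a * (m * w) - a)%Q; [clear; qring|].
    rewrite e'; clear; qring. }
split; [easy|].
rewrite em, qmultA, qinv_l, qmult1l; [easy|intros z; now apply RtoQ_inj in z].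
Qed.

Lemma hasval_ex F x : contractive F -> x * x < 1 -> exists v, hasval F (RtoQ x) v.
Proof.
intros hF hx; eexists; apply (hasval_qSeries F (RtoQ x) hF).
unfold inB; apply qmod_lt1; now rewrite qnR.
Qed.

Section Interpolation.
Variables (n : nat) (r : nat -> R) (s : nat -> quat).
Hypothesis (hn : (2 <= n)%nat).
Hypothesis (hr : forall m : nat, (1 <= m <= n)%nat -> -1 < r m < 1).
Hypothesis (hdistinct : forall i j : nat, (1 <= i <= n)%nat -> (1 <= j <= n)%nat ->
     i <> j -> r i <> r j).
Hypothesis (hs : forall m : nat, (1 <= m <= n)%nat -> inB (s m)).

(** The data count as step [0], which makes the recursion uniform in [k]. *)
Definition V (k l : nat) : option quat :=
  match k with O => Some (s l) | _ => Qval r s k l end.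

Lemma V_step k l : (k < n)%nat -> (k < l <= n)%nat ->
  V (S k) l =
      match V k (S k), V k l with
      | Some a, Some b =>
          if excluded_middle_informative (inB a /\ inB b) then
            Some (/ moebius (r (S k)) (r l) * moebius a b)%Q
          else if excluded_middle_informative (a = b /\ in_bdB a) then Some a
          else None
      | _, _ => None
      end.
Proof.
intros hk hl; destruct k as [|k]; [|easy].
change (V 0 1) with (Some (s 1%nat)); change (V 0 l) with (Some (s l)); cbv iota.
destruct (excluded_middle_informative (inB (s 1%nat) /\ inB (s l))) as [_|h].
- reflexivity.
- exfalso; apply h; split; apply hs; lia.
Qed.

Lemma r_sqr m : (1 <= m <= n)%nat -> r m * r m < 1.
Proof. intros h; specialize (hr m h); nra. Qed.

(** The interpolation problem that is left after [k] Schur steps. *)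
Definition level (k : nat) (F : fps) : Prop :=
  contractive F /\
  forall l, (k < l <= n)%nat -> exists v, V k l = Some v /\ hasval F (r l) v.

(** The value at the next point is either inside the ball, where a Schur step is
    possible, or unimodular, and then the series is constant. These are the two
    finite cases in the definition of the quantities Q. *)
Lemma level_down k F : (S k < n)%nat -> level k F -> exists a, V k (S k) = Some a /\
  ((qn a < 1 /\ exists F', level (S k) F' /\ schur (r (S k)) a F F') \/
   (qn a = 1 /\ F = fC a /\ level (S k) F)).
Proof.
intros hk [hF h]; destruct (h (S k) ltac:(lia)) as [a [ea ha]]; exists a; split; [easy|].
assert (hrk := r_sqr (S k) ltac:(lia)).
assert (ha1 : qn a <= 1) by (apply (contractive_value_le F (r (S k))); auto; now rewrite qnR).
destruct (Rle_lt_dec 1 (qn a)) as [h1|h1].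
- right; assert (eF : F = fC a).
  { apply (contractive_unimodular F (r (S k))); auto; now rewrite qnR. }
  split; [lra|split; [easy|split; [easy|]]].
  intros l hl; exists a; destruct (h l ltac:(lia)) as [b [eb hb]].
  assert (hrl := r_sqr l ltac:(lia)).
  assert (b = a) as ->.
  { apply (hasval_unique F (r l)); [now rewrite qnR|easy|rewrite eF; apply hasval_C]. }
  split; [|easy]; rewrite V_step, ea, eb by lia.
  destruct (excluded_middle_informative (inB a /\ inB a)) as [[z _]|_].
  + apply qmod_lt1 in z; lra.
  + destruct (excluded_middle_informative (a = a /\ in_bdB a)) as [_|z]; [easy|].
    exfalso; apply z; split; [easy|]; apply qmod_eq1; lra.
- left; split; [easy|].
  destruct (schur_down (r (S k)) a F hrk h1 hF ha) as [F' [hF' hsch]].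
  exists F'; split; [split; [easy|]|easy].
  intros l hl; destruct (h l ltac:(lia)) as [b [eb hb]].
  assert (hrl := r_sqr l ltac:(lia)).
  assert (hb1 : qn b < 1).
  { destruct (Rle_lt_dec 1 (qn b)) as [z|z]; [|easy]; exfalso.
    assert (eF : F = fC b) by (apply (contractive_unimodular F (r l)); auto; now rewrite qnR).
    assert (a = b).
    { apply (hasval_unique F (r (S k))); [now rewrite qnR|easy|rewrite eF; apply hasval_C]. }
    subst; lra. }
  destruct (hasval_ex F' (r l) hF' hrl) as [w hw].
  exists w; split; [|easy]; rewrite V_step, ea, eb by lia.
  destruct (excluded_middle_informative (inB a /\ inB b)) as [_|z].
  + f_equal; symmetry.
    apply (schur_value_moebius (r (S k)) (r l) a F F' b w); auto.
    apply hdistinct; lia.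
  + exfalso; apply z; split; now apply qmod_lt1.
Qed.

Lemma V_step_some k l c : (k < n)%nat -> (k < l <= n)%nat -> V (S k) l = Some c ->
  exists a b, V k (S k) = Some a /\ V k l = Some b /\
    ((inB a /\ inB b /\ c = (/ moebius (r (S k)) (r l) * moebius a b)%Q) \/
     (qn a = 1 /\ b = a /\ c = a)).
Proof.
intros hk hl; rewrite V_step by easy.
destruct (V k (S k)) as [a|]; [|easy]; destruct (V k l) as [b|]; [|easy].
destruct (excluded_middle_informative (inB a /\ inB b)) as [[h1 h2]|_].
- intros e; injection e as <-; exists a, b; tauto.
- destruct (excluded_middle_informative (a = b /\ in_bdB a)) as [[<- h2]|_];
    [|easy].
  intros e; injection e as <-; exists a, a; apply qmod_eq1 in h2; tauto.
Qed.

(** Conversely a finite value at step [S k] records which of the two cases occurred,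
    and the Schur step can be undone. *)
Lemma level_up k F' : (S k < n)%nat -> level (S k) F' -> exists a, V k (S k) = Some a /\
  ((qn a < 1 /\ exists F, level k F /\ schur (r (S k)) a F F') \/
   (qn a = 1 /\ F' = fC a /\ level k (fC a))).
Proof.
intros hk [hF' h].
assert (hrk := r_sqr (S k) ltac:(lia)).
destruct (h n ltac:(lia)) as [c [ec hc]].
destruct (V_step_some k n c ltac:(lia) ltac:(lia) ec) as [a [b [ea [_ hab]]]].
exists a; split; [easy|].
assert (hall : forall l, (S k < l <= n)%nat -> exists b c, V k l = Some b /\ hasval F' (r l) c /\
    ((qn a < 1 /\ qn b < 1 /\ c = (/ moebius (r (S k)) (r l) * moebius a b)%Q) \/
     (qn a = 1 /\ b = a /\ c = a))).
{ intros l hl; destruct (h l hl) as [c' [ec' hc']].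
  destruct (V_step_some k l c' ltac:(lia) ltac:(lia) ec') as [a' [b' [ea' [eb' hab']]]].
  rewrite ea in ea'; injection ea' as <-.
  exists b', c'; split; [easy|split; [easy|]]; unfold inB in hab'; rewrite !qmod_lt1 in hab'; tauto. }
destruct hab as [[haB [_ _]]|[ha1 [_ ->]]].
- left; apply qmod_lt1 in haB; split; [easy|].
  destruct (schur_up (r (S k)) a F' hrk haB hF') as [F [hF [hsch hFa]]].
  exists F; split; [split; [easy|]|easy].
  intros l hl; destruct (Nat.eq_dec l (S k)) as [->|ne]; [now exists a|].
  destruct (hall l ltac:(lia)) as [b' [c' [eb' [hc' [[_ [hb' e]]|[z _]]]]]]; [|lra].
  exists b'; split; [easy|].
  assert (hrl := r_sqr l ltac:(lia)).
  destruct (hasval_ex F (r l) hF hrl) as [v hv].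
  replace b' with v; [easy|].
  assert (hv1 : qn v <= 1) by (apply (contractive_value_le F (r l)); auto; now rewrite qnR).
  apply (moebius_inj a); auto; [lra|].
  assert (hne : r (S k) <> r l) by (apply hdistinct; lia).
  rewrite (proj1 (schur_value_moebius (r (S k)) (r l) a F F' v c' hrk hrl haB hne hF hF' hsch hv hc')).
  rewrite e, qmultA, qinv_r, qmult1l; [easy|].
  rewrite moebius_real by easy; intros z; apply RtoQ_inj in z.
  assert (0 < 1 - r (S k) * r l) by nra.
  apply (Rmult_eq_compat_r (1 - r (S k) * r l)) in z; unfold Rdiv in z.
  rewrite Rmult_assoc, Rinv_l, Rmult_0_l in z; lra.
- right; split; [easy|split].
  + apply (contractive_unimodular F' (r n)); auto; [|lra].
    rewrite qnR; apply r_sqr; lia.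
  + split; [apply contractive_C; lra|].
    intros l hl; exists a; split; [|apply hasval_C].
    destruct (Nat.eq_dec l (S k)) as [->|ne]; [easy|].
    destruct (hall l ltac:(lia)) as [b' [c' [eb' [_ [[z _]|[_ [-> _]]]]]]]; [lra|easy].
Qed.

Lemma top_level w F : V (n - 1) n = Some w ->
  (level (n - 1) F <-> contractive F /\ hasval F (r n) w).
Proof.
intros ew; split.
- intros [h1 h2]; destruct (h2 n ltac:(lia)) as [v [ev hv]].
  rewrite ew in ev; injection ev as ->; easy.
- intros [h1 h2]; split; [easy|]; intros l hl; replace l with n by lia.
  now exists w.
Qed.

Lemma level_descend F k : (k <= n - 1)%nat -> level 0 F -> exists F', level k F'.
Proof.
intros hk h; induction k as [|k IH]; [now exists F|].
destruct (IH ltac:(lia)) as [G hG].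
destruct (level_down k G ltac:(lia) hG) as [a [_ [[_ [F' [hF' _]]]|[_ [_ hF']]]]]; eauto.
Qed.

Lemma level_ind (P : nat -> Prop) : P (n - 1)%nat ->
  (forall k, (S k < n)%nat -> P (S k) -> P k) -> P 0%nat.
Proof.
intros h0 h; replace 0%nat with (n - 1 - (n - 1))%nat by lia.
enough (hj : forall j, (j <= n - 1)%nat -> P (n - 1 - j)%nat) by (apply hj; lia).
induction j as [|j IH]; intros hj; [now rewrite Nat.sub_0_r|].
apply h; [lia|]; replace (S (n - 1 - S j)) with (n - 1 - j)%nat by lia; apply IH; lia.
Qed.

Lemma level_exists w : V (n - 1) n = Some w -> qn w <= 1 -> exists F, level 0 F.
Proof.
intros ew hw; apply (level_ind (fun k => exists F, level k F)).
- exists (fC w); apply (top_level w); [easy|].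
  split; [now apply contractive_C|apply hasval_C].
- intros k hk [F' hF'].
  destruct (level_up k F' hk hF') as [a [_ [[_ [F [hF _]]]|[_ [_ hF]]]]]; eauto.
Qed.

Lemma level_unique w : V (n - 1) n = Some w -> qn w = 1 ->
  forall F1 F2, level 0 F1 -> level 0 F2 -> F1 = F2.
Proof.
intros ew hw; apply (level_ind (fun k => forall F1 F2, level k F1 -> level k F2 -> F1 = F2)).
- intros F1 F2 h1 h2; apply (top_level w _ ew) in h1, h2.
  assert (hn1 : qn (r n) < 1) by (rewrite qnR; apply r_sqr; lia).
  rewrite (contractive_unimodular F1 (r n) w), (contractive_unimodular F2 (r n) w); try tauto; lra.
- intros k hk IH F1 F2 h1 h2.
  destruct (level_down k F1 hk h1) as [a [ea d1]].
  destruct (level_down k F2 hk h2) as [a' [ea' d2]].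
  rewrite ea in ea'; injection ea' as <-.
  destruct d1 as [[ha [G1 [l1 s1]]]|[ha [e1 _]]];
    destruct d2 as [[ha' [G2 [l2 s2]]]|[ha' [e2 _]]]; try lra; [|now rewrite e1].
  rewrite (IH G1 G2 l1 l2) in s1.
  apply (schur_unique_l (r (S k)) a F1 F2 G2); auto; [apply r_sqr; lia|apply l2].
Qed.

Lemma level_inner w : V (n - 1) n = Some w -> qn w = 1 ->
  exists F d A B, level 0 F /\ inner_pair d F A B.
Proof.
intros ew hw; apply (level_ind (fun k => exists F d A B, level k F /\ inner_pair d F A B)).
- exists (fC w), 0%nat, (fC 1), (fC w); split; [|now apply inner_pair_C].
  apply (top_level w); [easy|]; split; [apply contractive_C; lra|apply hasval_C].
- intros k hk [F' [d [A [B [hF' hp]]]]].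
  destruct (level_up k F' hk hF') as [a [_ [[ha [F [hF hsch]]]|[ha [_ hF]]]]].
  + destruct (inner_pair_schur (r (S k)) a d F F' A B) as [A2 [B2 h2]]; auto.
    * apply r_sqr; lia.
    * apply hF'.
    * now exists F, (S d), A2, B2.
  + exists (fC a), 0%nat, (fC 1), (fC a); split; [easy|now apply inner_pair_C].
Qed.

(** Start from different constants at the last point; undoing a Schur step is
    injective. *)
Lemma level_family w : V (n - 1) n = Some w -> qn w < 1 -> exists Fam : nat -> fps,
  (forall i, level 0 (Fam i)) /\ (forall i i', Fam i = Fam i' -> i = i').
Proof.
intros ew hw; apply (level_ind (fun k => exists Fam : nat -> fps,
  (forall i, level k (Fam i)) /\ (forall i i', Fam i = Fam i' -> i = i'))).
- assert (hrn := r_sqr n ltac:(lia)).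
  set (c := fun i : nat => RtoQ (/ INR (i + 2))).
  assert (hi : forall i : nat, 2 <= INR (i + 2)).
  { intros i; rewrite plus_INR; simpl; pose proof (pos_INR i); lra. }
  assert (hc : forall i, contractive (fC (c i))).
  { intros i; apply contractive_C; unfold c; rewrite qnR; specialize (hi i).
    assert (0 < / INR (i + 2)) by (apply Rinv_0_lt_compat; lra).
    assert (/ INR (i + 2) * INR (i + 2) = 1) by (field; lra); nra. }
  assert (h : forall i, exists F, contractive F /\ schur (r n) w F (fC (c i)) /\ hasval F (r n) w).
  { intros i; now apply schur_up. }
  apply choice in h; destruct h as [Fam h]; exists Fam; split.
  + intros i; apply (top_level w); [easy|]; split; apply h.
  + intros i i' e; destruct (h i) as [h1 [h2 _]]; destruct (h i') as [_ [h3 _]].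
    rewrite <- e in h3; assert (e' := schur_unique_r _ _ _ _ _ hw h1 h2 h3).
    apply fC_inj, RtoQ_inj in e'; apply Rinv_eq_reg, INR_eq in e'; lia.
- intros k hk [Fam' [hF' inj]].
  destruct (level_up k (Fam' 0%nat) hk (hF' 0%nat)) as [a [ea h0]].
  assert (ha : qn a < 1).
  { destruct h0 as [[h0 _]|[h0 [e0 _]]]; [easy|exfalso].
    (* a unimodular [a] would leave a single series *)
    destruct (level_up k (Fam' 1%nat) hk (hF' 1%nat)) as [a' [ea' h1]].
    rewrite ea in ea'; injection ea' as <-.
    destruct h1 as [[h1 _]|[_ [e1 _]]]; [lra|].
    rewrite <- e1 in e0; apply inj in e0; lia. }
  assert (h : forall i, exists F, level k F /\ schur (r (S k)) a F (Fam' i)).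
  { intros i; destruct (level_up k (Fam' i) hk (hF' i)) as [a' [ea' h]].
    rewrite ea in ea'; injection ea' as <-.
    destruct h as [[_ h]|[h _]]; [easy|lra]. }
  apply choice in h; destruct h as [Fam h]; exists Fam; split.
  + intros i; apply h.
  + intros i i' e; destruct (h i) as [h1 h2]; destruct (h i') as [_ h3].
    rewrite <- e in h3; apply inj.
    exact (schur_unique_r _ _ _ _ _ ha (proj1 h1) h2 h3).
Qed.

Lemma level_0_not_unimodular F : level 0 F -> forall u, qn u = 1 -> F <> fC u.
Proof.
intros [hF h] u hu e; destruct (h 1%nat ltac:(lia)) as [v [ev hv]].
injection ev as <-; rewrite e in hv.
assert (h1 : qn (r 1%nat) < 1) by (rewrite qnR; apply r_sqr; lia).
assert (e1 := hasval_unique (fC u) (r 1%nat) u (s 1%nat) h1 (hasval_C u _) hv).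
pose proof (hs 1%nat ltac:(lia)) as h2; rewrite <- e1 in h2; apply qmod_lt1 in h2; lra.
Qed.

(** Values lie in the open ball: a unimodular value would make the series constant,
    against the first datum. *)
Lemma solution_of_level F : level 0 F -> solution n r s (qPSeries F).
Proof.
intros hl; pose proof hl as [hF h]; split; [now apply slice_regular_contractive|split].
- intros q hq; destruct (hasval_qSeries F q hF hq) as [_ hv].
  unfold qPSeries, inB; apply qmod_lt1.
  destruct (Rle_lt_dec 1 (qn (qSeries (term q F)))) as [z|z]; [exfalso|easy].
  assert (hq1 : qn q < 1) by now apply qmod_lt1.
  pose proof (contractive_value_le F q _ hF hq1 hv).
  apply (level_0_not_unimodular F hl (qSeries (term q F))); [lra|].
  now apply (contractive_unimodular F q).
- intros m hm; destruct (h m ltac:(lia)) as [v [ev hv]]; injection ev as <-.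
  assert (hm1 : qn (r m) < 1) by (rewrite qnR; now apply r_sqr).
  apply (hasval_unique F (r m)); auto.
  apply hasval_qSeries; [easy|now apply qmod_lt1].
Qed.

Lemma level_of_solution f : solution n r s f -> exists F, has_expansion f F /\ level 0 F.
Proof.
intros [h1 [h2 h3]]; destruct (slice_regular_expansion f h1) as [F hF]; exists F.
assert (hc : contractive F).
{ apply (bounded_contractive f); auto; intros q hq; left; now apply h2. }
split; [easy|split; [easy|]].
intros l hl; exists (s l); split; [easy|].
assert (hB : inB (r l)) by (apply inB_real, hr; lia).
rewrite <- (h3 l) by lia; apply hasval_qser; auto.
now apply is_series_qser, hF.
Qed.
End Interpolation.

Theorem theorem0p4 (n : nat) (r : nat -> R) (s : nat -> quat)
  (hn : (2 <= n)%nat)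
  (hr : forall m : nat, (1 <= m <= n)%nat -> -1 < r m < 1)
  (hdistinct : forall i j : nat, (1 <= i <= n)%nat -> (1 <= j <= n)%nat ->
     i <> j -> r i <> r j)
  (hs : forall m : nat, (1 <= m <= n)%nat -> inB (s m)) :
  ((exists f : quat -> quat, solution n r s f) <->
   (exists w : quat, Qval r s (n - 1) n = Some w /\ qmod w <= 1)) /\
  (forall w : quat, Qval r s (n - 1) n = Some w -> qmod w < 1 ->
     exists F : nat -> quat -> quat,
       (forall k : nat, solution n r s (F k)) /\
       (forall j k : nat, j <> k -> exists q : quat, inB q /\ F j q <> F k q)) /\
  (forall w : quat, Qval r s (n - 1) n = Some w -> qmod w = 1 ->
     exists f : quat -> quat,
       solution n r s f /\ regular_Blaschke f /\
       (forall g : quat -> quat, solution n r s g ->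
          forall q : quat, inB q -> g q = f q)).
Proof.
assert (eV : Qval r s (n - 1) n = V r s (n - 1) n).
{ unfold V; destruct (n - 1)%nat eqn:e; [lia|easy]. }
rewrite eV; clear eV.
split; [split|split].
- intros [f hf]; destruct (level_of_solution n r s hn hr f hf) as [F [_ hF]].
  destruct (level_descend n r s hn hr hdistinct hs F (n - 1) ltac:(lia) hF) as [G [hG hl]].
  destruct (hl n ltac:(lia)) as [w [ew hw]]; exists w; split; [easy|].
  apply qmod_le1, (contractive_value_le G (r n)); auto.
  rewrite qnR; apply (r_sqr n r hr); lia.
- intros [w [ew hw]]; apply qmod_le1 in hw.
  destruct (level_exists n r s hn hr hdistinct hs w ew hw) as [F hF].
  exists (qPSeries F); now apply solution_of_level.
- intros w ew hw; apply qmod_lt1 in hw.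
  destruct (level_family n r s hn hr hdistinct hs w ew hw) as [Fam [h1 h2]].
  exists (fun k => qPSeries (Fam k)); split.
  + intros k; now apply solution_of_level.
  + intros j k hjk; apply NNPP; intros hno; apply hjk, h2.
    apply (expansion_unique (qPSeries (Fam j)) (qPSeries (Fam k))).
    * now apply contractive_expansion, (h1 j).
    * now apply contractive_expansion, (h1 k).
    * intros x hx; apply NNPP; intros ne; apply hno.
      exists (RtoQ x); split; [now apply inB_real|easy].
- intros w ew hw; apply qmod_eq1 in hw.
  destruct (level_inner n r s hn hr hdistinct hs w ew hw) as [F [d [A [B [hF hp]]]]].
  exists (qPSeries F); split; [now apply solution_of_level|split].
  + destruct (inner_pair_factor d F A B (proj1 hF) hp) as [ts [u [h1 [h2 h3]]]].
    destruct ts as [|p ts].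
    * exfalso; now apply (level_0_not_unimodular n r s hn hr hs F hF u h2).
    * rewrite h3; now apply fprod_regular_Blaschke.
  + intros g hg q hq; destruct (level_of_solution n r s hn hr g hg) as [G [eG hG]].
    assert (e : G = F) by now apply (level_unique n r s hn hr hdistinct hs w ew hw).
    apply (expansion_unique_fun _ _ G); auto.
    rewrite e; now apply contractive_expansion, hF.
Qed.
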